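(* Let $\gamma\in\mathbb R\setminus[-1,0]$ and $1<p<\infty$. Then there is a continuous embedding $$[V^\infty,\dot{BV}]_{\frac1p,1}\hookrightarrow\dot{\mathcal B}^{1/p}_p(\gamma,\infty).$$
   Context: All spaces are over $\mathbb R^d$, $d\ge1$. $V^\infty$ is the quotient space of $L^\infty(\mathbb R^d)$ by constants, with norm $\|f\|_{V^\infty}=\inf_{c\in\mathbb C}\|f-c\|_\infty$. $\dot{BV}$ is the homogeneous space of functions of bounded variation: locally integrable functions, modulo constants, whose distributional gradient is a finite Radon measure, normed by the total variation of the gradient. $[X_0,X_1]_{\theta,r}$ denotes the real interpolation space (Peetre $K_{\theta,r}$ method), with norm $\big(\int_0^\infty(t^{-\theta}K(t,f))^r\frac{dt}{t}\big)^{1/r}$, $K(t,f)=\inf_{f=f_0+f_1}\|f_0\|_{X_0}+t\|f_1\|_{X_1}$. Functions modulo constants in $V^\infty+\dot{BV}$ are identified with elements of $\mathcal S_\infty'(\mathbb R^d)$ via $\phi\mapsto\int f\phi$. Here $\mathcal S_\infty(\mathbb R^d)$ is the space of Schwartz functions whose Fourier transforms vanish to infinite order at $0$, and $\mathcal S_\infty'(\mathbb R^d)$ is its dual (tempered distributions modulo polynomials). Fix a radial $\varphi\in C_c^\infty(\mathbb R^d)$ with $\mathrm{supp}\,\varphi\subset\{3/4<|\xi|<7/4\}$, $\varphi=1$ on $\{7/8\le|\xi|\le9/8\}$ and $\sum_{k\in\mathbb Z}\varphi(2^{-k}\xi)=1$ for $\xi\ne0$; put $\widehat{L_kf}(\xi)=\varphi(2^{-k}\xi)\widehat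 f(\xi)$. For $s\in\mathbb R$, $\dot{\mathcal B}^s_p(\gamma,\infty)$ is the space of $f\in\mathcal S_\infty'(\mathbb R^d)$ for which $$\|f\|_{\dot{\mathcal B}^s_p(\gamma,\infty)}\approx\sup_{\lambda>0}\lambda\Big[\sum_{k\in\mathbb Z}2^{-k\gamma}\,\mathrm{meas}\{x\in\mathbb R^d:|L_kf(x)|>\lambda2^{-k(s+\gamma/p)}\}\Big]^{1/p}$$ is finite, that is, $(x,k)\mapsto2^{k(s+\gamma/p)}L_kf(x)$ lies in weak $L^p$ on $\mathbb R^d\times\mathbb Z$ with respect to the measure $\mu_\gamma(E)=\sum_k2^{-k\gamma}\int\mathbf 1_E(x,k)dx$. *)

(* Defs.v *)
From HB Require Import structures.
From mathcomp Require Import all_boot all_order all_algebra.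
From mathcomp Require Import all_classical all_reals all_analysis.
From mathcomp Require Import complex.
Set Implicit Arguments.
Unset Strict Implicit.
Unset Printing Implicit Defensive.

Import Order.TTheory GRing.Theory Num.Theory.
Import numFieldNormedType.Exports.
Local Open Scope classical_set_scope.
Local Open Scope ring_scope.
Local Open Scope complex_scope.

(* Points of R^d are row vectors 'rV[R]_d. They carry the Borel sigma-algebra,
   generated by the coordinate functions, and Lebesgue measure lebesgue_rV,
   built as an iterated product and characterized by lebesgue_rV_box. *)
Definition rV_display : measure_display. Proof. exact. Qed.

Section measurable_rV.
Context {R : realType} {d : nat}.
Let coord (i : 'I_d) (x : 'rV[R]_d) : measurableTypeR R := x ord0 i.

Let rV_set0 : g_sigma_preimage coord set0.
Proof. exact: sigma_algebra0. Qed.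

Let rV_setC A : g_sigma_preimage coord A -> g_sigma_preimage coord (~` A).
Proof. exact: sigma_algebraC. Qed.

Let rV_bigcup (F : (set 'rV[R]_d)^nat) :
  (forall i, g_sigma_preimage coord (F i)) ->
  g_sigma_preimage coord (\bigcup_i (F i)).
Proof. exact: sigma_algebra_bigcup. Qed.

HB.instance Definition _ := @isMeasurable.Build rV_display
  'rV[R]_d (g_sigma_preimage coord) rV_set0 rV_setC rV_bigcup.

Lemma measurable_coord i : measurable_fun setT (coord i).
Proof.
move=> _ Y mY; rewrite setTI; apply: sub_sigma_algebra => /=.
rewrite -bigcup_seq/=; exists i => /=; first by rewrite mem_index_enum.
by exists Y => //; rewrite setTI.
Qed.

Lemma measurable_fun_rV d1 (T1 : measurableType d1) (f : T1 -> 'rV[R]_d) :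
  (forall i, measurable_fun setT (coord i \o f)) -> measurable_fun setT f.
Proof.
move=> mf.
apply: (@measurability _ _ _ _ setT f (\big[setU/set0]_(i < d)
  preimage_set_system setT (coord i) measurable)) => //.
move=> _ [B + <-].
rewrite -bigcup_seq/= => -[i _ [C mC <-]].
by rewrite setTI; exact: mf.
Qed.
End measurable_rV.


Section lebesgue_rV.
Context {R : realType}.

Section step.
Variable d : nat.
Definition cons_rV (ty : measurableTypeR R * 'rV[R]_d) : 'rV[R]_d.+1 :=
  \row_i (if unlift ord0 i is Some j then ty.2 ord0 j else ty.1).

Lemma cons_rV0 ty : cons_rV ty ord0 ord0 = ty.1.
Proof. by rewrite mxE unlift_none. Qed.

Lemma cons_rVS ty i : cons_rV ty ord0 (lift ord0 i) = ty.2 ord0 i.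
Proof. by rewrite mxE liftK. Qed.

Lemma measurable_cons_rV : measurable_fun setT cons_rV.
Proof.
apply: measurable_fun_rV => i.
have [->|[j ->]] : i = ord0 \/ exists j, i = lift ord0 j.
- by case: (unliftP ord0 i) => [j|] ->; [right; exists j|left].
- rewrite [X in measurable_fun _ X](_ : _ = fst); last first.
    by apply/funext => ty /=; rewrite cons_rV0.
  exact: measurable_fst.
- rewrite [X in measurable_fun _ X](_ : _ =
    (fun y : 'rV[R]_d => y ord0 j : measurableTypeR R) \o snd); last first.
    by apply/funext => ty /=; rewrite cons_rVS.
  by apply: measurableT_comp; [exact: measurable_coord|exact: measurable_snd].
Qed.

Variable m : {sigma_finite_measure set 'rV[R]_d -> \bar R}.

Definition lebesgue_rVS : set 'rV[R]_d.+1 -> \bar R :=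
  pushforward (product_measure1 (@lebesgue_measure R) m) cons_rV.

HB.instance Definition _ := Measure.copy lebesgue_rVS
  (measure_function_pushforward__canonical__measure_function_Measure
    (product_measure1 (@lebesgue_measure R) m) measurable_cons_rV).

Let lebesgue_rVS_sigma_finite : sigma_finite setT lebesgue_rVS.
Proof.
have /sigma_finiteP[F [TF ndF Foo]] := sigma_finiteT (@lebesgue_measure R).
have /sigma_finiteP[G [TG ndG Goo]] := sigma_finiteT m.
pose tl (x : 'rV[R]_d.+1) : measurableTypeR R * 'rV[R]_d :=
  (x ord0 ord0, \row_i x ord0 (lift ord0 i)).
have tlK : cancel cons_rV tl.
  move=> [t y]; congr (_, _); first by rewrite cons_rV0.
  by apply/rowP => i; rewrite mxE cons_rVS.
have mtl : measurable_fun setT tl.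
  apply/measurable_fun_pairP; split; first exact: measurable_coord.
  apply: measurable_fun_rV => i.
  rewrite [X in measurable_fun _ X](_ : _ =
    (fun y : 'rV[R]_d.+1 => y ord0 (lift ord0 i) : measurableTypeR R)).
    exact: measurable_coord.
  by apply/funext => x /=; rewrite mxE.
exists (fun k => tl @^-1` (F k `*` G k)).
  rewrite -preimage_bigcup (_ : \bigcup_k _ = setT) ?preimage_setT//.
  apply/seteqP; split => // -[x y] _.
  have [i _ Fx] : (\bigcup_i F i) x by rewrite -TF.
  have [j _ Gy] : (\bigcup_i G i) y by rewrite -TG.
  exists (maxn i j) => //; split.
    by move: Fx; exact/subsetPset/ndF/leq_maxl.
  by move: Gy; exact/subsetPset/ndG/leq_maxr.
move=> k; have [mFk Fkoo] := Foo k; have [mGk Gkoo] := Goo k; split.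
  by rewrite -[X in measurable X]setTI; apply: mtl => //; exact: measurableX.
rewrite /lebesgue_rVS /pushforward -comp_preimage.
rewrite (_ : tl \o cons_rV = id); last by apply/funext => x /=; rewrite tlK.
by rewrite preimage_id product_measure1E// lte_mul_pinfty// ge0_fin_numE.
Qed.

HB.instance Definition _ := @Measure_isSigmaFinite.Build _ _ _
  lebesgue_rVS lebesgue_rVS_sigma_finite.

End step.

Fixpoint lebesgue_rV (d : nat) :
    {sigma_finite_measure set 'rV[R]_d -> \bar R} :=
  if d is d'.+1 then lebesgue_rVS (lebesgue_rV d') else dirac (0 : 'rV[R]_0).

Lemma lebesgue_rV_box d (A : 'I_d -> set (measurableTypeR R)) :
  (forall i, measurable (A i)) ->
  lebesgue_rV d [set x | forall i, A i (x ord0 i)] =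
  (\prod_(i < d) lebesgue_measure (A i))%E.
Proof.
elim: d A => [|d IH] A mA.
  by rewrite big_ord0 /= diracE mem_set// => -[].
rewrite big_ord_recl -IH//= /lebesgue_rVS /pushforward.
rewrite (_ : _ @^-1` _ = A ord0 `*`
    [set y : 'rV[R]_d | forall i, A (lift ord0 i) (y ord0 i)]).
  rewrite product_measure1E//.
  rewrite (_ : mkset _ = \bigcap_(i in [set: 'I_d])
      ((fun y : 'rV[R]_d => y ord0 i : measurableTypeR R) @^-1`
        A (lift ord0 i))).
    apply: fin_bigcap_measurable => // i _.
    by rewrite -[X in measurable X]setTI; exact: measurable_coord.
  by apply/seteqP; split => y /= Ay i => [_|]; exact: Ay.
apply/seteqP; split => -[t y] /= Aty.
  split=> [|i]; first by have := Aty ord0; rewrite cons_rV0.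
  by have := Aty (lift ord0 i); rewrite cons_rVS.
move=> i; have [j ->|->] := unliftP ord0 i.
  by rewrite cons_rVS; exact: Aty.2.
by rewrite cons_rV0; exact: Aty.1.
Qed.

End lebesgue_rV.

Section complex_analysis.
Context {R : realType} {d : nat}.
Local Notation C := R[i].
Local Notation V := 'rV[R]_d.
Local Notation mu := (lebesgue_rV d).
Implicit Types (f g : V -> C) (x y xi : V).

Definition cmeasurable f :=
  measurable_fun setT (fun x => complex.Re (f x)) /\
  measurable_fun setT (fun x => complex.Im (f x)).

Definition cintegrable_on (D : set V) f :=
  mu.-integrable D (fun x => (complex.Re (f x))%:E) /\
  mu.-integrable D (fun x => (complex.Im (f x))%:E).

Definition cintegral f : C :=
  (\int[mu]_x complex.Re (f x)) +i* (\int[mu]_x complex.Im (f x)).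

(* Iterated partial derivative; the multi-index is the list of the directions
   of differentiation. *)
Fixpoint pderiv (s : seq 'I_d) (h : V -> R) : V -> R :=
  if s is i :: s' then fun x => 'D_(delta_mx ord0 i) (pderiv s' h) x else h.

Definition smooth (h : V -> R) := forall s : seq 'I_d,
  continuous (pderiv s h) /\
  forall (i : 'I_d) x, derivable (pderiv s h) x (delta_mx ord0 i).

Definition cpderiv (s : seq 'I_d) f x : C :=
  pderiv s (fun y => complex.Re (f y)) x +i*
  pderiv s (fun y => complex.Im (f y)) x.

Definition csmooth f :=
  smooth (fun x => complex.Re (f x)) /\ smooth (fun x => complex.Im (f x)).

Definition test_function f := csmooth f /\ compact (closure [set x | f x != 0]).

Definition dot x y : R := \sum_(i < d) x ord0 i * y ord0 i.

Definition enorm x : R := Num.sqrt (dot x x).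

Definition cexpi (t : R) : C := cos t +i* sin t.

(* Fourier transform with the convention that the inversion formula carries
   the factor (2 pi)^-d. *)
Definition fourier f xi : C := cintegral (fun x => f x * cexpi (- dot x xi)).

Definition schwartz_norm (N : nat) f : \bar R :=
  ereal_sup [set y | exists s x, (size s <= N)%N /\
    y = ((1 + enorm x) ^+ N * Normc.normc (cpderiv s f x))%:E].

Definition schwartz f :=
  csmooth f /\ forall N, (schwartz_norm N f < +oo)%E.

Definition schwartz_infty f :=
  schwartz f /\ forall s : seq 'I_d, cpderiv s (fourier f) 0 = 0.

(* A functional is given on all functions, but only its values on
   schwartz_infty are meaningful. Continuity for the topology defined by the
   increasing family of norms schwartz_norm N is boundedness by one of them. *)
Definition schwartz_infty_dual (u : (V -> C) -> C) :=
  (forall (a : C) f g, schwartz_infty f -> schwartz_infty g ->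
    u (fun x => a * f x + g x) = a * u f + u g) /\
  exists (N : nat) (c : R), forall f, schwartz_infty f ->
    ((Normc.normc (u f))%:E <= c%:E * schwartz_norm N f)%E.

Definition pairing f (psi : V -> C) : C := cintegral (fun x => f x * psi x).

End complex_analysis.

Section interpolation.
Context {R : realType} {E : zmodType}.
(* Elements of E represent the points of an ambient space, with equality eqv;
   X0 and X1 are subspaces with norms N0 and N1. *)
Variables (eqv : E -> E -> Prop) (X0 X1 : set E) (N0 N1 : E -> \bar R).

Definition K_functional (t : R) (f : E) : \bar R :=
  ereal_inf [set y | exists f0 f1, [/\ X0 f0, X1 f1, eqv f (f0 + f1) &
    y = (N0 f0 + t%:E * N1 f1)%E]].

Definition interp_norm (theta r : R) (f : E) : \bar R :=
  ((\int[lebesgue_measure]_(t in `]0%R, +oo[)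
    (((t `^ (- theta))%:E * K_functional t f) `^ r * (t^-1)%:E)) `^ r^-1)%E.

Definition interp_space (theta r : R) : set E :=
  [set f | (exists f0 f1, [/\ X0 f0, X1 f1 & eqv f (f0 + f1)]) /\
    (interp_norm theta r f < +oo)%E].

End interpolation.

Section Vinfty_BV.
Context {R : realType} {d : nat}.
Local Notation C := R[i].
Local Notation V := 'rV[R]_d.
Local Notation mu := (lebesgue_rV d).
Implicit Types (f g : V -> C) (x : V).

(* Elements of the spaces of functions modulo constants are represented by
   functions; this is equality of the elements they represent. *)
Definition eq_mod_const f g :=
  exists c : C, {ae mu, forall x, f x = g x + c}.

Definition Vinfty_norm f : \bar R :=
  ereal_inf [set 'N[mu]_+oo[(fun x => (Normc.normc (f x - c)%R)%:E)]%E
    | c in [set: C]].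

Definition Vinfty : set (V -> C) :=
  [set f | cmeasurable f /\ (Vinfty_norm f < +oo)%E].

Definition charge_integral (nu : {charge set V -> \bar R}) (h : V -> R) : R :=
  let HP := cid (Hahn_decomposition nu) in
  let HN := cid (projT2 HP) in
  \int[jordan_pos (projT2 HN)]_x h x - \int[jordan_neg (projT2 HN)]_x h x.

(* The pair (a, b) represents the complex Borel measure a + i b. *)
Definition cmeasure :=
  ({charge set V -> \bar R} * {charge set V -> \bar R})%type.

Definition cmeasure_integral (nu : cmeasure) f : C :=
  (charge_integral nu.1 (fun x => complex.Re (f x)) -
   charge_integral nu.2 (fun x => complex.Im (f x))) +i*
  (charge_integral nu.1 (fun x => complex.Im (f x)) +
   charge_integral nu.2 (fun x => complex.Re (f x))).

(* C^d-valued Borel measures, given by their components. *)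
Definition vmeasure := 'I_d -> cmeasure.

Definition vmeasure_norm (nu : vmeasure) (A : set V) : R :=
  Num.sqrt (\sum_(i < d)
    ((fine ((nu i).1 A)) ^+ 2 + (fine ((nu i).2 A)) ^+ 2)).

Definition vmeasure_variation (nu : vmeasure) : \bar R :=
  ereal_sup [set y | exists F : (set V)^nat,
    [/\ forall k, measurable (F k), trivIset [set: nat] F,
        \bigcup_k F k = [set: V] &
        y = (\sum_(0 <= k <oo) (vmeasure_norm nu (F k))%:E)%E]].

Definition distributional_gradient f (nu : vmeasure) :=
  forall (i : 'I_d) (psi : V -> C), test_function psi ->
    cintegral (fun x => f x * cpderiv [:: i] psi x) =
    - cmeasure_integral (nu i) psi.

Definition clocally_integrable f :=
  cmeasurable f /\ forall K : set V, compact K -> cintegrable_on K f.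

Definition BVdot : set (V -> C) :=
  [set f | clocally_integrable f /\ exists nu, distributional_gradient f nu].

(* The distributional gradient of f is unique, so this is its total
   variation. *)
Definition BVdot_norm f : \bar R :=
  ereal_inf [set vmeasure_variation nu | nu in distributional_gradient f].

Definition VBV_norm (theta r : R) (f : V -> C) : \bar R :=
  interp_norm eq_mod_const Vinfty BVdot Vinfty_norm BVdot_norm theta r f.

Definition VBV_space (theta r : R) : set (V -> C) :=
  [set f | cmeasurable f /\
    interp_space eq_mod_const Vinfty BVdot Vinfty_norm BVdot_norm theta r f].

End Vinfty_BV.

Section besov.
Context {R : realType} {d : nat}.
Local Notation C := R[i].
Local Notation V := 'rV[R]_d.
Local Notation mu := (lebesgue_rV d).

(* By cutoff_support the family summed in cutoff_sum has finite support, so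
   that \sum_(k \in _), which ranges over the support, is the whole sum. *)
Record dyadic_cutoff (phi : V -> C) : Prop := {
  cutoff_smooth : csmooth phi;
  cutoff_radial : forall xi eta, enorm xi = enorm eta -> phi xi = phi eta;
  cutoff_support : closure [set xi | phi xi != 0] `<=`
    [set xi | 3 / 4 < enorm xi < 7 / 4];
  cutoff_eq1 : forall xi, 7 / 8 <= enorm xi <= 9 / 8 -> phi xi = 1;
  cutoff_sum : forall xi, xi != 0 ->
    \sum_(k \in [set: int]) phi ((2 ^ (- k)) *: xi) = 1 }.

(* lp_kernel phi k x is the function y |-> (F^-1 [phi (2^-k .)]) (x - y), so
   that lp_piece phi k u is the smooth function u * F^-1 [phi (2^-k .)], which
   is the inverse Fourier transform of phi (2^-k .) times that of u. *)
Definition lp_kernel (phi : V -> C) (k : int) (x y : V) : C :=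
  ((2 * pi) ^- d)%:C *
  cintegral (fun xi => phi ((2 ^ (- k)) *: xi) * cexpi (dot (x - y) xi)).

Definition lp_piece (phi : V -> C) (k : int) (u : (V -> C) -> C) (x : V) : C :=
  u (lp_kernel phi k x).

Definition besov_norm (phi : V -> C) (s p gamma : R) (u : (V -> C) -> C) :
    \bar R :=
  ereal_sup [set (lambda%:E * (\esum_(k in [set: int])
      ((2 `^ (- (k%:~R * gamma)))%:E *
       mu [set x | (lambda * 2 `^ (- (k%:~R * (s + gamma / p))) <
                    Normc.normc (lp_piece phi k u x))%R])) `^ p^-1)%E
    | lambda in `]0, +oo[].

Definition besov (phi : V -> C) (s p gamma : R) : set ((V -> C) -> C) :=
  [set u | schwartz_infty_dual u /\ (besov_norm phi s p gamma u < +oo)%E].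

End besov.

(* Main.v *)
Require Import Defs.
From HB Require Import structures.
From mathcomp Require Import all_boot all_order all_algebra.
From mathcomp Require Import all_classical all_reals all_analysis.
From mathcomp Require Import complex.
From mathcomp Require Import measurable_realfun ess_sup_inf ring lra.

(* Write f = f0 + f1 with f0 bounded (modulo constants) by A and grad f1 of
   total variation M. The kernel of L_k is 2^(kd) K(2^k .) with K a Schwartz
   function of integral 0, so |L_k f0| <= C A everywhere, and, since
   int |f1(x + h) - f1(x)| dx <= C M |h|, the L1 norm of L_k f1 is at most
   C 2^-k M. By Chebyshev, if K(t, f) < kappa tau then
   meas{|L_k f| > tau} <= C 2^-k / t.

   For tau_k = lambda 2^(-k (1 + gamma)/p) let t_k be the dyadic threshold up to
   which K(t, f) < kappa tau_k. Summing the resulting bounds over the k that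
   share the same t_k gives a geometric series in 2^(-k (1 + gamma)), of ratio
   different from 1 because gamma <> -1. It is comparable to its largest term,
   which is at most C (K(2 t_k, f) / lambda)^p. What remains is the sum of
   (2^(-j/p) K(2^j, f))^p over dyadic 2^j, which is at most the p-th power of the
   corresponding l^1 sum, that is, of the norm in [V^oo, BV]_{1/p,1}.

   That f is determined modulo constants by its pairings with S_oo is proved as
   follows. If h annihilates the Fourier transforms of test functions vanishing
   near 0, then h * Phi_r, where Phi_r has the Fourier transform chi(./r) for a
   cutoff chi equal to 1 near 0, does not depend on r. Letting r -> 0, the
   decomposition of h shows that h * Phi_r is constant; letting r -> oo,
   h * Phi_r tends to a multiple of h. *)

Set Implicit Arguments.
Unset Strict Implicit.
Unset Printing Implicit Defensive.
Import Order.TTheory GRing.Theory Num.Theory.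
Import numFieldNormedType.Exports.
Local Open Scope classical_set_scope.
Local Open Scope ring_scope.
Local Open Scope complex_scope.

(** After the decomposition, all that is used of f1 is the L1 bound on its translates. Constants do
    not affect that bound, so it is compatible with working modulo constants, and it already makes
    f1 integrable against (1 + |x|)^-(2d+1); this gives a meaning to every pairing with f.

    Since f1 need not be differentiable, the bound is proved by duality: derivatives and
    translations are put on test functions. The auxiliary functions are built from the given [phi]
    and from sigmoids of coordinates, so no bump function has to be constructed.

    Fourier transforms are handled as real integrals of g(xi) cos(x.xi + th). Differentiation and
    integration by parts shift the phase th by pi/2, so one real family covers real and imaginary
    parts and all derivatives. Inversion is used at the origin only, up to a nonzero factor, and the
    value of that factor is never computed. *)

(** * Affine changes of variables for nonnegative integrals *)

Section affine_change.
Context {R : realType}.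

(** The image of Lebesgue measure under x |-> a x + b, multiplied by |a|, agrees with Lebesgue
    measure on the intervals ]x, y], hence everywhere. For a < 0 the preimage of such an interval is
    closed on the left instead, which does not change its length. *)
Lemma ge0_integral_affine1 (a b : R) (f : R -> \bar R) : a != 0 ->
  measurable_fun setT f -> (forall x, 0 <= f x)%E ->
  (\int[lebesgue_measure]_x f (a * x + b)%R =
   (`|a|^-1)%:E * \int[lebesgue_measure]_x f x)%E.
Proof.
move=> a0 mf f0.
pose g : measurableTypeR R -> measurableTypeR R := fun x => a * x + b.
have mg : measurable_fun setT g.
  apply: measurable_funD => //; apply: measurable_funM => //.
have na0 : (0 <= `|a|)%R by [].
pose nu := mscale (NngNum na0)
  (measure_function_pushforward__canonical__measure_function_Measure
    (@lebesgue_measure R) mg).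
have nuE A : measurable A -> lebesgue_measure A = nu A.
  apply: lebesgue_measure_unique => _ [[x y]] _ <-.
  rewrite /nu/= /mscale/= /pushforward.
  have := ltrgt0P a; case => [a_gt0|a_lt0|]; last by move/eqP; rewrite (negPf a0).
  - rewrite (_ : _ @^-1` _ = `](x - b) / a, (y - b) / a]%classic); last first.
      apply/seteqP; split => z /=; rewrite !in_itv/= /g ltr_pdivrMr// ler_pdivlMr//;
      by rewrite ltrBlDr lerBrDr (mulrC z).
    rewrite !lebesgue_measure_itv/= !lte_fin ltr_pM2r ?invr_gt0// ltrBlDr subrK.
    case: ifP => _; last by rewrite mule0.
    by rewrite -EFinB -EFinM; congr EFin; field; rewrite gt_eqF.
  - rewrite (_ : _ @^-1` _ = `[(y - b) / a, (x - b) / a[%classic); last first.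
      apply/seteqP; split => z /=; rewrite !in_itv/= /g ltr_ndivlMr// ler_ndivrMr//;
      by rewrite ltrBlDr lerBrDr (mulrC z) andbC.
    rewrite !lebesgue_measure_itv/= !lte_fin ltr_nM2r ?invr_lt0// ltrBlDr subrK.
    case: ifP => _; last by rewrite mule0.
    by rewrite -EFinB -EFinM; congr EFin; field; rewrite lt_eqF.
have -> : (\int[lebesgue_measure]_x f x = `|a|%:E * \int[lebesgue_measure]_x f (g x))%E.
  rewrite (eq_measure_integral nu); last by move=> A mA _; exact: nuE.
  rewrite ge0_integral_mscale//; congr (_ * _)%E.
  by rewrite ge0_integral_pushforward//.
by rewrite muleA -EFinM mulVf ?mul1e// normr_eq0.
Qed.

(** Tonelli for one step of the recursion that defines [lebesgue_rV]; it carries the inductions on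
    the dimension. *)
Lemma ge0_integral_cons (d : nat) (m : {sigma_finite_measure set 'rV[R]_d -> \bar R})
   (f : 'rV[R]_d.+1 -> \bar R) :
  measurable_fun setT f -> (forall x, 0 <= f x)%E ->
  (\int[lebesgue_rVS m]_x f x =
   \int[lebesgue_measure]_t \int[m]_y f (cons_rV (t, y)))%E.
Proof.
move=> mf f0.
rewrite ge0_integral_pushforward//; last exact: measurable_cons_rV.
rewrite preimage_setT.
rewrite fubini_tonelli1//.
  by apply: measurableT_comp => //; exact: measurable_cons_rV.
by move=> x; exact: f0.
Qed.

Lemma measurable_affine d (a : R) (b : 'rV[R]_d) :
  measurable_fun setT (fun x : 'rV[R]_d => a *: x + b).
Proof.
apply: measurable_fun_rV => i.
rewrite (_ : _ \o _ = fun x : 'rV[R]_d => a * (x ord0 i : measurableTypeR R) + b ord0 i).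
  apply: measurable_funD => //; apply: measurable_funM => //.
  exact: measurable_coord.
by apply/funext => x /=; rewrite !mxE.
Qed.

Lemma ge0_integral_affine d (a : R) (b : 'rV[R]_d) (f : 'rV[R]_d -> \bar R) :
  a != 0 -> measurable_fun setT f -> (forall x, 0 <= f x)%E ->
  (\int[lebesgue_rV d]_x f (a *: x + b)%R =
   (`|a|^-1 ^+ d)%:E * \int[lebesgue_rV d]_x f x)%E.
Proof.
move=> a0; elim: d b f => [|d IH] b f mf f0.
  rewrite expr0 mul1e; apply: eq_integral => x _; congr f.
  by rewrite (thinmx0 x) (thinmx0 (_ + _)).
rewrite [in LHS]/= [in RHS]/= !ge0_integral_cons//; last first.
  by apply: measurableT_comp => //; exact: measurable_affine.
have mfc : measurable_fun setT (fun ty : measurableTypeR R * 'rV[R]_d => f (cons_rV ty)).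
  by apply: measurableT_comp => //; exact: measurable_cons_rV.
pose b' : 'rV[R]_d := \row_i b ord0 (lift ord0 i).
pose G t := (\int[lebesgue_rV d]_y f (cons_rV (t, y)))%E.
have mG : measurable_fun setT G.
  exact: (measurable_fun_fubini_tonelli_F (fun ty : measurableTypeR R * 'rV[R]_d => f (cons_rV ty))).
have G0 t : (0 <= G t)%E by apply: integral_ge0 => y _; exact: f0.
rewrite (eq_integral (fun t : measurableTypeR R => (`|a|^-1 ^+ d)%:E * G (a * t + b ord0 ord0)%R)%E); last first.
  move=> t _; rewrite /G -(IH b' (fun y => f (cons_rV (a * t + b ord0 ord0, y)))).
  - apply: eq_integral => y _; congr f; apply/rowP => i; rewrite !mxE /=.
    by case: unliftP => [j ->|->] //; rewrite !mxE.
  - by apply: measurableT_comp => //; apply: measurableT_comp => //; exact: measurable_cons_rV.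
  - by move=> y; exact: f0.
rewrite ge0_integralZl.
- by rewrite ge0_integral_affine1// exprSr EFinM muleA.
- exact: measurableT.
- apply: (measurableT_comp mG).
  by apply: measurable_funD => //; exact: measurable_funM.
- by move=> t _; exact: G0.
- by rewrite lee_fin exprn_ge0.
Qed.

End affine_change.

(** * Max norm, open sets and measurability on row vectors *)

Section rV_norm.
Context {R : realType} {d : nat}.
Implicit Types x y : 'rV[R]_d.

Lemma coord_le_norm x i : `|x ord0 i| <= `|x|.
Proof.
rewrite [leRHS]/Num.norm /= mx_normrE; apply/bigmax_geP; right => /=.
by exists (ord0, i).
Qed.

Lemma norm_le_coord x r : 0 <= r -> (forall i, `|x ord0 i| <= r) -> `|x| <= r.
Proof.
move=> r0 xr; rewrite [leLHS]/Num.norm /= mx_normrE; apply/bigmax_leP; split => //.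
by move=> [i j] _ /=; rewrite (ord1 i).
Qed.

Lemma norm_lt_coord x r : 0 < r -> (forall i, `|x ord0 i| < r) -> `|x| < r.
Proof.
move=> r0 xr; rewrite [ltLHS]/Num.norm /= mx_normrE; apply/bigmax_ltP; split => //.
by move=> [i j] _ /=; rewrite (ord1 i).
Qed.

(** The sigma-algebra is generated by the coordinates, not by the open sets. An open set is the
    union of the boxes with rational centre and rational half-width that it contains, and these are
    countably many. *)
Lemma open_measurable_rV (A : set 'rV[R]_d) : open A -> measurable A.
Proof.
move=> oA.
pose b (qr : 'rV[rat]_d * rat) : set 'rV[R]_d :=
  [set x | forall i, `|x ord0 i - ratr (qr.1 ord0 i)| < ratr qr.2].
have mb qr : measurable (b qr).
  rewrite (_ : b qr = \bigcap_(i in [set: 'I_d])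
    (fun x : 'rV[R]_d => x ord0 i : measurableTypeR R) @^-1`
    [set t | `|t - ratr (qr.1 ord0 i)| < ratr qr.2]).
    apply: fin_bigcap_measurable => // i _.
    rewrite -[X in measurable X]setTI; apply: measurable_coord => //.
    rewrite (_ : mkset _ = ball (ratr (qr.1 ord0 i) : R) (ratr qr.2)); first exact: measurable_ball.
    by apply/seteqP; split => t /=; rewrite /ball/= distrC.
  by apply/seteqP; split => y /= yb i => [_|]; exact: yb.
rewrite (_ : A = \bigcup_(qr in [set qr | b qr `<=` A]) b qr).
  by rewrite bigcup_mkcond; apply: countable_bigcupT_measurable => // qr; case: ifP.
apply/seteqP; split => [x Ax|x [qr /= bA /bA//]].
have /nbhs_ballP[e /= e0 xeA] : nbhs x A by exact: open_nbhs_nbhs.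
have /rat_in_itvoo[r /=] : 0 < e / 2 :> R by rewrite divr_gt0.
rewrite in_itv/= => /andP[r0 re].
have /choice[q xq] : forall i, exists q : rat, `|x ord0 i - ratr q| < ratr r.
  move=> i; have /rat_in_itvoo[q] : x ord0 i - ratr r < x ord0 i + ratr r.
    by rewrite ltrD2l gtrN.
  by rewrite in_itv/= => qx; exists q; rewrite distrC ltr_distl.
exists (\row_i q i, r); last by move=> i /=; rewrite mxE; exact: xq.
move=> y /= yb; apply: xeA; rewrite -ball_normE /ball_/=.
apply: norm_lt_coord => // i; rewrite !mxE.
have := yb i; rewrite mxE /= => yi.
rewrite (le_lt_trans (ler_distD (ratr (q i)) _ _))// (splitr e) ltrD//.
  by rewrite (lt_trans (xq i)).
by rewrite distrC (lt_trans yi).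
Qed.

Lemma continuous_measurable_rV (f : 'rV[R]_d -> R) : continuous f -> measurable_fun setT f.
Proof.
move=> /continuousP cf; apply: (measurability _ (RGenOpens.measurableE R)).
move=> _ [_ [a [b ->] <-]]; rewrite setTI; apply: open_measurable_rV.
exact/cf/interval_open.
Qed.

End rV_norm.

(** * Real integrals: affine maps, domination, Fubini *)

Section integral_affine.
Context {R : realType} {d : nat}.
Local Notation V := 'rV[R]_d.
Local Notation mu := (lebesgue_rV d).

Lemma integrable_affine (a : R) (b : V) (f : V -> R) : a != 0 ->
  mu.-integrable setT (EFin \o f) -> mu.-integrable setT (EFin \o (fun x => f (a *: x + b))).
Proof.
move=> a0 /integrableP[mf foo].
have mf' : measurable_fun setT (fun x : V => (f (a *: x + b))%:E).
  by apply: (measurableT_comp mf); exact: measurable_affine.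
apply/integrableP; split => //.
rewrite (ge0_integral_affine b (f := fun x => `|(f x)%:E|%E))//.
- by rewrite lte_mul_pinfty.
- exact: measurableT_comp.
Qed.

Lemma Rintegral_affine (a : R) (b : V) (f : V -> R) : a != 0 ->
  mu.-integrable setT (EFin \o f) ->
  \int[mu]_x f (a *: x + b) = `|a|^-1 ^+ d * \int[mu]_x f x.
Proof.
move=> a0 fi; have mf := measurable_int mu fi.
have := integrable_affine b a0 fi => fi'.
rewrite /Rintegral [in LHS]integralE [in RHS]integralE.
rewrite (_ : (\int[mu]_x ((fun x => (f (a *: x + b))%:E)^\+)%E x)%E =
   ((`|a|^-1 ^+ d)%:E * \int[mu]_x ((fun x => (f x)%:E)^\+)%E x)%E); last first.
  rewrite -(ge0_integral_affine b (f := ((fun x => (f x)%:E)^\+)%E))//.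
    by apply: eq_integral => x _; rewrite !funeposE.
  exact: measurable_funepos.
rewrite (_ : (\int[mu]_x ((fun x => (f (a *: x + b))%:E)^\-)%E x)%E =
   ((`|a|^-1 ^+ d)%:E * \int[mu]_x ((fun x => (f x)%:E)^\-)%E x)%E); last first.
  rewrite -(ge0_integral_affine b (f := ((fun x => (f x)%:E)^\-)%E))//.
    by apply: eq_integral => x _; rewrite !funenegE.
  exact: measurable_funeneg.
have p1 := integrable_pos_fin_num measurableT fi.
have p2 := integrable_neg_fin_num measurableT fi.
set P := (\int[mu]_x (EFin \o f)^\+ x)%E in p1.
set N := (\int[mu]_x (EFin \o f)^\- x)%E in p2.
rewrite -[RHS]/(_ * fine (P - N)).
rewrite -[LHS]/(fine ((`|a|^-1 ^+ d)%:E * P - (`|a|^-1 ^+ d)%:E * N)).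
by rewrite -(fineK p1) -(fineK p2) -!EFinM -!EFinB /= mulrBr.
Qed.

Lemma Rintegral_translate (b : V) (f : V -> R) :
  mu.-integrable setT (EFin \o f) -> \int[mu]_x f (x + b) = \int[mu]_x f x.
Proof.
move=> fi; have := Rintegral_affine b (oner_neq0 R) fi.
rewrite normr1 invr1 expr1n mul1r => <-.
by apply: eq_Rintegral => x _; rewrite scale1r.
Qed.

Lemma integrable_translate (b : V) (f : V -> R) :
  mu.-integrable setT (EFin \o f) -> mu.-integrable setT (EFin \o (fun x => f (x + b))).
Proof.
move=> fi; have := integrable_affine b (oner_neq0 R) fi.
by apply: eq_integrable => // x _ /=; rewrite scale1r.
Qed.

Lemma ge0_integral_translate (b : V) (f : V -> \bar R) :
  measurable_fun setT f -> (forall x, 0 <= f x)%E ->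
  (\int[mu]_x f (x + b)%R = \int[mu]_x f x)%E.
Proof.
move=> mf f0; have := ge0_integral_affine b (oner_neq0 R) mf f0.
rewrite normr1 invr1 expr1n mul1e => <-.
by apply: eq_integral => x _; rewrite scale1r.
Qed.

Lemma integrable_le (f g : V -> R) : measurable_fun setT f ->
  (forall x, `|f x| <= g x) ->
  mu.-integrable setT (EFin \o g) -> mu.-integrable setT (EFin \o f).
Proof.
move=> mf fg; apply: le_integrable => //; first exact/measurable_EFinP.
by move=> x _ /=; rewrite lee_fin (le_trans (fg x))// ler_norm.
Qed.

(** The product bound makes F integrable for the product measure and makes every section integrable,
    so the [fine] hidden in the inner real integrals loses nothing. *)
Lemma Rintegral_Fubini (F : V -> V -> R) (g h : V -> R) :
  measurable_fun setT (fun z : V * V => F z.1 z.2) ->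
  (forall x y, `|F x y| <= g x * h y) ->
  mu.-integrable setT (EFin \o g) -> mu.-integrable setT (EFin \o h) ->
  \int[mu]_x \int[mu]_y F x y = \int[mu]_y \int[mu]_x F x y.
Proof.
move=> mF Fgh ig ih.
have mF1 x : measurable_fun setT (F x) by exact: (measurableT_comp mF (measurable_pair1 x)).
have mF2 y : measurable_fun setT (F ^~ y) by exact: (measurableT_comp mF (measurable_pair2 y)).
have mE : measurable_fun setT (EFin \o (fun z : V * V => F z.1 z.2)) by exact/measurable_EFinP.
have iF : (mu \x mu)%E.-integrable setT (EFin \o (fun z : V * V => F z.1 z.2)).
  apply/integrable12ltyP => //=.
  have -> : (\int[mu]_x \int[mu]_y `|(F x y)%:E| =
             \int[mu]_x \int[mu]_y `|(F x y)%:E|)%E by [].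
  apply: (@le_lt_trans _ _ (\int[mu]_x (`|(g x)%:E| * \int[mu]_y `|(h y)%:E|))%E).
    apply: ge0_le_integral => //.
    - by move=> x _; exact: integral_ge0.
    - apply: (measurable_fun_fubini_tonelli_F (fun z : V * V => `|(F z.1 z.2)%:E|%E)) => //.
      exact: measurableT_comp.
    - apply: emeasurable_funM => //; apply: measurableT_comp => //.
      exact: measurable_int ig.
    - move=> x _; rewrite -ge0_integralZl//; last first.
        by apply: measurableT_comp => //; exact: measurable_int ih.
      apply: ge0_le_integral => //.
      + apply: measurableT_comp => //; apply/measurable_EFinP.
        exact: mF1.
      + apply: emeasurable_funM => //; apply: measurableT_comp => //.
        exact: measurable_int ih.
      + move=> y _; rewrite -abseM lee_fin normrM (le_trans (Fgh x y))//.
        by rewrite -normrM ler_norm.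
  have [mg goo] := integrableP _ _ _ ig.
  have [mh hoo] := integrableP _ _ _ ih.
  rewrite ge0_integralZr//; last by apply: integral_ge0.
    by rewrite lte_mul_pinfty ?integral_ge0// ge0_fin_numE ?integral_ge0.
  exact: measurableT_comp.
have := Fubini iF; rewrite /= => H.
rewrite /Rintegral.
rewrite (eq_integral (fun x => \int[mu]_y (F x y)%:E)%E); last first.
  move=> x _ /=; rewrite fineK//; apply: integrable_fin_num => //.
  apply: (@integrable_le _ (fun y => g x * h y)) => //.
  by have := integrableZl measurableT (g x) ih.
rewrite H; congr fine; apply: eq_integral => y _ /=; rewrite fineK//.
apply: integrable_fin_num => //.
apply: (@integrable_le _ (fun x => g x * h y)) => //.
by have := integrableZr measurableT (h y) ig.
Qed.

End integral_affine.

(** * Polynomial weights *)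

Section weight.
Context {R : realType}.

(** By Tonelli the integral of a product of functions of one coordinate factors, one coordinate at a
    time. *)
Lemma integral_prod_coord_lty d (g : R -> R) :
  measurable_fun setT g -> (forall t, 0 <= g t) ->
  (\int[lebesgue_measure]_(t in [set: R]) (g t)%:E < +oo)%E ->
  (\int[lebesgue_rV d]_x (\prod_(i < d) g (x ord0 i))%:E < +oo)%E.
Proof.
move=> mg g0 goo; elim: d => [|d IH].
  rewrite integral_dirac//; last first.
    under eq_fun do rewrite big_ord0; exact: measurable_cst.
  by rewrite big_ord0 diracT mul1e ltry.
have mp n : measurable_fun setT (fun x : 'rV[R]_n => \prod_(i < n) g (x ord0 i)).
  apply: measurable_prod => i _; apply: (measurableT_comp mg); exact: measurable_coord.
rewrite /= ge0_integral_cons//; last 2 first.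
  - by apply/measurable_EFinP; exact: mp.
  - by move=> x; rewrite lee_fin prodr_ge0.
have p0 n (x : 'rV[R]_n) : 0 <= \prod_(i < n) g (x ord0 i) by apply: prodr_ge0.
rewrite (eq_integral (fun t : measurableTypeR R => ((g t)%:E *
  \int[lebesgue_rV d]_x (\prod_(i < d) g (x ord0 i))%:E)%E)); last first.
  move=> t _; rewrite -ge0_integralZl//.
  - apply: eq_integral => y _; rewrite -EFinM big_ord_recl cons_rV0.
    by congr (_ * _)%:E; apply: eq_bigr => i _; rewrite cons_rVS.
  - by apply/measurable_EFinP; exact: mp.
  - by move=> x _; rewrite lee_fin.
  - by rewrite lee_fin.
rewrite ge0_integralZr//.
- have G0 : (0 <= \int[@lebesgue_measure R]_x (g x)%:E)%E.
    by apply: integral_ge0 => x _; rewrite lee_fin.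
  by rewrite lte_mul_pinfty// ge0_fin_numE.
- exact/measurable_EFinP.
- by move=> x _; rewrite lee_fin.
- by rewrite integral_ge0// => x _; rewrite lee_fin.
Qed.

Lemma integral_oneDsqrV_lty :
  (\int[lebesgue_measure]_(t in [set: R]) ((oneDsqr t)^-1)%:E < +oo)%E.
Proof.
rewrite (@ge0_symfun_integralT _ (fun t => (oneDsqr t)^-1)).
- rewrite (_ : [set x : R | _] = `[0, +oo[%classic); last first.
    by apply/seteqP; split => x/=; rewrite in_itv/= andbT.
  by rewrite integral0y_oneDsqr -EFinM ltry.
- by move=> x; rewrite invr_ge0 ltW.
- exact: continuous_oneDsqrV.
- by move=> x /=; rewrite /oneDsqr sqrrN.
Qed.

End weight.

Section weight_rV.
Context {R : realType} {d : nat}.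
Local Notation V := 'rV[R]_d.
Local Notation mu := (lebesgue_rV d).

(** Here |x| is the max norm, the one behind the topology of row vectors. The Euclidean [enorm]
    occurs only where the definitions of the statement impose it. *)
Definition wt (n : nat) (x : V) : R := (1 + `|x|) ^- n.

Lemma wt_gt0 n x : 0 < wt n x.
Proof. by rewrite invr_gt0 exprn_gt0// ltr_pwDl. Qed.

Lemma wt_ge0 n x : 0 <= wt n x. Proof. exact/ltW/wt_gt0. Qed.

Lemma wt_le1 n x : wt n x <= 1.
Proof. by rewrite invf_le1 ?exprn_gt0 ?ltr_pwDl// exprn_ege1// lerDl. Qed.

Lemma wt_mono m n x : (m <= n)%N -> wt n x <= wt m x.
Proof.
by move=> mn; rewrite lef_pV2 ?posrE ?exprn_gt0 ?ltr_pwDl// ler_weXn2l// lerDl.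
Qed.

Lemma wtN n x : wt n (- x) = wt n x.
Proof. by rewrite /wt normrN. Qed.

Lemma measurable_wt n : measurable_fun setT (wt n).
Proof.
apply: continuous_measurable_rV => x; rewrite /wt.
apply: (@continuousV _ _ (fun x : V => (1 + `|x|) ^+ n)).
  by rewrite gt_eqF// exprn_gt0// ltr_pwDl.
apply: (@continuous_comp _ _ _ (fun x : V => 1 + `|x|) (fun t : R => t ^+ n)).
  by apply: continuousD; [exact: cst_continuous|exact: norm_continuous].
exact: exprn_continuous.
Qed.

(** Since |x| dominates each coordinate, (1 + |x|)^(2d) is at least the product of the 1 + x_i^2,
    whose inverse is integrable. *)
Lemma integrable_wt n : (d.*2 <= n)%N -> mu.-integrable setT (EFin \o wt n).
Proof.
move=> dn; apply/integrableP; split; first by apply/measurable_EFinP; exact: measurable_wt.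
apply: (le_lt_trans _ (integral_prod_coord_lty d (g := fun t => (oneDsqr t)^-1) _ _
  integral_oneDsqrV_lty)).
- apply: ge0_le_integral => //.
  + by apply: measurableT_comp => //; apply/measurable_EFinP; exact: measurable_wt.
  + apply/measurable_EFinP; apply: measurable_prod => i _.
    apply: (@measurableT_comp _ _ _ _ _ _ (fun t : R => (oneDsqr t)^-1)).
      by apply: continuous_measurable_fun; exact: continuous_oneDsqrV.
    exact: measurable_coord.
  + move=> x _ /=; rewrite lee_fin ger0_norm ?wt_ge0//.
    rewrite (le_trans (wt_mono _ dn))// /wt prodfV lef_pV2 ?posrE; last 2 first.
    * by rewrite exprn_gt0// ltr_pwDl.
    * by apply: prodr_gt0 => i _; rewrite (lt_le_trans ltr01)// oneDsqr_ge1.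
    rewrite -muln2 mulnC exprM -[X in _ ^+ X]card_ord -prodr_const.
    apply: ler_prod => i _; rewrite (le_trans ler01 (oneDsqr_ge1 _))/= /oneDsqr.
    have := coord_le_norm x i; set a := x ord0 i => ax.
    have : a ^+ 2 <= `|x| ^+ 2 by rewrite -[leLHS]real_normK ?num_real// ler_sqr ?nnegrE.
    have := normr_ge0 x; nra.
- by apply: continuous_measurable_fun; exact: continuous_oneDsqrV.
- by move=> t; rewrite invr_ge0 (le_trans ler01 (oneDsqr_ge1 _)).
Qed.

(* Peetre's inequality. *)
Lemma wt_shift n x y : wt n (x + y) <= (1 + `|y|) ^+ n * wt n x.
Proof.
rewrite /wt ler_pdivlMr ?exprn_gt0 ?ltr_pwDl// mulrC ler_pdivrMr ?exprn_gt0 ?ltr_pwDl//.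
rewrite -exprMn lerXn2r ?nnegrE ?mulr_ge0 ?addr_ge0//.
have := ler_normB (x + y) y; rewrite addrK.
have := normr_ge0 (x + y); have := normr_ge0 y; nra.
Qed.

End weight_rV.

(** * Directional derivatives and smooth functions *)

Section lines.
Context {R : realType} {d : nat}.
Local Notation V := 'rV[R]_d.
Implicit Types (h : V -> R) (x v : V).

(** Both difference quotients are the same function of the increment, so derivatives along v can be
    computed by the rules of one variable. *)
Lemma is_derive_line h x v (t : R) : derivable h (t *: v + x) v ->
  is_derive t 1 (fun s : R => h (s *: v + x)) ('D_v h (t *: v + x)).
Proof.
have E : (fun e : R => e^-1 *: (((fun s : R => h (s *: v + x)) \o shift t) (e *: 1) - h (t *: v + x)))
  = (fun e : R => e^-1 *: ((h \o shift (t *: v + x)) (e *: v) - h (t *: v + x))).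
  by apply/funext => e /=; rewrite [_%:A]mulr1 scalerDl addrA.
by move=> dh; apply: DeriveDef; rewrite /derivable /derive E.
Qed.

Lemma line_is_derive h x v l :
  is_derive (0 : R) 1 (fun s : R => h (s *: v + x)) l -> is_derive x v h l.
Proof.
have E : (fun e : R => e^-1 *: (((fun s : R => h (s *: v + x)) \o shift 0) (e *: 1) - h ((0 : R) *: v + x)))
  = (fun e : R => e^-1 *: ((h \o shift x) (e *: v) - h x)).
  by apply/funext => e /=; rewrite [_%:A]mulr1 addr0 scale0r add0r.
by move=> -[dh <-]; apply: DeriveDef; rewrite /derivable /derive -E.
Qed.

Lemma is_derive_affine h (a : R) (b x v : V) : derivable h (a *: x + b) v ->
  is_derive x v (fun y => h (a *: y + b)) (a * 'D_v h (a *: x + b)).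
Proof.
move=> dh; apply: line_is_derive.
have -> : (fun s : R => h (a *: (s *: v + x) + b)) =
   (fun s : R => h (s *: v + (a *: x + b))) \o (fun s : R => a * s).
  by apply/funext => s /=; rewrite scalerDr scalerA addrA.
have d1 : is_derive (a * 0) 1 (fun s : R => h (s *: v + (a *: x + b)))
   ('D_v h (a *: x + b)).
  have -> : a *: x + b = (a * 0) *: v + (a *: x + b) by rewrite mulr0 scale0r add0r.
  rewrite [X in is_derive _ _ X](_ : _ = (fun s : R => h (s *: v + (a *: x + b)))); last first.
    by apply/funext => s; rewrite mulr0 scale0r add0r.
  by apply: is_derive_line; rewrite mulr0 scale0r add0r.
have d2 : is_derive (0 : R) 1 (fun s : R => a * s) a.
  have := is_deriveM (is_derive_cst a (0 : R) 1) (is_derive_id (0 : R) 1).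
  rewrite scaler0 addr0 [_ *: _]mulr1; exact.
by apply: is_derive_eq; rewrite mulrC.
Qed.

End lines.

Section smooth.
Context {R : realType} {d : nat}.
Local Notation V := 'rV[R]_d.
Implicit Types (h u : V -> R) (x : V) (i : 'I_d).

Definition partial i h : V -> R := fun x => 'D_(delta_mx ord0 i) h x.

(** A coinduction principle: [smooth] is the largest class of continuous functions with partial
    derivatives that is stable under [partial]. Smoothness is then proved by exhibiting such a class
    S. *)
Lemma smooth_coind (S : (V -> R) -> Prop) :
  (forall h, S h -> continuous h /\ forall i x, derivable h x (delta_mx ord0 i)) ->
  (forall h i, S h -> S (partial i h)) -> forall h, S h -> smooth h.
Proof.
move=> Scd Sp h Sh s.
have Ss : S (pderiv s h) by elim: s => //= i s IH; exact: Sp.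
by split=> [|i x]; have [cs ds] := Scd _ Ss.
Qed.

Lemma smooth_continuous h : smooth h -> continuous h.
Proof. by move=> /(_ [::])[]. Qed.

Lemma smooth_derivable h i x : smooth h -> derivable h x (delta_mx ord0 i).
Proof. by move=> /(_ [::])[]. Qed.

Lemma pderiv_partial s i h : pderiv s (partial i h) = pderiv (rcons s i) h.
Proof. by elim: s => //= j s ->. Qed.

Lemma smooth_partial i h : smooth h -> smooth (partial i h).
Proof. by move=> sh s; rewrite pderiv_partial; exact: sh. Qed.

Lemma smooth_measurable h : smooth h -> measurable_fun setT h.
Proof. by move=> /smooth_continuous; exact: continuous_measurable_rV. Qed.

(** By the Leibniz rule the derivative of a product is a sum of products, so a class of single
    products is not stable. The algebra generated by B is stable as soon as it contains the partial
    derivatives of its generators. *)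
Inductive alg_closure (B : (V -> R) -> Prop) : (V -> R) -> Prop :=
| alg_base h : B h -> alg_closure B h
| alg_cst c : alg_closure B (cst c)
| alg_add h u : alg_closure B h -> alg_closure B u -> alg_closure B (h + u)
| alg_mul h u : alg_closure B h -> alg_closure B u -> alg_closure B (h * u).

Lemma alg_closure_smooth (B : (V -> R) -> Prop) :
  (forall h, B h -> continuous h /\ forall i x, derivable h x (delta_mx ord0 i)) ->
  (forall h i, B h -> alg_closure B (partial i h)) ->
  forall h, alg_closure B h -> smooth h.
Proof.
move=> Bcd Bp.
have cd h : alg_closure B h ->
    continuous h /\ forall i x, derivable h x (delta_mx ord0 i).
  elim=> {h} [h Bh|c|h u _ [ch dh] _ [cu du]|h u _ [ch dh] _ [cu du]].
  - exact: Bcd.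
  - by split=> [|i x]; [exact: cst_continuous|exact: derivable_cst].
  - split=> [x|i x]; first exact: continuousD (ch x) (cu x).
    exact: derivableD.
  - split=> [x|i x]; first exact: continuousM (ch x) (cu x).
    exact: derivableM.
apply: smooth_coind => // h i; elim=> {h} [h Bh|c|h u Sh Ph Su Pu|h u Sh Ph Su Pu].
- exact: Bp.
- rewrite (_ : partial i (cst c) = cst 0); first exact: alg_cst.
  by apply/funext => x; rewrite /partial derive_cst.
- rewrite (_ : partial i (h + u) = partial i h + partial i u); first exact: alg_add.
  by apply/funext => x; rewrite /partial deriveD//; [exact: (cd _ Sh).2|exact: (cd _ Su).2].
- rewrite (_ : partial i (h * u) = h * partial i u + u * partial i h).
    by apply: alg_add; apply: alg_mul.
  by apply/funext => x; rewrite /partial deriveM//; [exact: (cd _ Sh).2|exact: (cd _ Su).2].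
Qed.

Lemma smooth_alg h : alg_closure smooth h -> smooth h.
Proof.
apply: alg_closure_smooth => {}h.
  by move=> sh; split=> [|i x]; [exact: smooth_continuous|exact: smooth_derivable].
by move=> i sh; apply: alg_base; exact: smooth_partial.
Qed.

Lemma smooth_cst (c : R) : smooth (fun _ : V => c).
Proof. exact/smooth_alg/alg_cst. Qed.

Lemma smoothD h u : smooth h -> smooth u -> smooth (fun x => h x + u x).
Proof. by move=> sh su; apply/smooth_alg/alg_add; exact: alg_base. Qed.

Lemma smoothM h u : smooth h -> smooth u -> smooth (fun x => h x * u x).
Proof. by move=> sh su; apply/smooth_alg/alg_mul; exact: alg_base. Qed.

Lemma smoothZ (c : R) h : smooth h -> smooth (fun x => c * h x).
Proof. by move=> sh; apply: smoothM; [exact: smooth_cst|exact: sh]. Qed.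

Lemma smoothB h u : smooth h -> smooth u -> smooth (fun x => h x - u x).
Proof.
move=> sh su; rewrite (_ : (fun _ => _) = fun x => h x + -1 * u x).
  by apply: smoothD; [exact: sh|exact: smoothZ].
by apply/funext => x; rewrite mulN1r.
Qed.

Lemma partialM i h u : smooth h -> smooth u ->
  partial i (fun x => h x * u x) = fun x => h x * partial i u x + u x * partial i h x.
Proof.
move=> sh su; apply/funext => x; rewrite /partial.
have -> : (fun x0 => h x0 * u x0) = h * u by [].
by rewrite deriveM//; exact: smooth_derivable.
Qed.

Lemma partial_affine i h (a : R) (b : V) : smooth h ->
  partial i (fun y => h (a *: y + b)) = (fun y => a * partial i h (a *: y + b)).
Proof.
move=> sh; apply/funext => x; rewrite /partial.
by have [_ ->] := is_derive_affine (@smooth_derivable _ i (a *: x + b) sh).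
Qed.

Lemma affine_continuous (a : R) (b : V) : continuous (fun y : V => a *: y + b).
Proof.
move=> x; apply: continuousD; [exact: scaler_continuous|exact: cst_continuous].
Qed.

Lemma smooth_affine h (a : R) (b : V) : smooth h -> smooth (fun y => h (a *: y + b)).
Proof.
move=> sh; pose S k := exists2 u, smooth u & exists c : R, k = fun y => c * u (a *: y + b).
apply: (smooth_coind (S := S)).
- move=> _ [u su [c ->]]; split=> [x|i x].
    apply: continuousM; first exact: cst_continuous.
    apply: (@continuous_comp V V R (fun y : V => a *: y + b) u).
      exact: affine_continuous.
    exact: smooth_continuous.
  have [du _] := is_derive_affine (@smooth_derivable _ i (a *: x + b) su).
  exact: (derivableM (derivable_cst c _ _) du).
- move=> _ i [u su [c ->]]; exists (partial i u); first exact: smooth_partial.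
  exists (c * a); apply/funext => x; rewrite /partial.
  have [du Du] := is_derive_affine (@smooth_derivable _ i (a *: x + b) su).
  have -> : (fun y => c * u (a *: y + b)) = cst c * (fun y => u (a *: y + b)) by [].
  by rewrite (deriveM (derivable_cst c _ _) du) derive_cst scaler0 addr0 Du -mulrA.
- by exists h => //; exists 1; apply/funext => x; rewrite mul1r.
Qed.

(** Derivatives are local. This serves for [low_cutoff], which is defined by cases. *)
Lemma smooth_near h :
  (forall x, exists2 u, smooth u & \forall y \near x, h y = u y) -> smooth h.
Proof.
pose S k := forall x, exists2 u, smooth u & \forall y \near x, k y = u y.
apply: (smooth_coind (S := S)) => {}h.
  move=> Sh; split=> [x|i x]; have [u su hu] := Sh x.
    rewrite /continuous_at (nbhs_singleton hu).
    have cu : u y @[y --> x] --> u x := @smooth_continuous u su x.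
    apply: cvg_trans cu.
    have uh : {near x, u =1 h} by near do apply/esym.
    exact: (near_eq_cvg uh).
  apply: (@near_eq_derivable _ _ _ u); last exact: smooth_derivable.
  by near do apply/esym.
move=> i Sh x; have [u su hu] := Sh x.
exists (partial i u); first exact: smooth_partial.
apply: filterS (near_join hu) => y hy; exact: near_eq_derive.
Unshelve. all: by end_near. Qed.

End smooth.

Section coord.
Context {R : realType} {d : nat}.
Local Notation V := 'rV[R]_d.
Implicit Types (h u : V -> R) (x : V) (i : 'I_d).

Lemma is_derive_lin (a b t : R) : is_derive t 1 (fun s : R => a * s + b) a.
Proof.
have := is_deriveD (is_deriveM (is_derive_cst a t 1) (is_derive_id t 1)) (is_derive_cst b t 1).
by rewrite scaler0 !addr0 [_ *: _]mulr1; exact.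
Qed.

Lemma is_derive_comp_coord (F F' : R -> R) (a b : R) i j x :
  (forall t : R, is_derive t 1 F (F' t)) ->
  is_derive x (delta_mx ord0 j) (fun y : V => F (a * y ord0 i + b))
    (a * (i == j)%:R * F' (a * x ord0 i + b)).
Proof.
move=> dF; apply: line_is_derive.
have -> : (fun s : R => F (a * (s *: delta_mx ord0 j + x) ord0 i + b)) =
   F \o (fun s => (a * (i == j)%:R) * s + (a * x ord0 i + b)).
  by apply/funext => s /=; rewrite !mxE eqxx /=; congr F; ring.
have d1 := is_derive_lin (a * (i == j)%:R) (a * x ord0 i + b) 0.
have d2 := dF (a * (i == j)%:R * 0 + (a * x ord0 i + b)).
by apply: is_derive_eq; rewrite mulr0 add0r mulrC.
Qed.

Lemma coord_continuous i : continuous (fun x : V => x ord0 i).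
Proof. by move=> x; apply: coord_continuous. Qed.

Lemma smooth_coord i : smooth (fun x : V => x ord0 i).
Proof.
have dc j x : is_derive x (delta_mx ord0 j) (fun x : V => x ord0 i) (i == j)%:R.
  have := @is_derive_comp_coord id (fun=> 1) 1 0 i j x (fun t => is_derive_id t 1).
  rewrite mulr1 mul1r; congr is_derive.
  by apply/funext => y; rewrite mul1r addr0.
apply: (alg_closure_smooth (B := fun h => h = (fun x : V => x ord0 i))); last exact: alg_base.
  move=> _ ->; split=> [|j x]; first exact: coord_continuous.
  by have [] := dc j x.
move=> _ j ->; rewrite (_ : partial _ _ = cst (i == j)%:R); first exact: alg_cst.
by apply/funext => x; have [_] := dc j x.
Qed.

(** The derivative of the sigmoid is a polynomial in the sigmoid itself, so the algebra generated by
    a sigmoid of one coordinate is stable under [partial]. Steep sigmoids will approximate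
    half-spaces. *)
Definition sigmoid (t : R) : R := (1 + expR (- t))^-1.

Lemma sigmoid_gt0 t : 0 < sigmoid t.
Proof. by rewrite invr_gt0 addr_gt0// expR_gt0. Qed.

Lemma sigmoid_le1 t : sigmoid t <= 1.
Proof. by rewrite invf_le1 ?addr_gt0 ?expR_gt0// lerDl expR_ge0. Qed.

Lemma is_derive_sigmoid (t : R) :
  is_derive t 1 sigmoid (sigmoid t * (1 - sigmoid t)).
Proof.
have dN : is_derive t 1 (fun s : R => - s) (-1) by exact: is_deriveNid.
have dE := is_derive_expR (- t).
have d1 : is_derive t 1 (expR \o (fun s : R => - s)) (expR (- t) * -1) by exact: is_derive1_comp.
have d2 := is_deriveD (is_derive_cst (1 : R) t (1 : R)) d1.
have e0 := expR_gt0 (- t).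
have n0 : (cst 1 + (expR \o (fun s : R => - s))) t != 0 by rewrite gt_eqF// addr_gt0.
have [h1 h2] := is_deriveV n0 d2.
apply: DeriveDef; first exact: h1.
rewrite [LHS]h2 /sigmoid.
transitivity (- (1 + expR (- t)) ^- 2 * (0 + expR (- t) * -1)); first by [].
by field; rewrite gt_eqF// addr_gt0.
Qed.

Lemma smooth_sigmoid_coord (a b : R) i : smooth (fun x : V => sigmoid (a * x ord0 i + b)).
Proof.
have dc j x := @is_derive_comp_coord sigmoid _ a b i j x is_derive_sigmoid.
have cs : continuous sigmoid.
  move=> t; apply: differentiable_continuous; apply/derivable1_diffP.
  by have [] := is_derive_sigmoid t.
apply: (alg_closure_smooth (B := fun h => h = (fun x : V => sigmoid (a * x ord0 i + b))));
  last exact: alg_base.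
  move=> _ ->; split=> [x|j x]; last by have [] := dc j x.
  apply: (@continuous_comp V R R (fun x : V => a * x ord0 i + b) sigmoid); last exact: cs.
  apply: continuousD; last exact: cst_continuous.
  apply: continuousM; [exact: cst_continuous|exact: coord_continuous].
move=> _ j ->.
set B := fun h : V -> R => _.
pose s := fun x : V => sigmoid (a * x ord0 i + b).
rewrite (_ : partial _ _ = cst (a * (i == j)%:R) * (s * (cst 1 + cst (-1) * s))).
  have Bs : alg_closure B s by exact: alg_base.
  by do ![exact: Bs|exact: alg_cst|apply: alg_mul|apply: alg_add].
apply/funext => x; have [_] := dc j x; rewrite /partial => ->.
by rewrite /s -[RHS]/(_ * (_ * (1 + -1 * _))) mulN1r.
Qed.

End coord.

(** * Rapidly decreasing functions and real test functions *)

Section decay.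
Context {R : realType} {d : nat}.
Local Notation V := 'rV[R]_d.
Local Notation mu := (lebesgue_rV d).
Implicit Types (h u g : V -> R) (x : V) (i : 'I_d).

(** Decay of the function alone: the derivatives of a transform are treated separately, as
    transforms of other functions. *)
Definition rapid g := measurable_fun setT g /\
  forall n, exists2 C : R, 0 <= C & forall x, `|g x| <= C * wt n x.

Lemma rapid_integrable g : rapid g -> mu.-integrable setT (EFin \o g).
Proof.
move=> [mg /(_ d.*2)[C C0 gC]]; apply: (integrable_le mg gC).
exact: (integrableZl measurableT C (integrable_wt (leqnn _))).
Qed.

Lemma rapid_coordM i g : rapid g -> rapid (fun x => x ord0 i * g x).
Proof.
move=> [mg gr]; split; first by apply: measurable_funM => //; exact: measurable_coord.
move=> n; have [C C0 gC] := gr n.+1; exists C => // x; rewrite normrM.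
rewrite (le_trans (ler_pM _ _ (coord_le_norm x i) (gC x)))//.
rewrite mulrCA ler_wpM2l// /wt exprS invfM mulrA ler_piMl ?wt_ge0//.
by rewrite ler_pdivrMr ?ltr_pwDl// mul1r lerDr.
Qed.

Lemma rapid_le g u (C : R) : measurable_fun setT g -> 0 <= C ->
  (forall x, `|g x| <= C * `|u x|) -> rapid u -> rapid g.
Proof.
move=> mg C0 gu [_ ur]; split => // n; have [D D0 uD] := ur n.
exists (C * D); first exact: mulr_ge0.
by move=> x; rewrite (le_trans (gu x))// -mulrA ler_wpM2l.
Qed.

Lemma rapidD g u : rapid g -> rapid u -> rapid (fun x => g x + u x).
Proof.
move=> [mg gr] [mu' ur]; split; first exact: measurable_funD.
move=> n; have [C C0 gC] := gr n; have [D D0 uD] := ur n.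
exists (C + D); first exact: addr_ge0.
by move=> x; rewrite mulrDl (le_trans (ler_normD _ _))// lerD.
Qed.

Lemma rapidZ (c : R) g : rapid g -> rapid (fun x => c * g x).
Proof.
move=> rg; apply: (@rapid_le _ g `|c|) => //; last by move=> x; rewrite normrM.
by apply: measurable_funM => //; case: rg.
Qed.

(** Real test functions, with an explicit radius in place of compact support; [btest_test] makes the
    link to [test_function]. *)
Definition btest h := smooth h /\ exists r : R, forall x, r <= `|x| -> h x = 0.

Lemma btest_partial i h : btest h -> btest (partial i h).
Proof.
move=> [sh [r hr]]; split; first exact: smooth_partial.
exists (r + 1) => x xr; rewrite /partial.
have h0 : \forall y \near x, h y = (cst 0 : V -> R) y.
  apply: filterS (nbhsx_ballx x 1 ltr01) => y; rewrite -ball_normE /ball_/= => xy.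
  apply: hr; have := ler_distD y x 0; rewrite !subr0; lra.
by rewrite (near_eq_derive _ h0) derive_cst.
Qed.

Lemma btest_affine h (a : R) (b : V) : a != 0 -> btest h -> btest (fun y => h (a *: y + b)).
Proof.
move=> a0 [sh [r hr]]; split; first exact: smooth_affine.
exists ((`|r| + `|b|) / `|a|) => x; rewrite ler_pdivrMr ?normr_gt0// => xr.
apply: hr; have := ler_normB (a *: x + b) b; rewrite addrK normrZ.
have := ler_norm r; lra.
Qed.

Lemma btestM h u : btest h -> smooth u -> btest (fun y => h y * u y).
Proof.
move=> [sh [r hr]] su; split; first exact: smoothM.
by exists r => x xr; rewrite hr// mul0r.
Qed.

Lemma btestMl h u : smooth u -> btest h -> btest (fun y => u y * h y).
Proof.
move=> su bh; rewrite (_ : (fun _ => _) = fun y => h y * u y); first exact: btestM.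
by apply/funext => y; rewrite mulrC.
Qed.

Lemma btestB h u : btest h -> btest u -> btest (fun y => h y - u y).
Proof.
move=> [sh [r hr]] [su [t ut]]; split; first exact: smoothB.
exists (Num.max r t) => x; rewrite ge_max => /andP[xr xt].
by rewrite hr// ut// subr0.
Qed.

Lemma closed_ball0_compact (r : R) : compact [set x : V | `|x| <= r].
Proof.
apply: bounded_closed_compact.
  by exists r; split; [exact: num_real|move=> s rs x /= xr; rewrite (le_trans xr)// ltW].
rewrite (_ : [set x | _] = (fun x : V => `|x|) @^-1` [set t | t <= r])//.
by apply: closed_comp => [x _|]; [exact: norm_continuous|exact: closed_le].
Qed.

Lemma btest_bounded h : btest h -> exists2 C : R, 0 <= C & forall x, `|h x| <= C.
Proof.
move=> [sh [r hr]].
have ch : {within [set x : V | `|x| <= r], continuous (fun x => `|h x|)}.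
  apply: continuous_subspaceT => x.
  apply: (@continuous_comp V R R h (fun t : R => `|t|)); last exact: norm_continuous.
  exact: smooth_continuous.
have [|r0] := pselect (0 <= r); last first.
  exists 0 => // x; rewrite hr ?normr0// (le_trans _ (normr_ge0 x))// ltW// ltNge.
  exact/negP.
move=> r0; have [||c _ hc] := @EVT_max_rV R d _ [set x : V | `|x| <= r] _ _ ch.
- by exists 0; rewrite /= normr0.
- exact: closed_ball0_compact.
exists `|h c| => // x; have [xr|xr] := leP r `|x|; first by rewrite hr// normr0.
by apply: hc; rewrite inE /= ltW.
Qed.

Lemma btest_rapid h : btest h -> rapid h.
Proof.
move=> bh; have [C C0 hC] := btest_bounded bh; have [sh [r hr]] := bh.
split; first exact: smooth_measurable.
move=> n; exists (C * (1 + `|r|) ^+ n) => [|x].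
  by rewrite mulr_ge0// exprn_ge0// addr_ge0.
have [xr|xr] := leP r `|x|.
  by rewrite hr// normr0 mulr_ge0 ?wt_ge0// mulr_ge0// exprn_ge0// addr_ge0.
rewrite (le_trans (hC x))// -mulrA ler_peMr// /wt ler_pdivlMr ?exprn_gt0 ?ltr_pwDl//.
rewrite mul1r lerXn2r ?nnegrE ?addr_ge0// lerD2l ltW// (lt_le_trans xr)//.
exact: ler_norm.
Qed.

Lemma btest_test h : btest h -> test_function (fun x => (h x)%:C).
Proof.
move=> [sh [r hr]]; split; first by split; [exact: sh|exact: smooth_cst].
apply: (subclosed_compact _ (@closed_ball0_compact r)); first exact: closed_closure.
have cB := compact_closed (@norm_hausdorff _ _) (@closed_ball0_compact r).
rewrite [X in _ `<=` X](_ : _ = closure [set x : V | `|x| <= r]); last first.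
  exact/closure_id.
apply: closure_subset => x /=; apply: contraNle => xr.
by rewrite hr// ltW.
Qed.

End decay.

(** * Derivatives and limits under the integral sign *)

Section limits_under_integral.
Context {R : realType} {d : nat}.
Local Notation V := 'rV[R]_d.
Local Notation mu := (lebesgue_rV d).

(** The parameter is kept in a bounded interval so that a single G can dominate all the
    derivatives. *)
Lemma is_derive_under_Rintegral (f f' : R -> V -> R) (G : V -> R) (T : R) :
  (forall s, `|s| < T -> mu.-integrable setT (EFin \o f s)) ->
  (forall (s : R) x, `|s| < T -> is_derive s 1 (f ^~ x) (f' s x)) ->
  (forall s x, `|s| < T -> `|f' s x| <= G x) ->
  mu.-integrable setT (EFin \o G) ->
  forall s : R, `|s| < T -> is_derive s 1 (fun s => \int[mu]_x f s x) (\int[mu]_x f' s x).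
Proof.
move=> fi df fG Gi s sT.
have Is : `]-T, T[%classic s by rewrite /= in_itv/= -ltr_norml.
have I1 t : `]-T, T[%classic t -> `|t| < T by rewrite /= in_itv/= -ltr_norml.
have G0 y : 0 <= G y by rewrite (le_trans (normr_ge0 _) (fG s y sT)).
have fi' t : `]-T, T[%classic t -> mu.-integrable setT (EFin \o f t) by move=> /I1 /fi.
have dr t y : `]-T, T[%classic t -> setT y -> derivable (f ^~ y) t 1.
  by move=> /I1 tT _; have [] := df t y tT.
have bd t y : `]-T, T[%classic t -> setT y -> `|partial1of2 f t y| <= G y.
  by move=> /I1 tT _; have [_ e] := df t y tT; rewrite partial1of2E e; exact: fG.
apply: DeriveDef; first exact: (derivable_under_integral measurableT Is fi' dr G0 Gi bd).
rewrite -derive1E (differentiation_under_integral measurableT Is fi' dr G0 Gi bd).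
apply: eq_Rintegral => y _; rewrite partial1of2E.
by have [_ ->] := df s y sT.
Qed.

Lemma integrable_addr (f g : V -> R) : mu.-integrable setT (EFin \o f) ->
  mu.-integrable setT (EFin \o g) -> mu.-integrable setT (EFin \o (fun x => f x + g x)).
Proof. by move=> fi gi; exact: (integrableD measurableT fi gi). Qed.

Lemma integrable_subr (f g : V -> R) : mu.-integrable setT (EFin \o f) ->
  mu.-integrable setT (EFin \o g) -> mu.-integrable setT (EFin \o (fun x => f x - g x)).
Proof. by move=> fi gi; exact: (integrableB measurableT fi gi). Qed.

Lemma integrable_scaler (c : R) (f : V -> R) : mu.-integrable setT (EFin \o f) ->
  mu.-integrable setT (EFin \o (fun x => c * f x)).
Proof. by move=> fi; exact: (integrableZl measurableT c fi). Qed.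

Lemma integrable_normr (f : V -> R) : mu.-integrable setT (EFin \o f) ->
  mu.-integrable setT (EFin \o (fun x => `|f x|)).
Proof. by move=> fi; exact: (integrable_abse fi). Qed.

Lemma dominated_Rintegral (f_ : nat -> V -> R) (f g : V -> R) :
  (forall n, measurable_fun setT (f_ n)) ->
  (forall x, f_ n x @[n --> \oo] --> f x) ->
  (forall n x, `|f_ n x| <= g x) ->
  mu.-integrable setT (EFin \o g) ->
  \int[mu]_x f_ n x @[n --> \oo] --> \int[mu]_x f x.
Proof.
move=> mf ff fg gi.
have mf' : measurable_fun setT f.
  by apply: (measurable_fun_cvg (h := f_)) => // x _; exact: ff.
have fx x : `|f x| <= g x.
  have nf : `|f_ n x| @[n --> \oo] --> `|f x| by apply: cvg_norm; exact: ff.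
  rewrite -(cvg_lim _ nf)//; apply: limr_le; first by apply/cvg_ex; exists `|f x|.
  exact: nearW.
have fint : mu.-integrable setT (EFin \o f) by exact: (integrable_le mf' fx).
apply: fine_cvg; rewrite fineK; last exact: integrable_fin_num.
apply: (@dominated_cvg _ _ _ mu setT measurableT (fun n x => (f_ n x)%:E) (EFin \o f) (EFin \o g)) => //.
- by move=> n; apply/measurable_EFinP.
- by move=> x _; apply: cvg_EFin; [exact: nearW|exact: ff].
- by move=> n x _; rewrite lee_fin.
Qed.

End limits_under_integral.

(** * Smooth approximation of measurable sets *)

Section density.
Context {R : realType} {d : nat}.
Local Notation V := 'rV[R]_d.
Local Notation mu := (lebesgue_rV d).
Variable rho : V -> R.
Hypothesis rho_ge0 : forall x, 0 <= rho x.
Hypothesis rho_int : mu.-integrable setT (EFin \o rho).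

Let mrho : measurable_fun setT rho.
Proof. by apply/measurable_EFinP; exact: measurable_int rho_int. Qed.

(** Approximation in L1 of the finite measure rho dx. The sets that admit it form a sigma-algebra,
    which contains the half-spaces x_i > a and therefore every measurable set. *)
Definition approximable (A : set V) := measurable A /\
  forall e : R, 0 < e -> exists2 g : V -> R,
    smooth g /\ (forall x, 0 <= g x <= 1) &
    \int[mu]_x (`|\1_A x - g x| * rho x) < e.

Let indic01 (A : set V) x : 0 <= (\1_A x : R) <= 1.
Proof. by rewrite indicE; case: (_ \in _); rewrite lexx ler01. Qed.

Let dist_le1 (u v : R) : 0 <= u <= 1 -> 0 <= v <= 1 -> `|u - v| <= 1.
Proof. by move=> ? ?; rewrite ler_norml; lra. Qed.

Let int_dist (u v : V -> R) : measurable_fun setT u -> measurable_fun setT v ->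
  (forall x, 0 <= u x <= 1) -> (forall x, 0 <= v x <= 1) ->
  mu.-integrable setT (EFin \o (fun x => `|u x - v x| * rho x)).
Proof.
move=> mu' mv u1 v1; apply: (integrable_le (g := rho)) => //.
  apply: measurable_funM => //; apply: measurableT_comp => //; exact: measurable_funB.
move=> x; rewrite normrM normr_id (ger0_norm (rho_ge0 x)) ler_piMl//.
exact: dist_le1.
Qed.

Let dist_triangle (u v w : V -> R) : measurable_fun setT u -> measurable_fun setT v ->
  measurable_fun setT w ->
  (forall x, 0 <= u x <= 1) -> (forall x, 0 <= v x <= 1) -> (forall x, 0 <= w x <= 1) ->
  \int[mu]_x (`|u x - w x| * rho x) <=
  \int[mu]_x (`|u x - v x| * rho x) + \int[mu]_x (`|v x - w x| * rho x).
Proof.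
move=> mu' mv mw u1 v1 w1; rewrite -RintegralD//; try exact: int_dist.
apply: le_Rintegral => //; first exact: int_dist.
  by apply: (integrableD measurableT (int_dist mu' mv u1 v1) (int_dist mv mw v1 w1)).
move=> x _; rewrite -mulrDl ler_wpM2r//; exact: ler_distD.
Qed.

Let dist_cvg0 (u_ : nat -> V -> R) (u : V -> R) :
  (forall n, measurable_fun setT (u_ n)) -> measurable_fun setT u ->
  (forall n x, 0 <= u_ n x <= 1) -> (forall x, 0 <= u x <= 1) ->
  (forall x, u_ n x @[n --> \oo] --> u x) ->
  forall e : R, 0 < e -> exists n, \int[mu]_x (`|u x - u_ n x| * rho x) < e.
Proof.
move=> mu_ mu' u_1 u1 uu e e0.
have : \int[mu]_x (`|u x - u_ n x| * rho x) @[n --> \oo] --> \int[mu]_x (cst 0 : V -> R) x.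
  apply: (dominated_Rintegral (g := rho)) => //.
  - move=> n; apply: measurable_funM => //; apply: measurableT_comp => //.
    exact: measurable_funB.
  - move=> x; rewrite [X in _ --> X](_ : _ = 0 * rho x); last by rewrite mul0r.
    apply: cvgM; last exact: cvg_cst.
    rewrite -(normr0 R) -(subrr (u x)); apply: cvg_norm; apply: cvgB; first exact: cvg_cst.
    exact: uu.
  - move=> n x; rewrite normrM normr_id (ger0_norm (rho_ge0 x)) ler_piMl//.
    exact: dist_le1.
have -> : \int[mu]_x (cst 0 : V -> R) x = 0.
  by rewrite /Rintegral integral0_eq.
move/cvgrPdist_lt => /(_ e e0)[N _ /(_ N (leqnn _))].
by rewrite /= sub0r normrN => /(le_lt_trans (ler_norm _)) h; exists N.
Qed.

Let mindic (A : set V) : measurable A -> measurable_fun setT (\1_A : V -> R).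
Proof. by move=> mA; exact: measurable_indic. Qed.

Lemma approximable_cvg (A : set V) (g_ : nat -> V -> R) : measurable A ->
  (forall n, smooth (g_ n)) -> (forall n x, 0 <= g_ n x <= 1) ->
  (forall x, g_ n x @[n --> \oo] --> (\1_A x : R)) -> approximable A.
Proof.
move=> mA sg g1 gA; split => // e e0.
have [n ne] := dist_cvg0 (fun n => smooth_measurable (sg n)) (mindic mA) g1 (indic01 A) gA e0.
by exists (g_ n).
Qed.

Lemma approximable_lim (A : set V) (A_ : nat -> set V) :
  (forall n, approximable (A_ n)) -> measurable A ->
  (forall x, (\1_(A_ n) x : R) @[n --> \oo] --> (\1_A x : R)) -> approximable A.
Proof.
move=> aA mA AA; split => // e e0; have e20 : 0 < e / 2 by rewrite divr_gt0.
have [n ne] := dist_cvg0 (fun n => mindic (aA n).1) (mindic mA)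
  (fun n => indic01 (A_ n)) (indic01 A) AA e20.
have [mAn /(_ _ e20)[g [sg g1] ge]] := aA n.
exists g => //; rewrite (splitr e) (le_lt_trans _ (ltrD ne ge))//.
by apply: dist_triangle => //; exact: smooth_measurable.
Qed.

Lemma approximable0 : approximable set0.
Proof.
apply: (approximable_cvg (g_ := fun _ => fun=> 0)) => //.
- by move=> n; exact: smooth_cst.
- by move=> n x; rewrite lexx ler01.
- by move=> x; rewrite indic0; exact: cvg_cst.
Qed.

Lemma approximableC A : approximable A -> approximable (~` A).
Proof.
move=> [mA aA]; split=> [|e e0]; first exact: measurableC.
have [g [sg g1] ge] := aA e e0; exists (fun x => 1 - g x).
  split=> [|x]; first by apply: smoothB; [exact: smooth_cst|exact: sg].
  by have := g1 x; lra.
rewrite (_ : Rintegral _ _ _ = \int[mu]_x (`|\1_A x - g x| * rho x))//.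
apply: eq_Rintegral => x _; congr (_ * _).
rewrite (_ : \1_(~` A) x = 1 - \1_A x :> R); first by rewrite -normrN; congr `|_|; ring.
by rewrite !indicE in_setC; case: (_ \in _) => /=; rewrite ?subrr ?subr0.
Qed.

Lemma approximableU A B : approximable A -> approximable B -> approximable (A `|` B).
Proof.
move=> [mA aA] [mB aB]; split=> [|e e0]; first exact: measurableU.
have e20 : 0 < e / 2 by rewrite divr_gt0.
have [g [sg g1] ge] := aA _ e20; have [h [sh h1] he] := aB _ e20.
have smg := smooth_measurable sg; have smh := smooth_measurable sh.
(* The smooth counterpart of the indicator of a union, by inclusion and exclusion. *)
exists (fun x => g x + (h x - g x * h x)).
  split=> [|x]; first exact: smoothD sg (smoothB sh (smoothM sg sh)).
  by have := g1 x; have := h1 x; nra.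
rewrite (splitr e) (le_lt_trans _ (ltrD ge he))// -RintegralD//; last 2 first.
- by apply: int_dist => //; exact: mindic.
- by apply: int_dist => //; exact: mindic.
apply: le_Rintegral => //.
- apply: int_dist => //; first by apply: mindic; exact: measurableU.
    apply: measurable_funD => //; apply: measurable_funB => //; exact: measurable_funM.
  by move=> x; have := g1 x; have := h1 x; nra.
- by apply: integrable_addr; apply: int_dist => //; exact: mindic.
move=> x _; rewrite -mulrDl ler_wpM2r//.
rewrite (_ : \1_(A `|` B) x = \1_A x + (\1_B x - \1_A x * \1_B x) :> R); last first.
  by rewrite !indicE in_setU; case: (_ \in _); case: (_ \in _) => /=; lra.
move: (indic01 A x) (indic01 B x) (g1 x) (h1 x).
set a := \1_A x; set b := \1_B x; move: (g x) (h x) => s t a1 b1 s1 t1.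
(* Each error is multiplied by a factor in [0, 1], so the errors of g and h simply add up. *)
rewrite (_ : _ - _ = (a - s) * (1 - b) + (b - t) * (1 - s)); last by ring.
rewrite (le_trans (ler_normD _ _))// !normrM lerD// ler_piMr// ger0_norm; lra.
Qed.

Lemma approximable_bigcup (F : (set V)^nat) :
  (forall n, approximable (F n)) -> approximable (\bigcup_n F n).
Proof.
move=> aF; pose U n := \big[setU/set0]_(k < n) F k.
have aU n : approximable (U n).
  rewrite /U; elim: n => [|n IH]; first by rewrite big_ord0; exact: approximable0.
  by rewrite big_ord_recr /=; exact: approximableU.
apply: (approximable_lim (A_ := U)) => //.
  by apply: bigcupT_measurable => n; case: (aF n).
move=> x; have [[n _ Fx]|nF] := pselect ((\bigcup_n F n) x).
  rewrite indicE mem_set; last by exists n.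
  apply: cvg_near_cst; near=> m; rewrite indicE mem_set// /U.
  rewrite -bigcup_mkord; exists n => //=; near: m; exact: nbhs_infty_gt.
apply: cvg_near_cst; apply: nearW => m; rewrite !indicE !memNset//.
by rewrite /U -bigcup_mkord => -[k _ Fk]; apply: nF; exists k.
Unshelve. all: by end_near. Qed.

Lemma sigmoid_le_inv (t : R) : 0 <= t -> 1 - sigmoid t <= (1 + t)^-1.
Proof.
move=> t0; rewrite /sigmoid expRN.
have e0 := expR_gt0 t; have := expR_ge1Dx t => et.
rewrite (_ : 1 - _ = (1 + expR t)^-1); last by field; rewrite !gt_eqF//; lra.
rewrite lef_pV2 ?posrE//; lra.
Qed.

Lemma sigmoidN (t : R) : sigmoid (- t) = 1 - sigmoid t.
Proof.
rewrite /sigmoid opprK expRN; have e0 := expR_gt0 t.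
by field; rewrite !gt_eqF//; lra.
Qed.

Lemma approximable_ray (i : 'I_d) (a : R) : approximable [set x : V | a < x ord0 i].
Proof.
have mA : measurable [set x : V | a < x ord0 i].
  rewrite -[X in measurable X]setTI.
  rewrite (_ : [set x : V | _] = (fun x : V => x ord0 i : measurableTypeR R) @^-1` `]a, +oo[%classic).
    exact: measurable_coord.
  by apply/seteqP; split => x /=; rewrite in_itv/= andbT.
(* This is the sigmoid of n^2 (x_i - a) - n. For x_i > a the term n^2 (x_i - a) wins; for x_i <= a,
   boundary included, the shift by - n drives the value to 0. *)
pose g_ (n : nat) (x : V) := sigmoid ((n%:R ^+ 2) * x ord0 i + (- n%:R ^+ 2 * a - n%:R)).
have inv0 : (1 + n%:R)^-1 @[n --> \oo] --> (0 : R).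
  rewrite (_ : (fun n : nat => _) = fun n => n.+1%:R^-1); last first.
    by apply/funext => n; rewrite -[in RHS]addn1 natrD addrC.
  exact: cvg_harmonic.
apply: (approximable_cvg (g_ := g_)) => //.
- by move=> n; exact: smooth_sigmoid_coord.
- by move=> n x; rewrite ltW ?sigmoid_gt0// sigmoid_le1.
move=> x; rewrite indicE; case: (boolP (x \in _)); rewrite ?inE/= => ax.
- rewrite /= -[X in _ --> X]subr0.
  rewrite (_ : (fun n => g_ n x) = fun n => 1 - (1 - g_ n x)); last first.
    by apply/funext => n; rewrite subKr.
  apply: cvgB; first exact: cvg_cst.
  apply: (squeeze_cvgr _ (cvg_cst 0) inv0).
  have dx : 0 < x ord0 i - a by rewrite subr_gt0.
  near=> n; rewrite subr_ge0 sigmoid_le1/=.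
  have nd : n%:R <= n%:R ^+ 2 * (x ord0 i - a) - n%:R.
    have n0 : 0 <= n%:R :> R by [].
    have : 2 / (x ord0 i - a) <= n%:R by near: n; exact: nbhs_infty_ger.
    rewrite ler_pdivrMr// => h; rewrite expr2; nra.
  have -> : g_ n x = sigmoid (n%:R ^+ 2 * (x ord0 i - a) - n%:R).
    by rewrite /g_; congr sigmoid; ring.
  rewrite (le_trans (sigmoid_le_inv _))//; first exact: le_trans nd.
  by rewrite lef_pV2 ?posrE ?lerD2l// ltr_pwDl//; apply: le_trans nd.
- rewrite /=; apply: (squeeze_cvgr _ (cvg_cst 0) inv0).
  near=> n; rewrite ltW ?sigmoid_gt0//=.
  have n0 : 0 <= n%:R :> R by [].
  have xa : x ord0 i <= a by rewrite leNgt; apply/negP => ?; move/negP : ax; apply; rewrite inE.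
  have -> : g_ n x = sigmoid (- (n%:R ^+ 2 * (a - x ord0 i) + n%:R)).
    by rewrite /g_; congr sigmoid; ring.
  rewrite sigmoidN (le_trans (sigmoid_le_inv _))//.
    by rewrite addr_ge0// mulr_ge0// ?sqr_ge0// subr_ge0.
  rewrite lef_pV2 ?posrE ?ltr_pwDl//; last first.
    by rewrite addr_ge0// mulr_ge0// ?sqr_ge0// subr_ge0.
  by rewrite lerD2l lerDr mulr_ge0// ?sqr_ge0// subr_ge0.
Unshelve. all: by end_near. Qed.

Lemma measurable_approximable (A : set V) : measurable A -> approximable A.
Proof.
have sig : sigma_algebra setT approximable.
  split; first exact: approximable0.
    by move=> B; rewrite setTD; exact: approximableC.
  exact: approximable_bigcup.
have coordB (i : 'I_d) (B : set (measurableTypeR R)) : measurable B ->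
    approximable ((fun x : V => x ord0 i : measurableTypeR R) @^-1` B).
  pose S (B : set R) := approximable ((fun x : V => x ord0 i) @^-1` B).
  suff : <<s RGenOInfty.G (R := R) >> `<=` S.
    have E : @measurable _ (measurableTypeR R) = <<s RGenOInfty.G (R := R) >>.
      exact: RGenOInfty.measurableE.
    by move=> GS; rewrite E; exact: GS.
  apply: smallest_sub.
    split.
    - by rewrite /S preimage_set0; exact: approximable0.
    - by move=> C; rewrite setTD /S preimage_setC; exact: approximableC.
    - by move=> F SF; rewrite /S preimage_bigcup; exact: approximable_bigcup.
  move=> _ [a ->]; rewrite /S (_ : _ @^-1` _ = [set x : V | a < x ord0 i]); first exact: approximable_ray.
  by apply/seteqP; split => x /=; rewrite in_itv/= andbT.
apply: (smallest_sub sig) => B; rewrite /= -bigcup_seq /= => -[i _ [C mC <-]].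
by rewrite setTI; exact: coordB.
Qed.

End density.

(** * The L1 norm by duality with test functions *)

Section fatou_le.
Context {R : realType} {d : nat}.
Local Notation V := 'rV[R]_d.
Local Notation mu := (lebesgue_rV d).
Local Open Scope ereal_scope.

Lemma ge0_integral_cvg_le (f_ : nat -> V -> \bar R) (f : V -> \bar R) (c : \bar R) :
  (forall n, measurable_fun setT (f_ n)) -> (forall n x, 0 <= f_ n x) ->
  (forall x, f_ n x @[n --> \oo] --> f x) ->
  (forall n, \int[mu]_x f_ n x <= c) -> \int[mu]_x f x <= c.
Proof.
move=> mf f0 ff fc.
rewrite (_ : \int[mu]_x f x = \int[mu]_x limn_einf (f_^~ x)); last first.
  by apply: eq_integral => x _; rewrite (cvg_limn_einf_sup (ff x)).1.
apply: (le_trans (fatou mu measurableT mf _)) => //.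
rewrite limn_einf_lim; apply: lime_le; first exact: is_cvg_einfs.
apply: nearW => n; apply: (le_trans _ (fc n)).
by apply: ereal_inf_lbound; exists n => //=.
Qed.

End fatou_le.

Section duality.
Context {R : realType} {d : nat}.
Local Notation V := 'rV[R]_d.
Local Notation mu := (lebesgue_rV d).

Definition cutoff (chi : V -> R) := btest chi /\
  exists2 r : R, 0 < r & forall x, `|x| <= r -> chi x = 1.

Definition loc_integrable (a : V -> R) := measurable_fun setT a /\
  forall u, btest u -> mu.-integrable setT (EFin \o (fun x => a x * u x)).

(** A [cutoff] may change sign; the square makes the truncation nonnegative and keeps the value 1
    near 0. *)
Definition cutoff_at (chi : V -> R) (n : nat) (x : V) : R := chi (n.+1%:R^-1 *: x) ^+ 2.

Lemma cutoff_at_btest chi n : btest chi -> btest (cutoff_at chi n).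
Proof.
move=> bc.
have bn : btest (fun x : V => chi (n.+1%:R^-1 *: x + 0)).
  by apply: btest_affine => //; rewrite invr_eq0 pnatr_eq0.
rewrite (_ : cutoff_at chi n =
  fun x => chi (n.+1%:R^-1 *: x + 0) * chi (n.+1%:R^-1 *: x + 0)).
  by apply: btestM => //; case: bn.
by apply/funext => x; rewrite /cutoff_at addr0 expr2.
Qed.

Lemma cutoff_at_eq1 chi : cutoff chi -> exists2 r : R, 0 < r &
  forall n x, `|x| <= n.+1%:R * r -> cutoff_at chi n x = 1.
Proof.
move=> [_ [r r0 chi1]]; exists r => // n x xr.
rewrite /cutoff_at chi1 ?expr1n// normrZ ger0_norm// mulrC ler_pdivrMr//.
by rewrite mulrC.
Qed.

Lemma cutoff_at_cvg chi (x : V) : cutoff chi -> cutoff_at chi n x @[n --> \oo] --> (1 : R).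
Proof.
move=> /cutoff_at_eq1[r r0 chi1].
apply: cvg_near_cst; near=> n; apply: chi1.
rewrite -ler_pdivrMr// (@le_trans _ _ n%:R)//; last by rewrite ler_nat.
by near: n; exact: nbhs_infty_ger.
Unshelve. all: by end_near. Qed.

(* The sign of k is replaced by 2 g - 1, where g is a smooth function close to
   the indicator of {k > 0} in L1 of the measure |k| dx. *)
Lemma L1_duality chi : cutoff chi -> exists2 B : R, 0 < B &
  forall (k : V -> R) (M : R), loc_integrable k ->
  (forall u, btest u -> (forall x, `|u x| <= 1) -> `|\int[mu]_x (k x * u x)| <= M) ->
  (\int[mu]_x `|k x|%:E <= (B * M)%:E)%E.
Proof.
move=> cc; have [bc _] := cc.
have [C C0 chiC] := btest_bounded bc.
(* B bounds all the truncations, so the test function u below, which carries the factor 1 / B, is at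
   most 1 in absolute value. *)
exists (1 + C ^+ 2) => [|k M [mk ki] kM]; first by rewrite ltr_pwDl// sqr_ge0.
set B := 1 + C ^+ 2.
have B0 : 0 < B by rewrite ltr_pwDl// sqr_ge0.
have zB n x : 0 <= cutoff_at chi n x <= B.
  rewrite sqr_ge0/= /cutoff_at -real_normK ?num_real//.
  rewrite (@le_trans _ _ (C ^+ 2))//; last by rewrite lerDr.
  by rewrite lerXn2r ?nnegrE// chiC.
have key n : \int[mu]_x (`|k x| * cutoff_at chi n x) <= B * M.
  set z := cutoff_at chi n.
  have bz : btest z by exact: cutoff_at_btest.
  have z0 x : 0 <= z x by case/andP: (zB n x).
  have kzi := ki _ bz.
  pose rho x := `|k x| * z x.
  have rhoE x : rho x = `|k x * z x| by rewrite normrM (ger0_norm (z0 x)).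
  have rho0 x : 0 <= rho x by rewrite mulr_ge0.
  have rhoi : mu.-integrable setT (EFin \o rho).
    by rewrite (_ : rho = fun x => `|k x * z x|); [exact: integrable_normr|apply/funext].
  apply/ler_addgt0Pr => e e0.
  have mA : measurable [set x | 0 < k x].
    rewrite -[X in measurable X]setTI.
    rewrite (_ : [set x | _] = k @^-1` `]0, +oo[%classic); first exact: mk.
    by apply/seteqP; split => x /=; rewrite in_itv/= andbT.
  have e20 : 0 < e / 2 by rewrite divr_gt0.
  have [_ /(_ _ e20)[g [sg g1] ge]] := measurable_approximable rho0 rhoi mA.
  have mg := smooth_measurable sg.
  pose u x := B^-1 * (z x * (2 * g x - 1)).
  have sg' : smooth (fun x => 2 * g x - 1).
    by apply: smoothB; [exact: smoothZ|exact: smooth_cst].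
  have bu : btest u.
    by apply: btestMl; [exact: smooth_cst|exact: btestM bz sg'].
  have u1 x : `|u x| <= 1.
    rewrite normrM gtr0_norm ?invr_gt0// mulrC ler_pdivrMr// mul1r normrM.
    rewrite (ger0_norm (z0 x)) -[leRHS]mulr1 ler_pM//; first by case/andP: (zB n x).
    by rewrite ler_norml; have := g1 x; lra.
  have := kM u bu u1; have kui := ki _ bu.
  have Ei : mu.-integrable setT (EFin \o (fun x => `|\1_[set x | 0 < k x] x - g x| * rho x)).
    apply: (integrable_le (g := rho)) => //.
      apply: measurable_funM; last by apply/measurable_EFinP; exact: measurable_int rhoi.
      by apply: measurableT_comp => //; apply: measurable_funB => //; exact: measurable_indic.
    move=> x; rewrite normrM normr_id (ger0_norm (rho0 x)) ler_piMl//.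
    rewrite ler_norml indicE; have := g1 x; case: (x \in _) => /=; lra.
  (* Pointwise the two sides agree: k (2 g - 1) misses |k| by exactly twice |k| times the distance
     from g to the indicator of k > 0. *)
  have : \int[mu]_x rho x <= \int[mu]_x (B * (k x * u x) + 2 * (`|\1_[set x | 0 < k x] x - g x| * rho x)).
    apply: le_Rintegral => //.
      by apply: integrable_addr; exact: integrable_scaler.
    move=> x _; rewrite /u (_ : B * _ = k x * z x * (2 * g x - 1)); last first.
      by field; rewrite gt_eqF.
    rewrite /rho indicE; have := g1 x; have := z0 x.
    case: (boolP (x \in _)); rewrite ?inE /= => kx zx gx.
      have -> : `|1 - g x| = 1 - g x by rewrite ger0_norm; lra.
      by rewrite (gtr0_norm kx); nra.
    have {}kx : k x <= 0 by rewrite leNgt; apply: contra kx => h; rewrite inE.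
    rewrite /= sub0r normrN; have -> : `|g x| = g x by rewrite ger0_norm; lra.
    by rewrite (ler0_norm kx); nra.
  rewrite RintegralD//; [|exact: integrable_scaler|exact: integrable_scaler].
  rewrite !RintegralZl// => h1 h2.
  have : B * \int[mu]_x (k x * u x) <= B * M.
    by rewrite ler_pM2l// (le_trans (ler_norm _)).
  by move: h1 ge; rewrite -/rho; lra.
have mkz n : measurable_fun setT (fun x => (`|k x| * cutoff_at chi n x)%:E).
  apply/measurable_EFinP; apply: measurable_funM; first exact: measurableT_comp.
  by apply: smooth_measurable; case: (cutoff_at_btest n bc).
apply: (ge0_integral_cvg_le (f_ := fun n x => (`|k x| * cutoff_at chi n x)%:E)) => //.
- by move=> n x; rewrite lee_fin mulr_ge0//; case/andP: (zB n x).
- move=> x; apply: cvg_EFin; first exact: nearW.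
  rewrite -[X in _ --> X]mulr1; apply: cvgM; first exact: cvg_cst.
  exact: cutoff_at_cvg.
- move=> n; have := key n; rewrite -lee_fin /Rintegral fineK//; apply: integrable_fin_num => //.
  have bz := cutoff_at_btest n bc.
  have := integrable_normr (ki _ bz); apply: eq_integrable => // x _ /=.
  by rewrite normrM [X in (_ * X)%:E]ger0_norm//; case/andP: (zB n x).
Qed.

End duality.

(** * Bounded variation and L1 bounds on translates *)

Section translation.
Context {R : realType} {d : nat}.
Local Notation V := 'rV[R]_d.
Local Notation mu := (lebesgue_rV d).
Variables (chi : V -> R).
Hypothesis chiP : cutoff chi.

Lemma dominating_cutoff (r : R) : exists n, forall x, `|x| <= r -> cutoff_at chi n x = 1.
Proof.
have [r0 r00 c1] := cutoff_at_eq1 chiP.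
exists (Num.truncn (`|r| / r0)) => x xr; apply: c1.
rewrite -ler_pdivrMr// (@le_trans _ _ (`|r| / r0))//.
  by rewrite ler_pM2r ?invr_gt0// (le_trans xr)// ler_norm.
by rewrite ltW// truncnS_gt.
Qed.

(** The function a need not be differentiable, so the translation is put on u. For |s| < T the
    translates of u live in one ball, and a truncation of a that equals a there, times a bound for
    the partial derivative of u, dominates. *)
Lemma is_derive_Rintegral_shift (a u : V -> R) i (t : R) : loc_integrable a -> btest u ->
  is_derive t 1 (fun s : R => \int[mu]_x (a x * u (s *: delta_mx ord0 i + x)))
    (\int[mu]_x (a x * partial i u (t *: delta_mx ord0 i + x))).
Proof.
move=> [ma ai] bu.
pose T : R := `|t| + 1.
have bpu := btest_partial i bu.
have [C C0 uC] := btest_bounded bpu.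
have [_ [r ur]] := bpu.
have [n n1] := dominating_cutoff (r + T * `|delta_mx ord0 i : V|).
have bz : btest (cutoff_at chi n) by apply: cutoff_at_btest; case: chiP.
have tT : `|t| < T by rewrite ltrDl.
clearbody T; move: t tT.
apply: (@is_derive_under_Rintegral R d
    (fun s x => a x * u (s *: delta_mx ord0 i + x))
    (fun s x => a x * partial i u (s *: delta_mx ord0 i + x))
    (fun x => C * `|a x * cutoff_at chi n x|)).
- move=> s _; apply: ai; rewrite (_ : (fun _ => _) = fun x => u (1 *: x + s *: delta_mx ord0 i)).
    exact: btest_affine.
  by apply/funext => x; rewrite scale1r addrC.
- move=> s x _.
  have [du Du] := is_derive_line (@smooth_derivable _ _ u i (s *: delta_mx ord0 i + x) bu.1).
  apply: DeriveDef; first exact: (derivableM (derivable_cst (a x) s 1) du).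
  have -> : (fun s0 : R => a x * u (s0 *: delta_mx ord0 i + x)) =
    cst (a x) * (fun s0 : R => u (s0 *: delta_mx ord0 i + x)) by [].
  by rewrite (deriveM (derivable_cst _ _ _) du) derive_cst scaler0 addr0 Du.
- move=> s x sT.
  have [rx|rx] := leP r `|s *: delta_mx ord0 i + x|.
    by rewrite ur// mulr0 normr0 mulr_ge0.
  rewrite n1 ?mulr1 ?normrM 1?[leRHS]mulrC ?ler_wpM2l//.
  have := ler_normB (s *: delta_mx ord0 i + x) (s *: delta_mx ord0 i).
  rewrite (addrC (s *: _)) addrK addrC [`|s *: _|]normrZ => /le_trans; apply.
  by apply: lerD; [exact: ltW|apply: ler_wpM2r => //; exact: ltW].
- by apply: integrable_scaler; apply: integrable_normr; exact: ai.
Qed.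

Lemma Rintegral_shift_le (a u : V -> R) (M t : R) i : loc_integrable a ->
  btest u -> (forall s : R, `|\int[mu]_x (a x * partial i u (s *: delta_mx ord0 i + x))| <= M) ->
  `|\int[mu]_x (a x * u (t *: delta_mx ord0 i + x)) - \int[mu]_x (a x * u x)| <= M * `|t|.
Proof.
move=> la bu uM.
pose A (s : R) := \int[mu]_x (a x * u (s *: delta_mx ord0 i + x)).
pose A' (s : R) := \int[mu]_x (a x * partial i u (s *: delta_mx ord0 i + x)).
have dA (s : R) : is_derive s 1 A (A' s) by exact: is_derive_Rintegral_shift.
have -> : \int[mu]_x (a x * u x) = A 0.
  by apply: eq_Rintegral => x _; rewrite scale0r add0r.
rewrite -/(A t).
have cA : continuous A.
  by move=> s; have [+ _] := dA s; move=> /derivable1_diffP /differentiable_continuous.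
have main (b c : R) : b <= c -> `|A c - A b| <= M * (c - b).
  move=> bc; have [|s sbc ->] := @MVT_segment R A A' b c bc (fun s _ => dA s).
    exact: continuous_subspaceT.
  by rewrite normrM (ger0_norm (_ : 0 <= c - b)) ?subr_ge0// ler_wpM2r ?subr_ge0// uM.
have [t0|t0] := leP 0 t.
  by rewrite (ger0_norm t0) -[X in _ * X]subr0; exact: main.
by rewrite (ltr0_norm t0) distrC -[- t]sub0r; apply: main => //; exact: ltW.
Qed.

(** What is kept of the gradient measure: its action on real test functions, controlled by their sup
    norm. *)
Definition BV_bound (a : V -> R) (M : R) := loc_integrable a /\
  forall i u (C : R), btest u -> (forall x, `|u x| <= C) ->
    `|\int[mu]_x (a x * partial i u x)| <= M * C.

(** The l^1 length of h appears because the path from 0 to h is taken along the coordinate axes. *)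
Definition translation_bound (a : V -> R) (M : R) := loc_integrable a /\
  forall h : V, (\int[mu]_x `|a (x + h) - a x|%:E <= (M * \sum_i `|h ord0 i|)%:E)%E.

Lemma loc_integrable_shift (a : V -> R) h : loc_integrable a -> loc_integrable (fun x => a (x + h)).
Proof.
move=> [ma ai]; split.
  rewrite (_ : (fun _ => _) = fun x => a (1 *: x + h)).
    by apply: (measurableT_comp ma); exact: measurable_affine.
  by apply/funext => x; rewrite scale1r.
move=> u bu.
have bu' : btest (fun x => u (1 *: x + - h)) by exact: btest_affine.
have := integrable_translate h (ai _ bu').
by apply: eq_integrable => // x _ /=; rewrite scale1r addrK.
Qed.

Lemma loc_integrableB (a b : V -> R) : loc_integrable a -> loc_integrable b ->
  loc_integrable (fun x => a x - b x).
Proof.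
move=> [ma ai] [mb bi]; split; first exact: measurable_funB.
move=> u bu; have := integrable_subr (ai u bu) (bi u bu).
by apply: eq_integrable => // x _ /=; rewrite mulrBl.
Qed.

Lemma Rintegral_shift_pairing (a u : V -> R) h : loc_integrable a -> btest u ->
  \int[mu]_x ((a (x + h) - a x) * u x) =
  \int[mu]_x (a x * u (x - h)) - \int[mu]_x (a x * u x).
Proof.
move=> la bu; have [ma ai] := la.
have bu' : btest (fun x => u (x - h)).
  rewrite (_ : (fun _ => _) = fun x => u (1 *: x - h)); first exact: btest_affine.
  by apply/funext => x; rewrite scale1r.
rewrite -(Rintegral_translate h (ai _ bu')) -RintegralB//.
- by apply: eq_Rintegral => x _; rewrite addrK mulrBl.
- have [_ /(_ u bu)] := loc_integrable_shift h la.
  by apply: eq_integrable => // x _ /=; rewrite addrK.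
- exact: ai.
Qed.

(** By [L1_duality] it is enough to pair a (x + t e_i) - a x with test functions u bounded by 1.
    With the translation moved to u, the pairing is an increment of a function whose derivative is
    the pairing of a with a translate of [partial i u], hence at most M by [BV_bound]; the mean
    value theorem gives M |t|. *)
Lemma BV_translation_bound : exists2 B : R, 0 < B &
  forall a M, 0 <= M -> BV_bound a M -> translation_bound a (B * M).
Proof.
have [B B0 dual] := L1_duality chiP; exists B => // a M M0 [la aM]; split => //.
have step i (t : R) : (\int[mu]_x `|a (x + t *: delta_mx ord0 i) - a x|%:E <= (B * M * `|t|)%:E)%E.
  rewrite -mulrA; apply: dual.
    by apply: loc_integrableB => //; exact: loc_integrable_shift.
  move=> u bu u1; rewrite Rintegral_shift_pairing//.
  rewrite (_ : \int[mu]_x (a x * u (x - t *: delta_mx ord0 i)) =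
    \int[mu]_x (a x * u ((- t) *: delta_mx ord0 i + x))); last first.
    by apply: eq_Rintegral => x _; rewrite addrC scaleNr.
  rewrite -(normrN t); apply: Rintegral_shift_le => // s.
  rewrite (_ : (fun x => a x * _) = fun x => a x * partial i (fun y => u (1 *: y + s *: delta_mx ord0 i)) x); last first.
    apply/funext => x; rewrite partial_affine; last by case: bu.
    by rewrite mul1r scale1r addrC.
  by rewrite -(mulr1 M); apply: aM => //; apply: btest_affine.
move=> h.
(* The coordinates of h are added one at a time. The new increment v translates the integral already
   estimated, which leaves its value unchanged, and costs one application of [step]. *)
have aux (l : seq 'I_d) : (\int[mu]_x `|a (x + \sum_(i <- l) h ord0 i *: delta_mx ord0 i) - a x|%:E
    <= (B * M * \sum_(i <- l) `|h ord0 i|)%:E)%E.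
  elim: l => [|i l IH].
    rewrite !big_nil mulr0 integral0_eq// => x _.
    by rewrite addr0 subrr normr0.
  rewrite !big_cons; set w := \sum_(j <- l) _ in IH *.
  set v := _ *: delta_mx ord0 i.
  have mk (h1 h2 : V) : measurable_fun setT (fun x : V => `|a (x + h1) - a (x + h2)|%:E).
    apply/measurable_EFinP; apply: measurableT_comp => //.
    by apply: measurable_funB; [case: (loc_integrable_shift h1 la)|case: (loc_integrable_shift h2 la)].
  have mk0 (h1 : V) : measurable_fun setT (fun x : V => `|a (x + h1) - a x|%:E).
    by have := mk h1 0; under eq_fun do rewrite addr0.
  apply: (@le_trans _ _ (\int[mu]_x (`|a (x + v + w) - a (x + v)|%:E + `|a (x + v) - a x|%:E))%E).
    apply: ge0_le_integral => //.
      apply: emeasurable_funD; last exact: mk0.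
      by under eq_fun do rewrite -addrA; exact: mk.
    by move=> x _; rewrite -EFinD lee_fin addrA ler_distD.
  rewrite ge0_integralD//; last first.
    by under eq_fun do rewrite -addrA; exact: mk.
  rewrite mulrDr EFinD addeC; apply: leeD; first exact: step.
  by rewrite (ge0_integral_translate v (f := fun x => `|a (x + w) - a x|%:E)).
by have := aux (index_enum 'I_d); rewrite -row_sum_delta.
Qed.

End translation.

(** * Growth at infinity of functions with controlled translates *)

Section growth.
Context {R : realType} {d : nat}.
Local Notation V := 'rV[R]_d.
Local Notation mu := (lebesgue_rV d).

Lemma measurable_norm_le (r : R) : measurable [set x : V | `|x| <= r].
Proof.
have mn : measurable_fun setT (fun x : V => `|x|).
  by apply: continuous_measurable_rV; exact: norm_continuous.
rewrite -[X in measurable X]setTI.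
rewrite (_ : [set x : V | _] = (fun x : V => `|x|) @^-1` `]-oo, r]%classic); first exact: mn.
by apply/seteqP; split => x /=; rewrite in_itv.
Qed.

Lemma lebesgue_ball_gt0 (r : R) : 0 < r -> (0 < mu [set x : V | (`|x| <= r)%R])%E.
Proof.
move=> r0.
pose A (i : 'I_d) : set (measurableTypeR R) := `[- r, r]%classic.
have mA i : measurable (A i) by exact: measurable_itv.
have -> : [set x : V | `|x| <= r] = [set x : V | forall i, A i (x ord0 i)].
  apply/seteqP; split => x /= xr.
    by move=> i; rewrite /A /= in_itv/= -ler_norml (le_trans (coord_le_norm x i)).
  by apply: norm_le_coord (ltW r0) _ => i; have := xr i; rewrite /A /= in_itv/= ler_norml.
rewrite lebesgue_rV_box// /A; elim/big_ind : _ => // [x y|i _]; first exact: mule_gt0.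
by rewrite lebesgue_measure_itv/= lte_fin gtrN// -EFinB lte_fin opprK addr_gt0.
Qed.

Lemma ge0_integral_gt0 (u : V -> R) (r e : R) : measurable_fun setT u ->
  (forall x, 0 <= u x) -> 0 < r -> 0 < e -> (forall x, `|x| <= r -> e <= u x) ->
  (0 < \int[mu]_x (u x)%:E)%E.
Proof.
move=> mu' u0 r0 e0 ue; set D := [set x : V | `|x| <= r].
have mD : measurable D by exact: measurable_norm_le.
apply: (@lt_le_trans _ _ (\int[mu]_(x in D) (cst e%:E) x)%E).
  by rewrite integral_cst// mule_gt0// lebesgue_ball_gt0.
apply: (@le_trans _ _ (\int[mu]_(x in D) (u x)%:E)%E).
  apply: ge0_le_integral => //.
  - by move=> x _; rewrite lee_fin ltW.
  - by apply/measurable_EFinP; exact: measurable_funTS.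
apply: ge0_subset_integral => //; first exact/measurable_EFinP.
by move=> x _; rewrite lee_fin.
Qed.

Lemma measurable_fun_integral_snd (F : V -> V -> R) :
  measurable_fun setT (fun z : V * V => (F z.1 z.2)%:E) -> (forall x y, 0 <= F x y) ->
  measurable_fun setT (fun x => (\int[mu]_y (F x y)%:E)%E).
Proof.
move=> mF F0; apply: (measurable_fun_fubini_tonelli_F (fun z : V * V => (F z.1 z.2)%:E)) => //.
by move=> z; rewrite lee_fin.
Qed.

Lemma measurable_fun_integral_fst (F : V -> V -> R) :
  measurable_fun setT (fun z : V * V => (F z.1 z.2)%:E) -> (forall x y, 0 <= F x y) ->
  measurable_fun setT (fun y => (\int[mu]_x (F x y)%:E)%E).
Proof.
move=> mF F0; apply: (measurable_fun_fubini_tonelli_G (fun z : V * V => (F z.1 z.2)%:E)) => //.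
by move=> z; rewrite lee_fin.
Qed.

(** Integrate |a z| <= |a z - a y| + |a y| against q y * w z, with q a nonnegative test function and
    w the weight. The second term is a product of two finite integrals. In the first, put z = y + h:
    by Peetre's inequality w (y + h) is at most w h times a power of 1 + |y|, which q absorbs, and
    the integral over y is then at most a multiple of |h| w h. The factor |h| costs one power of the
    weight, hence the exponent 2 d + 1. *)
Lemma integrable_translation_bound (chi a : V -> R) (M : R) : cutoff chi ->
  translation_bound a M -> mu.-integrable setT (EFin \o (fun x => a x * wt d.*2.+1 x)).
Proof.
move=> cc [[ma ai] aM].
pose q := cutoff_at chi 0.
have bq : btest q by apply: cutoff_at_btest; case: cc.
have q0 y : 0 <= q y by rewrite sqr_ge0.
have mq := smooth_measurable bq.1.
have [_ /(_ d.*2.+1)[C C0 qC]] := btest_rapid bq.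
have c0 : (0 < \int[mu]_y (q y)%:E)%E.
  have [r r0 q1] := cutoff_at_eq1 cc.
  apply: (ge0_integral_gt0 mq q0 r0 ltr01) => x xr.
  by rewrite /q q1// mul1r.
clearbody q.
set w := wt d.*2.+1.
have mw : measurable_fun setT (w : V -> R) by exact: measurable_wt.
have w0 (x : V) : 0 <= w x by exact: wt_ge0.
have mabs : measurable_fun setT (fun x => `|a x|) by exact: measurableT_comp.
have m1 : measurable_fun setT (fun yz : V * V => (`|a yz.2 - a yz.1| * w yz.2 * q yz.1)%:E).
  apply/measurable_EFinP; apply: measurable_funM; last exact: measurableT_comp mq measurable_fst.
  apply: measurable_funM; last exact: measurableT_comp mw measurable_snd.
  apply: measurableT_comp => //; apply: measurable_funB.
    exact: measurableT_comp ma measurable_snd.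
  exact: measurableT_comp ma measurable_fst.
have madd : measurable_fun setT (fun yz : V * V => yz.1 + yz.2).
  apply: measurable_fun_rV => i.
  rewrite (_ : _ \o _ = fun yz : V * V => (yz.1 ord0 i : measurableTypeR R) + yz.2 ord0 i).
    apply: measurable_funD.
      exact: measurableT_comp (measurable_coord i) measurable_fst.
    exact: measurableT_comp (measurable_coord i) measurable_snd.
  by apply/funext => yz /=; rewrite mxE.
have m2 : measurable_fun setT (fun yh : V * V => (`|a (yh.1 + yh.2) - a yh.1| * w yh.2)%:E).
  apply/measurable_EFinP.
  apply: measurable_funM; last exact: measurableT_comp mw measurable_snd.
  apply: measurableT_comp => //; apply: measurable_funB.
    exact: measurableT_comp ma madd.
  exact: measurableT_comp ma measurable_fst.
pose I := (\int[mu]_y \int[mu]_z (`|a z - a y| * w z * q y)%:E)%E.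
have Ioo : (I < +oo)%E.
  have mF : measurable_fun setT (fun yz : V * V => (C * (`|a (yz.1 + yz.2) - a yz.1| * w yz.2))%:E).
    by under eq_fun do rewrite EFinM; apply: emeasurable_funM.
  (* J is what I becomes after z = y + h, once q has absorbed the factor from Peetre's inequality; C
     is its bound. *)
  pose J := (\int[mu]_y \int[mu]_h (C * (`|a (y + h) - a y| * w h))%:E)%E.
  apply: (@le_lt_trans _ _ J).
    apply: ge0_le_integral => //.
    - by move=> y _; apply: integral_ge0 => z _; rewrite lee_fin !mulr_ge0.
    - by apply: (measurable_fun_integral_snd m1) => y z; rewrite !mulr_ge0.
    - by apply: (measurable_fun_integral_snd mF) => y z; rewrite !mulr_ge0.
    move=> y _.
    have my : measurable_fun setT (fun z => (`|a z - a y| * w z * q y)%:E).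
      exact: (measurableT_comp m1 (measurable_pair1 y)).
    rewrite -(ge0_integral_translate y my); last by move=> z; rewrite lee_fin !mulr_ge0.
    apply: ge0_le_integral => //.
    - by move=> z _; rewrite lee_fin !mulr_ge0.
    - have := measurable_affine 1 y => /(measurableT_comp my).
      by under [X in measurable_fun _ X -> _]eq_fun do rewrite /= scale1r.
    - by under eq_fun do rewrite EFinM; apply: emeasurable_funM => //; exact: (measurableT_comp m2 (measurable_pair1 y)).
    move=> h _; rewrite lee_fin mulrCA -mulrA [h + y]addrC ler_wpM2l//.
    have := wt_shift d.*2.+1 h y; rewrite -/w (addrC h) => wh.
    have qCy := qC y; rewrite (ger0_norm (q0 y)) in qCy.
    rewrite (le_trans (ler_pM _ _ wh qCy))//.
    have E : (1 + `|y|) ^+ d.*2.+1 * wt d.*2.+1 y = 1.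
      by rewrite /wt divff// gt_eqF// exprn_gt0// ltr_pwDl.
    move: E; set P := _ ^+ _; set Q := wt _ y => E.
    have -> : P * w h * (C * Q) = P * Q * (C * w h) by ring.
    by rewrite E mul1r.
  rewrite /J (fubini_tonelli (fun yz : V * V => (C * (`|a (yz.1 + yz.2) - a yz.1| * w yz.2))%:E))//; last first.
    by move=> yz; rewrite lee_fin !mulr_ge0.
  apply: (@le_lt_trans _ _ (\int[mu]_h ((C * `|M| * d%:R) * wt d.*2 h)%:E)%E); last first.
    have := integrable_scaler (C * `|M| * d%:R) (integrable_wt (leqnn d.*2)).
    move=> /integrableP[_]; apply: le_lt_trans; apply: ge0_le_integral => //.
    - by move=> h _; rewrite lee_fin mulr_ge0 ?wt_ge0// !mulr_ge0.
    - by apply/measurable_EFinP; apply: measurable_funM => //; exact: measurable_wt.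
    - apply/measurable_EFinP; apply: measurableT_comp => //.
      by apply: measurable_funM => //; exact: measurable_wt.
    - by move=> h _; rewrite lee_fin /= ler_norm.
  apply: ge0_le_integral => //.
  - by move=> h _; apply: integral_ge0 => y _; rewrite lee_fin !mulr_ge0.
  - by apply: (measurable_fun_integral_fst mF) => y z; rewrite !mulr_ge0.
  - by apply/measurable_EFinP; apply: measurable_funM => //; exact: measurable_wt.
  move=> h _.
  have mh : measurable_fun setT (fun y : V => `|a (y + h) - a y|%:E).
    apply/measurable_EFinP; apply: measurableT_comp => //; apply: measurable_funB => //.
    exact: (measurableT_comp ma (measurableT_comp madd (measurable_pair2 h))).
  rewrite (eq_integral (fun y : V => (C * w h)%:E * `|a (y + h)%R - a y|%:E)%E); last first.
    by move=> y _; rewrite -EFinM; congr EFin; ring.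
  rewrite ge0_integralZl//; last by rewrite lee_fin mulr_ge0.
  apply: (le_trans (lee_wpmul2l _ (aM h))); first by rewrite lee_fin mulr_ge0.
  rewrite -EFinM lee_fin -!mulrA ler_wpM2l// mulrCA.
  have hd : \sum_i `|h ord0 i| <= d%:R * `|h|.
    rewrite mulrC mulr_natr -[X in _ *+ X]card_ord -sumr_const.
    by apply: ler_sum => i _; exact: coord_le_norm.
  have wh : w h * `|h| <= wt d.*2 h.
    rewrite /w /wt exprSr invfM -mulrA ler_piMr ?wt_ge0//.
    by rewrite mulrC ler_pdivrMr ?ltr_pwDl// mul1r lerDr.
  rewrite (@le_trans _ _ (`|M| * (w h * (d%:R * `|h|))))//.
    rewrite (le_trans (ler_wpM2r _ (ler_norm M)))//.
      by rewrite mulr_ge0// sumr_ge0.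
    by rewrite ler_wpM2l// ler_wpM2l.
  by rewrite ler_wpM2l// mulrCA ler_wpM2l.
have mq' : measurable_fun setT (fun yz : V * V => q yz.1) by exact: measurableT_comp mq measurable_fst.
have mw' : measurable_fun setT (fun yz : V * V => w yz.2) by exact: measurableT_comp mw measurable_snd.
have ma1 : measurable_fun setT (fun yz : V * V => `|a yz.1|) by exact: measurableT_comp mabs measurable_fst.
have ma2 : measurable_fun setT (fun yz : V * V => `|a yz.2|) by exact: measurableT_comp mabs measurable_snd.
have mx (f g : V -> R) : measurable_fun setT f -> measurable_fun setT g ->
    measurable_fun setT (fun x => (f x * g x)%:E).
  by move=> mf mg; apply/measurable_EFinP; exact: measurable_funM.
have aw0 : (0 <= \int[mu]_z (`|a z| * w z)%:E)%E.
  by apply: integral_ge0 => z _; rewrite lee_fin mulr_ge0.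
have w1 : (0 <= \int[mu]_z (w z)%:E)%E by apply: integral_ge0 => z _; rewrite lee_fin.
have wfin : (\int[mu]_z (w z)%:E)%E \is a fin_num.
  by apply: integrable_fin_num => //; apply: integrable_wt; rewrite leqW.
have qfin : (\int[mu]_y (q y)%:E)%E \is a fin_num.
  by apply: integrable_fin_num => //; apply: rapid_integrable; exact: btest_rapid.
have aqfin : (\int[mu]_y (`|a y| * q y)%:E)%E \is a fin_num.
  apply: integrable_fin_num => //.
  have := integrable_normr (ai q bq); apply: eq_integrable => // y _ /=.
  by rewrite normrM (ger0_norm (q0 y)).
pose K := (\int[mu]_y \int[mu]_z (`|a y| * q y * w z)%:E)%E.
have KE : (K = (\int[mu]_y (`|a y| * q y)%:E) * \int[mu]_z (w z)%:E)%E.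
  rewrite /K (eq_integral (fun y => (`|a y| * q y)%:E * \int[mu]_z (w z)%:E)%E); last first.
    move=> y _; rewrite -ge0_integralZl//.
    - exact/measurable_EFinP.
    - by move=> z _; rewrite lee_fin.
    - by rewrite lee_fin mulr_ge0.
  rewrite ge0_integralZr//; first exact: mx.
  by move=> y _; rewrite lee_fin mulr_ge0.
have LE : ((\int[mu]_y (q y)%:E) * (\int[mu]_z (`|a z| * w z)%:E) =
    \int[mu]_y \int[mu]_z (q y * (`|a z| * w z))%:E)%E.
  rewrite -ge0_integralZr//; last 2 first.
  - exact/measurable_EFinP.
  - by move=> y _; rewrite lee_fin.
  apply: eq_integral => y _; rewrite -ge0_integralZl//.
  - exact: mx.
  - by move=> z _; rewrite lee_fin mulr_ge0.
  - by rewrite lee_fin.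
have m3 : measurable_fun setT (fun yz : V * V => (`|a yz.1| * q yz.1 * w yz.2)%:E).
  by apply/measurable_EFinP; apply: measurable_funM => //; exact: measurable_funM.
have m4 : measurable_fun setT (fun yz : V * V => (q yz.1 * (`|a yz.2| * w yz.2))%:E).
  by apply/measurable_EFinP; apply: measurable_funM => //; exact: measurable_funM.
have Loo : ((\int[mu]_y (q y)%:E) * (\int[mu]_z (`|a z| * w z)%:E) < +oo)%E.
  rewrite LE; apply: (@le_lt_trans _ _ (I + K)%E); last first.
    apply: lte_add_pinfty; first exact: Ioo.
    rewrite KE; apply: lte_mul_pinfty.
    - by apply: integral_ge0 => y _; rewrite lee_fin mulr_ge0.
    - exact: aqfin.
    - by rewrite ltey_eq wfin.
  have mI : measurable_fun setT (fun y => \int[mu]_z (`|a z - a y| * w z * q y)%:E)%E.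
    by apply: (measurable_fun_integral_snd m1) => y z; rewrite !mulr_ge0.
  have mK : measurable_fun setT (fun y => \int[mu]_z (`|a y| * q y * w z)%:E)%E.
    by apply: (measurable_fun_integral_snd m3) => y z; rewrite !mulr_ge0.
  have I0 y : (0 <= \int[mu]_z (`|a z - a y| * w z * q y)%:E)%E.
    by apply: integral_ge0 => z _; rewrite lee_fin !mulr_ge0.
  have K0 y : (0 <= \int[mu]_z (`|a y| * q y * w z)%:E)%E.
    by apply: integral_ge0 => z _; rewrite lee_fin !mulr_ge0.
  rewrite /I /K -ge0_integralD//; apply: ge0_le_integral => //.
  - by move=> y _; apply: integral_ge0 => z _; rewrite lee_fin !mulr_ge0.
  - by apply: (measurable_fun_integral_snd m4) => y z; rewrite !mulr_ge0.
  - exact: emeasurable_funD.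
  move=> y _.
  have m1y : measurable_fun setT (fun z => (`|a z - a y| * w z * q y)%:E).
    exact: (measurableT_comp m1 (measurable_pair1 y)).
  have m3y : measurable_fun setT (fun z => (`|a y| * q y * w z)%:E).
    exact: (measurableT_comp m3 (measurable_pair1 y)).
  rewrite -ge0_integralD//; last 2 first.
  - by move=> z _; rewrite lee_fin !mulr_ge0.
  - by move=> z _; rewrite lee_fin !mulr_ge0.
  apply: ge0_le_integral => //.
  - by move=> z _; rewrite lee_fin !mulr_ge0.
  - exact: (measurableT_comp m4 (measurable_pair1 y)).
  - exact: emeasurable_funD.
  move=> z _; rewrite -EFinD lee_fin.
  rewrite (_ : _ + _ = q y * ((`|a z - a y| + `|a y|) * w z)); last by ring.
  by rewrite ler_wpM2l// ler_wpM2r// -{1}(subrK (a y) (a z)) ler_normD.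
apply/integrableP; split; first by apply/measurable_EFinP; exact: measurable_funM.
rewrite (eq_integral (fun z => (`|a z| * w z)%:E)); last first.
  by move=> z _ /=; rewrite normrM (ger0_norm (w0 z)).
(* If the integral of |a| w were infinite, so would be its product with the positive integral of q,
   against [Loo]. *)
rewrite ltNge leye_eq; apply/negP => /eqP aoo; move: Loo.
by rewrite aoo gt0_muley.
Qed.

End growth.

(** * Real Fourier transforms and their regularity *)

Section fourier.
Context {R : realType} {d : nat}.
Local Notation V := 'rV[R]_d.
Local Notation mu := (lebesgue_rV d).
Implicit Types (g h : V -> R) (x y xi : V) (th : R) (i : 'I_d).

Lemma dotC x y : dot x y = dot y x.
Proof. by apply: eq_bigr => i _; rewrite mulrC. Qed.

Lemma dotDl x y xi : dot (x + y) xi = dot x xi + dot y xi.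
Proof. by rewrite -big_split; apply: eq_bigr => i _; rewrite mxE mulrDl. Qed.

Lemma dotZl (a : R) x xi : dot (a *: x) xi = a * dot x xi.
Proof. by rewrite mulr_sumr; apply: eq_bigr => i _; rewrite mxE mulrA. Qed.

Lemma dotZr (a : R) x xi : dot x (a *: xi) = a * dot x xi.
Proof. by rewrite dotC dotZl dotC. Qed.

Lemma dotDr x y xi : dot xi (x + y) = dot xi x + dot xi y.
Proof. by rewrite dotC dotDl !(dotC xi). Qed.

Lemma dotNr x xi : dot x (- xi) = - dot x xi.
Proof. by rewrite -scaleN1r dotZr mulN1r. Qed.

Lemma dot0l xi : dot 0 xi = 0.
Proof. by rewrite /dot big1// => i _; rewrite mxE mul0r. Qed.

Lemma dot_delta i xi : dot (delta_mx ord0 i) xi = xi ord0 i.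
Proof.
rewrite /dot (bigD1 i)//= mxE !eqxx mul1r big1 ?addr0// => j ji.
by rewrite mxE eqxx (negPf ji) mul0r.
Qed.

Lemma dot_norm x xi : `|dot x xi| <= d%:R * `|x| * `|xi|.
Proof.
rewrite (le_trans (ler_norm_sum _ _ _))// -mulrA mulr_natl -[X in _ *+ X]card_ord -sumr_const.
by apply: ler_sum => i _; rewrite normrM ler_pM// coord_le_norm.
Qed.

Lemma cos_lip (s t : R) : `|cos s - cos t| <= `|s - t|.
Proof.
wlog ts : s t / t <= s.
  move=> H; have [/H//|/ltW/H] := leP t s.
  by rewrite distrC (distrC s).
have [|c _ ->] := @MVT_segment R cos (fun u => - sin u) t s ts (fun u _ => is_derive_cos u).
  by apply: continuous_subspaceT; exact: continuous_cos.
by rewrite normrM normrN ler_piMl// sin_max.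
Qed.

Definition cosdot x th xi : R := cos (dot x xi + th).

Lemma measurable_dot : measurable_fun setT (fun z : V * V => dot z.1 z.2).
Proof.
apply: measurable_sum => i; apply: measurable_funM.
  exact: measurableT_comp (measurable_coord i) measurable_fst.
exact: measurableT_comp (measurable_coord i) measurable_snd.
Qed.

Lemma measurable_cosdot2 th : measurable_fun setT (fun z : V * V => cosdot z.1 th z.2).
Proof.
apply: (measurableT_comp (continuous_measurable_fun (@continuous_cos R))).
by apply: measurable_funD => //; exact: measurable_dot.
Qed.

Lemma measurable_cosdot x th : measurable_fun setT (cosdot x th).
Proof. exact: (measurableT_comp (measurable_cosdot2 th) (measurable_pair1 x)). Qed.

Lemma cosdot_le1 x th xi : `|cosdot x th xi| <= 1. Proof. exact: cos_max. Qed.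

Lemma is_derive_cosdot x th xi i : is_derive xi (delta_mx ord0 i) (cosdot x th)
  (x ord0 i * cosdot x (th + pi / 2) xi).
Proof.
apply: line_is_derive.
have -> : (fun s : R => cosdot x th (s *: delta_mx ord0 i + xi)) =
   cos \o (fun s => x ord0 i * s + (dot x xi + th)).
  apply/funext => s /=; rewrite /cosdot; congr cos.
  by rewrite dotDr dotZr (dotC _ (delta_mx _ _)) dot_delta; ring.
have d1 := is_derive_lin (x ord0 i) (dot x xi + th) 0.
apply: is_derive_eq; rewrite mulr0 add0r /cosdot addrA cosDpihalf.
by rewrite mulrC.
Qed.

Lemma lipschitz_continuous_rV (f : V -> R) (C : R) :
  (forall x y, `|f x - f y| <= C * `|x - y|) -> continuous f.
Proof.
move=> fC x; apply/(@cvgrPdist_lt _ _ V (nbhs (x : V)) _ f (f x)) => e e0.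
have C1 : 0 < `|C| + 1 by rewrite ltr_pwDr.
have d0 : 0 < e / (`|C| + 1) by rewrite divr_gt0.
apply: filterS (nbhsx_ballx x _ d0) => y; rewrite -ball_normE /ball_/= ltr_pdivlMr// => xy.
rewrite (le_lt_trans (fC x y))// (le_lt_trans _ xy)// mulrC ler_wpM2l//.
by rewrite (le_trans (ler_norm _))// lerDl.
Qed.

Lemma cosdot_lip x th xi xi' :
  `|cosdot x th xi - cosdot x th xi'| <= d%:R * `|x| * `|xi - xi'|.
Proof.
rewrite (le_trans (cos_lip _ _))// (_ : _ - _ = dot x (xi - xi')); first exact: dot_norm.
by rewrite dotDr dotNr; ring.
Qed.

Lemma cosdot_continuous x th : continuous (cosdot x th).
Proof. by apply: lipschitz_continuous_rV => xi xi'; exact: cosdot_lip. Qed.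

Lemma smooth_cosdot x th : smooth (cosdot x th).
Proof.
pose S h := exists (c : R) (t : R), h = fun xi => c * cosdot x t xi.
apply: (smooth_coind (S := S)).
- move=> _ [c [t ->]]; split=> [xi|i xi].
    apply: continuousM; first exact: cst_continuous.
    exact: cosdot_continuous.
  have [dc _] := is_derive_cosdot x t xi i.
  exact: (derivableM (derivable_cst c _ _) dc).
- move=> _ i [c [t ->]]; exists (c * x ord0 i), (t + pi / 2); apply/funext => xi.
  have [dc Dc] := is_derive_cosdot x t xi i.
  rewrite /partial; have -> : (fun xi => c * cosdot x t xi) = cst c * cosdot x t by [].
  by rewrite (deriveM (derivable_cst c _ _) dc) derive_cst scaler0 addr0 Dc -mulrA.
- by exists 1, th; apply/funext => xi; rewrite mul1r.
Qed.

Lemma cosdotC x th xi : cosdot x th xi = cosdot xi th x.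
Proof. by rewrite /cosdot dotC. Qed.

(** Phase 0 gives the cosine integral and phase pi / 2 minus the sine integral. A derivative in x
    becomes a factor xi_i and a shift of th by pi / 2, so the family is closed under
    differentiation. *)
Definition ft th g x : R := \int[mu]_xi (g xi * cosdot x th xi).

Lemma integrable_cosdot g x th : mu.-integrable setT (EFin \o g) ->
  mu.-integrable setT (EFin \o (fun xi => g xi * cosdot x th xi)).
Proof.
move=> gi; apply: (integrable_le (g := fun xi => `|g xi|)).
- apply: measurable_funM; last exact: measurable_cosdot.
  by apply/measurable_EFinP; exact: measurable_int gi.
- by move=> xi; rewrite normrM ler_piMr// cosdot_le1.
- exact: integrable_normr.
Qed.

Lemma ft_bound th g x : mu.-integrable setT (EFin \o g) ->
  `|ft th g x| <= \int[mu]_xi `|g xi|.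
Proof.
move=> gi; rewrite (le_trans (le_normr_Rintegral _ _))//; first exact: integrable_cosdot.
apply: le_Rintegral => //.
- by apply: integrable_normr; exact: integrable_cosdot.
- exact: integrable_normr.
- by move=> xi _; rewrite normrM ler_piMr// cosdot_le1.
Qed.

Lemma rapid_normM g : rapid g -> rapid (fun xi => `|g xi| * `|xi|).
Proof.
move=> [mg gr]; split.
  apply: measurable_funM; first exact: measurableT_comp.
  by apply: continuous_measurable_rV; exact: norm_continuous.
move=> n; have [C C0 gC] := gr n.+1; exists C => // x.
rewrite normrM !normr_id (le_trans (ler_wpM2r _ (gC x)))// -mulrA ler_wpM2l//.
rewrite /wt exprS invfM mulrC mulrA ler_piMl ?wt_ge0//.
by rewrite ler_pdivrMr ?ltr_pwDl// mul1r lerDr.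
Qed.

Lemma ft_continuous th g : rapid g -> continuous (ft th g).
Proof.
move=> rg; have gi := rapid_integrable rg.
apply: (lipschitz_continuous_rV (C := d%:R * \int[mu]_xi (`|g xi| * `|xi|))) => x y.
rewrite /ft -RintegralB//; [|exact: integrable_cosdot|exact: integrable_cosdot].
have gxi := rapid_integrable (rapid_normM rg).
have di := integrable_subr (integrable_cosdot x th gi) (integrable_cosdot y th gi).
rewrite (le_trans (le_normr_Rintegral _ _))//.
rewrite mulrAC -RintegralZl//; apply: le_Rintegral => //.
- exact: integrable_normr.
- exact: integrable_scaler.
- move=> xi _; rewrite -mulrBr normrM !(cosdotC _ _ xi).
  rewrite (le_trans (ler_wpM2l _ (cosdot_lip _ _ _ _)))//.
  by rewrite le_eqVlt; apply/orP; left; apply/eqP; ring.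
Qed.

Lemma is_derive_ft th g x i : rapid g -> is_derive x (delta_mx ord0 i) (ft th g)
  (ft (th + pi / 2) (fun xi => xi ord0 i * g xi) x).
Proof.
move=> rg; have gi := rapid_integrable rg.
apply: line_is_derive.
have rig := rapid_coordM i rg; have gii := rapid_integrable rig.
have := @is_derive_under_Rintegral R d
  (fun s xi => g xi * cosdot (s *: delta_mx ord0 i + x) th xi)
  (fun s xi => (xi ord0 i * g xi) * cosdot (s *: delta_mx ord0 i + x) (th + pi / 2) xi)
  (fun xi => `|xi ord0 i * g xi|) 1.
move=> /(_ _ _ _ _ 0); rewrite normr0 scale0r add0r; apply => //.
- by move=> s _; exact: integrable_cosdot.
- move=> s xi _.
  have [du Du] := is_derive_line (@smooth_derivable _ _ _ i (s *: delta_mx ord0 i + x) (smooth_cosdot xi th)).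
  have [_ Dc] := is_derive_cosdot xi th (s *: delta_mx ord0 i + x) i.
  have -> : (fun s0 : R => g xi * cosdot (s0 *: delta_mx ord0 i + x) th xi) =
      cst (g xi) * (fun s0 : R => cosdot xi th (s0 *: delta_mx ord0 i + x)).
    by apply/funext => s0; rewrite cosdotC.
  apply: DeriveDef; first exact: (derivableM (derivable_cst _ _ _) du).
  rewrite (deriveM (derivable_cst _ _ _) du) derive_cst scaler0 addr0 Du Dc.
  by rewrite [_ *: _]mulrA (mulrC (g xi)) cosdotC.
- by move=> s xi _; rewrite normrM ler_piMr// cosdot_le1.
- exact: integrable_normr.
Qed.

Lemma smooth_ft th g : rapid g -> smooth (ft th g).
Proof.
move=> rg; pose S h := exists2 k, rapid k & exists t, h = ft t k.
apply: (smooth_coind (S := S)).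
- move=> _ [k rk [t ->]]; split=> [|i x]; first exact: ft_continuous.
  by have [] := is_derive_ft t x i rk.
- move=> _ i [k rk [t ->]]; exists (fun xi => xi ord0 i * k xi); first exact: rapid_coordM.
  by exists (t + pi / 2); apply/funext => x; have [_] := is_derive_ft t x i rk.
- by exists g => //; exists th.
Qed.

Definition monomial (s : seq 'I_d) (xi : V) : R := \prod_(i <- s) xi ord0 i.

Lemma rapid_monomial s g : rapid g -> rapid (fun xi => monomial s xi * g xi).
Proof.
move=> rg; elim: s => [|i s IH].
  rewrite (_ : (fun _ => _) = g) //.
  by apply/funext => xi; rewrite /monomial big_nil mul1r.
rewrite (_ : (fun _ => _) = fun xi => xi ord0 i * (monomial s xi * g xi)).
  exact: rapid_coordM.
by apply/funext => xi; rewrite /monomial big_cons mulrA.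
Qed.

Lemma pderiv_ft s th g : rapid g ->
  pderiv s (ft th g) = ft (th + (pi / 2) *+ size s) (fun xi => monomial s xi * g xi).
Proof.
move=> rg; elim: s => [|i s IH] /=.
  rewrite mulr0n addr0; congr ft.
  by apply/funext => xi; rewrite /monomial big_nil mul1r.
apply/funext => x; rewrite IH.
have [_ ->] := is_derive_ft (th + pi / 2 *+ size s) x i (rapid_monomial s rg).
rewrite (mulrSr (pi / 2) (size s)) addrA; congr ft.
by apply/funext => xi; rewrite /monomial big_cons mulrA.
Qed.

End fourier.

(** * Decay of transforms and inversion at the origin *)

Section fourier_decay.
Context {R : realType} {d : nat}.
Local Notation V := 'rV[R]_d.
Local Notation mu := (lebesgue_rV d).
Implicit Types (g h u : V -> R) (x y xi : V) (th : R) (i : 'I_d).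
Variable chi : V -> R.
Hypothesis chiP : cutoff chi.

Lemma loc_integrable_cst (c : R) : loc_integrable (fun _ : V => c).
Proof.
split; first exact: measurable_cst.
by move=> u bu; apply: integrable_scaler; apply: rapid_integrable; exact: btest_rapid.
Qed.

(** The integral of u does not change when u is translated; this is differentiated in the
    translation, under the integral sign. *)
Lemma Rintegral_partial i u : btest u -> \int[mu]_x partial i u x = 0.
Proof.
move=> bu.
have [_] := is_derive_Rintegral_shift chiP i 0 (loc_integrable_cst 1) bu.
have -> : \int[mu]_x (1 * partial i u ((0 : R) *: delta_mx ord0 i + x)) = \int[mu]_x partial i u x.
  by apply: eq_Rintegral => x _; rewrite scale0r add0r mul1r.
move=> <-.
have -> : (fun s : R => \int[mu]_x (1 * u (s *: delta_mx ord0 i + x))) =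
  cst (\int[mu]_x u x).
  apply/funext => s /=.
  rewrite -[RHS](Rintegral_translate (s *: delta_mx ord0 i)).
    by apply: eq_Rintegral => x _; rewrite mul1r addrC.
  by apply: rapid_integrable; exact: btest_rapid.
by rewrite derive_cst.
Qed.

Lemma ft_partial th g x i : btest g ->
  x ord0 i * ft th g x = ft (th + pi / 2) (partial i g) x.
Proof.
move=> bg; have sg := bg.1.
(* With this phase the partial derivative of c is - x_i times the cosine of phase th, since two
   shifts by pi / 2 change the sign. *)
pose c := cosdot x (th + pi / 2).
have sc : smooth c by exact: smooth_cosdot.
have bgc : btest (fun xi => g xi * c xi) by exact: btestM.
have := Rintegral_partial i bgc; rewrite (partialM i sg sc).
have bi := btest_partial i bg.
have i1 : mu.-integrable setT (EFin \o (fun xi => g xi * cosdot x th xi)).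
  by apply: integrable_cosdot; apply: rapid_integrable; exact: btest_rapid.
have i2 : mu.-integrable setT (EFin \o (fun xi => partial i g xi * c xi)).
  by apply: integrable_cosdot; apply: rapid_integrable; exact: btest_rapid.
have -> : \int[mu]_xi (g xi * partial i c xi + c xi * partial i g xi) =
  \int[mu]_xi (partial i g xi * c xi - x ord0 i * (g xi * cosdot x th xi)).
  apply: eq_Rintegral => xi _; rewrite /partial.
  have [_ ->] := is_derive_cosdot x (th + pi / 2) xi i.
  rewrite -/(partial i g xi) /c /cosdot.
  rewrite (_ : cos (dot x xi + (th + pi / 2 + pi / 2)) = - cos (dot x xi + th)); first by ring.
  by rewrite !addrA !cosDpihalf sinDpihalf.
rewrite RintegralB//; last exact: integrable_scaler.
rewrite RintegralZl// => /eqP; rewrite subr_eq0 => /eqP.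
by rewrite /ft => ->.
Qed.

Lemma ft_partial_iter th g i n : btest g -> exists2 k, btest k &
  exists t, forall x, x ord0 i ^+ n * ft th g x = ft t k x.
Proof.
elim: n th g => [|n IH] th g bg; first by exists g => //; exists th => x; rewrite expr0 mul1r.
have [k bk [t kt]] := IH (th + pi / 2) _ (btest_partial i bg).
by exists k => //; exists t => x; rewrite exprSr -mulrA ft_partial.
Qed.

Lemma btest_integrable g : btest g -> mu.-integrable setT (EFin \o g).
Proof. by move=> bg; apply: rapid_integrable; exact: btest_rapid. Qed.

Lemma ft_rapid th g : btest g -> rapid (ft th g).
Proof.
move=> bg; split.
  by apply: smooth_measurable; apply: smooth_ft; exact: btest_rapid.
move=> n.
have gi := btest_integrable bg.
have /choice[B HB] : forall i, exists B : R, forall x, `|x ord0 i| ^+ n * `|ft th g x| <= B.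
  move=> i; have [k bk [t kt]] := ft_partial_iter th i n bg.
  exists (\int[mu]_xi `|k xi|) => x; rewrite -normrX -normrM kt.
  exact: ft_bound (btest_integrable bk).
pose B0 := \int[mu]_xi `|g xi|.
have B00 : 0 <= B0 by apply: Rintegral_ge0.
pose D := \sum_i `|B i| + B0.
have D0 : 0 <= D by rewrite addr_ge0// sumr_ge0.
have xD x : `|x| ^+ n * `|ft th g x| <= D.
  have [x0|x0] := eqVneq `|x| 0.
    rewrite x0; case: (n) => [|m].
      rewrite expr0 mul1r (le_trans (ft_bound _ _ gi))// -/B0 /D.
      by rewrite lerDr sumr_ge0.
    by rewrite expr0n mul0r.
  (* The max norm is attained at some coordinate i, and [HB] bounds the powers of a single
     coordinate. *)
  have [[j i]] := mx_norm_neq0 x0; rewrite (ord1 j) /= => xi.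
  have {xi} -> : `|x| = `|x ord0 i| by [].
  rewrite (le_trans (HB i x))// (le_trans (ler_norm _))// /D.
  rewrite (bigD1 i)//= -addrA lerDl addr_ge0// sumr_ge0//.
exists (2 ^+ n * (D + B0)) => [|x]; first by rewrite mulr_ge0// addr_ge0.
rewrite /wt ler_pdivlMr ?exprn_gt0 ?ltr_pwDl//.
have : (1 + `|x|) ^+ n <= 2 ^+ n * (1 + `|x| ^+ n).
  have [x1|x1] := leP `|x| 1.
    rewrite (@le_trans _ _ (2 ^+ n))//.
      by rewrite lerXn2r ?nnegrE ?addr_ge0// -[X in _ <= X](@natrD R 1 1) lerD2l.
    by rewrite ler_peMr// ?exprn_ge0// lerDl exprn_ge0.
  rewrite (@le_trans _ _ ((2 * `|x|) ^+ n))//.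
    by rewrite lerXn2r ?nnegrE ?addr_ge0 ?mulr_ge0//; lra.
  by rewrite exprMn ler_wpM2l ?exprn_ge0// lerDr.
move=> /(ler_wpM2l (normr_ge0 (ft th g x))) /le_trans; apply.
rewrite mulrCA ler_wpM2l ?exprn_ge0// mulrDr mulr1 addrC lerD//.
  by rewrite mulrC.
exact: ft_bound.
Qed.

Lemma ftZ th (a : R) g x : a != 0 -> mu.-integrable setT (EFin \o g) ->
  ft th (fun xi => g (a *: xi)) x = `|a|^-1 ^+ d * ft th g (a^-1 *: x).
Proof.
move=> a0 gi; rewrite /ft.
rewrite -(Rintegral_affine 0 a0 (integrable_cosdot _ _ gi)).
apply: eq_Rintegral => xi _; rewrite addr0; congr (_ * _).
by rewrite /cosdot dotZr dotZl mulrA divff// mul1r.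
Qed.

(** By inversion this is a multiple of g 0. Which multiple is left open; for phase 0 it will be
    enough that it is not zero. *)
Definition ft_mass th g : R := \int[mu]_x ft th g x.

Lemma inv_nat_cvg0 : (n.+1%:R^-1 : R) @[n --> \oo] --> (0 : R).
Proof. exact: cvg_harmonic. Qed.

Lemma scale_cvg (u : V -> R) (x : V) : continuous u ->
  u ((n.+1%:R^-1 : R) *: x) @[n --> \oo] --> u 0.
Proof.
move=> cu; apply: (@cvg_comp _ _ _ (fun n : nat => (n.+1%:R^-1 : R) *: x) u); last exact: cu.
have : (n.+1%:R^-1 : R) *: x @[n --> \oo] --> (0 : R) *: x.
  by apply: cvgZ; [exact: inv_nat_cvg0|exact: cvg_cst].
by rewrite scale0r.
Qed.

Lemma cutoff0 : chi 0 = 1.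
Proof. by have [_ [r r0]] := chiP; apply; rewrite normr0 ltW. Qed.

(* Fourier inversion at the origin, up to the value of the constant. *)
Lemma ft_massE th g : btest g -> ft_mass th g = g 0 * ft_mass th chi.
Proof.
move=> bg; have bchi : btest chi by case: chiP.
have rg := btest_rapid bg; have gi := btest_integrable bg.
have rchi := btest_rapid bchi; have chii := btest_integrable bchi.
have [Cg Cg0 gC] := btest_bounded bg.
have [Cc Cc0 chiC] := btest_bounded bchi.
have fgi := rapid_integrable (ft_rapid th bg).
have fci := rapid_integrable (ft_rapid th bchi).
have e0 n : (n.+1%:R^-1 : R) != 0 by rewrite invr_eq0 pnatr_eq0.
(* A integrates the transform of g against a widening cutoff. Fubini and a rescaling move the
   transform to chi and the widening to g, which gives B; both sequences converge by domination. *)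
pose A n := \int[mu]_x (ft th g x * chi ((n.+1%:R^-1 : R) *: x)).
pose B n := \int[mu]_xi (g ((n.+1%:R^-1 : R) *: xi) * ft th chi xi).
have mchi n : measurable_fun setT (fun x => chi ((n.+1%:R^-1 : R) *: x)).
  have := measurableT_comp (smooth_measurable bchi.1) (measurable_affine (n.+1%:R^-1 : R) 0).
  by under eq_fun do rewrite addr0.
have mgn n : measurable_fun setT (fun x => g ((n.+1%:R^-1 : R) *: x)).
  have := measurableT_comp (smooth_measurable bg.1) (measurable_affine (n.+1%:R^-1 : R) 0).
  by under eq_fun do rewrite addr0.
have AB n : A n = B n.
  pose F x xi := g xi * cosdot x th xi * chi ((n.+1%:R^-1 : R) *: x).
  have ichi : mu.-integrable setT (EFin \o (fun x => `|chi ((n.+1%:R^-1 : R) *: x)|)).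
    apply: integrable_normr; have := integrable_affine 0 (e0 n) chii.
    by apply: eq_integrable => // x _ /=; rewrite addr0.
  transitivity (\int[mu]_x \int[mu]_xi F x xi).
    apply: eq_Rintegral => x _; rewrite /F /ft mulrC -RintegralZl//; last exact: integrable_cosdot.
    by apply: eq_Rintegral => xi _; rewrite mulrC.
  rewrite (@Rintegral_Fubini _ _ F (fun x => `|chi ((n.+1%:R^-1 : R) *: x)|) (fun xi => `|g xi|))//; last 3 first.
  - rewrite /F; apply: measurable_funM; last exact: measurableT_comp (mchi n) measurable_fst.
    apply: measurable_funM; first exact: measurableT_comp (smooth_measurable bg.1) measurable_snd.
    exact: measurable_cosdot2.
  - by move=> x xi; rewrite /F mulrC normrM ler_wpM2l// normrM ler_piMr// cosdot_le1.
  - exact: integrable_normr.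
  pose G xi := g ((n.+1%:R^-1 : R) *: xi) * ft th chi xi.
  have Gi : mu.-integrable setT (EFin \o G).
    apply: (integrable_le (g := fun xi => Cg * `|ft th chi xi|)).
    - apply: measurable_funM; first exact: mgn.
      by have [] := ft_rapid th bchi.
    - by move=> xi; rewrite /G normrM ler_wpM2r.
    - by apply: integrable_scaler; exact: integrable_normr.
  have en0 : n.+1%:R != 0 :> R by rewrite pnatr_eq0.
  have n1 : n.+1%:R ^+ d != 0 :> R by rewrite expf_neq0.
  transitivity (\int[mu]_xi (n.+1%:R ^+ d * G ((n.+1%:R : R) *: xi + 0))).
    apply: eq_Rintegral => xi _; rewrite /G addr0 scalerA mulVf// scale1r /F.
    transitivity (g xi * \int[mu]_x (chi ((n.+1%:R^-1 : R) *: x) * cosdot xi th x)).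
      rewrite -RintegralZl//.
        by apply: eq_Rintegral => x _; rewrite cosdotC; ring.
      apply: integrable_cosdot; have := integrable_affine 0 (e0 n) chii.
      by apply: eq_integrable => // x _ /=; rewrite addr0.
    rewrite -/(ft th (fun x => chi ((n.+1%:R^-1 : R) *: x)) xi) ftZ//.
    by rewrite normrV ?unitfE// !invrK normr_nat mulrCA.
  rewrite RintegralZl//; last exact: integrable_affine.
  by rewrite Rintegral_affine// normr_nat exprVn mulrA divff// mul1r.
have A_cvg : A n @[n --> \oo] --> ft_mass th g.
  apply: (dominated_Rintegral (g := fun x => Cc * `|ft th g x|)).
  - by move=> n; apply: measurable_funM => //; case: (ft_rapid th bg).
  - move=> x; rewrite [X in _ --> X](_ : _ = ft th g x * chi 0); last by rewrite cutoff0 mulr1.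
    apply: cvgM; first exact: cvg_cst.
    by apply: scale_cvg; exact: smooth_continuous bchi.1.
  - by move=> n x; rewrite normrM mulrC ler_wpM2r.
  - by apply: integrable_scaler; exact: integrable_normr.
have B_cvg : B n @[n --> \oo] --> g 0 * ft_mass th chi.
  rewrite -RintegralZl//.
  apply: (dominated_Rintegral (g := fun x => Cg * `|ft th chi x|)).
  - by move=> n; apply: measurable_funM => //; case: (ft_rapid th bchi).
  - move=> x; apply: cvgM; last exact: cvg_cst.
    by apply: scale_cvg; exact: smooth_continuous bg.1.
  - by move=> n x; rewrite normrM ler_wpM2r.
  - by apply: integrable_scaler; exact: integrable_normr.
rewrite -(cvg_lim _ A_cvg)// -(cvg_lim _ B_cvg)//.
by congr (lim (_ @ \oo)); apply/funext.
Qed.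

End fourier_decay.

(** * Comparison of the Euclidean norm with the max norm *)

Section euclidean_norm.
Context {R : realType} {d : nat}.
Local Notation V := 'rV[R]_d.
Implicit Types x : V.

Lemma dot_ge0 x : 0 <= dot x x.
Proof. by apply: sumr_ge0 => i _; rewrite -expr2 sqr_ge0. Qed.

Lemma enorm_ge0 x : 0 <= enorm x. Proof. exact: sqrtr_ge0. Qed.

Lemma norm_le_enorm x : `|x| <= enorm x.
Proof.
apply: norm_le_coord => [|i]; first exact: enorm_ge0.
rewrite -sqrtr_sqr /enorm ler_wsqrtr// expr2 /dot (bigD1 i)//= lerDl.
by apply: sumr_ge0 => j _; rewrite -expr2 sqr_ge0.
Qed.

Lemma enorm_le_norm x : enorm x <= (1 + d%:R) * `|x|.
Proof.
have x0 : 0 <= (1 + d%:R) * `|x| by rewrite mulr_ge0// addr_ge0.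
rewrite -[leRHS]ger0_norm// -sqrtr_sqr ler_wsqrtr//.
have := dot_norm x x; rewrite (ger0_norm (dot_ge0 x)) => /le_trans; apply.
rewrite exprMn -mulrA ler_wpM2r// ?mulr_ge0//.
have d0 : 0 <= d%:R :> R by [].
by rewrite sqrrD expr1n mul1r -addrA (_ : _ *+ 2 = d%:R + d%:R) ?mulr2n// addrCA -addrA lerDl; nra.
Qed.

End euclidean_norm.

(** * Transforms of test functions that vanish near the origin *)

Section fourier_schwartz.
Context {R : realType} {d : nat}.
Local Notation V := 'rV[R]_d.
Local Notation mu := (lebesgue_rV d).
Implicit Types (g h u : V -> R) (x y xi : V) (th : R) (i : 'I_d).
Variable chi : V -> R.
Hypothesis chiP : cutoff chi.

Lemma btest_shift g (b : V) : btest g -> btest (fun xi => g (xi + b)).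
Proof.
move=> bg; rewrite (_ : (fun _ => _) = fun xi => g (1 *: xi + b)); first exact: btest_affine.
by apply/funext => x; rewrite scale1r.
Qed.

Lemma ft_shift th g b x : btest g ->
  ft th (fun xi => g (xi - b)) x = \int[mu]_xi (g xi * cosdot x th (xi + b)).
Proof.
move=> bg; rewrite /ft.
have bi : mu.-integrable setT (EFin \o (fun xi => g (xi - b) * cosdot x th xi)).
  by apply: integrable_cosdot; apply: (btest_integrable); exact: btest_shift.
rewrite -(Rintegral_translate b bi).
by apply: eq_Rintegral => xi _; rewrite addrK.
Qed.

Lemma integrable_cosdot_shift th g b x : btest g ->
  mu.-integrable setT (EFin \o (fun xi => g xi * cosdot x th (xi + b))).
Proof.
move=> bg; apply: (integrable_le (g := fun xi => `|g xi|)).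
- apply: measurable_funM; first exact: smooth_measurable bg.1.
  apply: smooth_measurable.
  rewrite (_ : (fun _ => _) = fun xi => cosdot x th (1 *: xi + b)).
    exact: smooth_affine (smooth_cosdot _ _).
  by apply/funext => xi; rewrite scale1r.
- by move=> xi; rewrite normrM ler_piMr// cosdot_le1.
- by apply: integrable_normr; exact: btest_integrable.
Qed.

(** The product formula for cosines: multiplying a transform by a cosine amounts to averaging the
    translates of g by xi and - xi. *)
Lemma ft_modulate g x xi : btest g -> ft 0 g x * cosdot x 0 xi =
  2^-1 * (ft 0 (fun eta => g (eta - xi)) x + ft 0 (fun eta => g (eta - (- xi))) x).
Proof.
move=> bg; rewrite !ft_shift// -RintegralD//; [|exact: integrable_cosdot_shift..].
rewrite -RintegralZl//; last by apply: integrable_addr; exact: integrable_cosdot_shift.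
rewrite mulrC -RintegralZl//; last by apply: integrable_cosdot; exact: btest_integrable.
apply: eq_Rintegral => eta _; rewrite /cosdot !addr0 !dotDr dotNr cosB cosD.
by field.
Qed.

(** If it vanished, [ft_massE] would give mass 0 to every test function. For g = chi^2 and f =
    [ft 0 g], Fubini and [ft_modulate] write the integral of f^2 through masses of translates of g,
    so it would be 0. But f is continuous, and f 0 is the integral of g, which is positive. *)
Lemma ft_mass_neq0 : ft_mass 0 chi != 0.
Proof.
apply/negP => /eqP c0.
have bchi : btest chi by case: chiP.
pose g : V -> R := fun x => chi x * chi x.
have bg : btest g by apply: btestM => //; case: bchi.
have gi := btest_integrable bg.
have rg := btest_rapid bg.
have T0 (k : V -> R) : btest k -> ft_mass 0 k = 0 by move=> bk; rewrite (ft_massE chiP)// c0 mulr0.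
pose f := ft 0 g.
have rf : rapid f by exact: (ft_rapid chiP).
have fi := rapid_integrable rf.
have ff0 : \int[mu]_x (f x * f x) = 0.
  pose F x xi := f x * (g xi * cosdot x 0 xi).
  have mF : measurable_fun setT (fun z : V * V => F z.1 z.2).
    apply: measurable_funM; first exact: measurableT_comp rf.1 measurable_fst.
    apply: measurable_funM; first exact: measurableT_comp rg.1 measurable_snd.
    exact: measurable_cosdot2.
  have bF x xi : `|F x xi| <= `|f x| * `|g xi|.
    by rewrite /F normrM ler_wpM2l// normrM ler_piMr// cosdot_le1.
  transitivity (\int[mu]_x \int[mu]_xi F x xi).
    apply: eq_Rintegral => x _; rewrite /F RintegralZl//.
    exact: integrable_cosdot.
  rewrite (Rintegral_Fubini mF bF (integrable_normr fi) (integrable_normr gi)).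
  rewrite (_ : Rintegral _ _ _ = \int[mu]_xi (cst 0 : V -> R) xi); last first.
    apply: eq_Rintegral => xi _.
    transitivity (\int[mu]_x (g xi * (2^-1 * (ft 0 (fun eta => g (eta - xi)) x +
       ft 0 (fun eta => g (eta - (- xi))) x)))).
      by apply: eq_Rintegral => x _; rewrite /F -ft_modulate// /f; ring.
    have i1 (b : V) : mu.-integrable setT (EFin \o ft 0 (fun eta => g (eta + b))).
      by apply: rapid_integrable; apply: (ft_rapid chiP); exact: btest_shift.
    rewrite RintegralZl//; last by apply: integrable_scaler; exact: integrable_addr.
    rewrite RintegralZl//; last exact: integrable_addr.
    rewrite RintegralD// -!/(ft_mass 0 _) !T0 ?addr0 ?mulr0//; exact: btest_shift.
  by rewrite /Rintegral integral0_eq.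
have I0 : (0 < \int[mu]_x (g x)%:E)%E.
  have [_ [r r0 chi1]] := chiP.
  apply: (ge0_integral_gt0 rg.1 _ r0 ltr01) => x; first by rewrite /g -expr2 sqr_ge0.
  by move=> xr; rewrite /g chi1// mulr1.
have f0 : 0 < f 0.
  have -> : f 0 = \int[mu]_x g x.
    by apply: eq_Rintegral => xi _; rewrite /cosdot dot0l addr0 cos0 mulr1.
  by rewrite -lte_fin /Rintegral fineK//; exact: integrable_fin_num.
have cf : {for (0 : V), continuous f} by apply: ft_continuous.
have [r r0 fr] : exists2 r, 0 < r & forall x, `|x| <= r -> f 0 / 2 <= f x.
  have f02 : 0 < f 0 / 2 by rewrite divr_gt0.
  have := (@cvgrPdist_lt _ _ V (nbhs (0 : V)) (nbhs_filter (0 : V)) f (f 0)).1 cf _ f02.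
  move=> /nbhs_ballP[e /= e0 He]; exists (e / 2); first by rewrite divr_gt0.
  move=> x xe; have /He /= : ball (0 : V) e x.
    by rewrite -ball_normE /ball_/= sub0r normrN (le_lt_trans xe)// ltr_pdivrMr// ltr_pMr// ltr1n.
  by rewrite ltr_distl => /andP[? ?]; lra.
have : (0 < \int[mu]_x (f x * f x)%:E)%E.
  apply: (ge0_integral_gt0 (r := r) (e := (f 0 / 2) ^+ 2)) => //.
  - by apply: measurable_funM; exact: rf.1.
  - by move=> x; rewrite -expr2 sqr_ge0.
  - by rewrite exprn_gt0// divr_gt0.
  - move=> x xr; rewrite expr2; have := fr x xr; have := f0; nra.
have ffi : mu.-integrable setT (EFin \o (fun x => f x * f x)).
  have [C C0 fC] := rf.2 0.
  apply: (integrable_le (g := fun x => C * `|f x|)).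
  - by apply: measurable_funM; exact: rf.1.
  - by move=> x; rewrite normrM ler_wpM2r// (le_trans (fC x))// ler_piMr// wt_le1.
  - by apply: integrable_scaler; exact: integrable_normr.
by rewrite -(fineK (integrable_fin_num measurableT ffi)) -/(Rintegral _ _ _) ff0 ltxx.
Qed.

Lemma btest_coordM g i : btest g -> btest (fun xi => xi ord0 i * g xi).
Proof. by move=> bg; apply: btestMl => //; exact: smooth_coord. Qed.

(** Each factor x_i turns into a derivative of g, and g vanishes near 0 together with its
    derivatives. *)
Lemma monomial_ft s th g : btest g -> (\forall xi \near (0 : V), g xi = 0) ->
  exists2 k, btest k /\ k 0 = 0 & exists t, forall x, monomial s x * ft th g x = ft t k x.
Proof.
elim: s th g => [|i s IH] th g bg g0.
  exists g; first by split=> //; exact: nbhs_singleton g0.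
  by exists th => x; rewrite /monomial big_nil mul1r.
have [|k bk [t kt]] := IH (th + pi / 2) _ (btest_partial i bg).
  apply: filterS (near_join g0) => xi hxi.
  by rewrite /partial (near_eq_derive (g := cst 0) _ hxi) derive_cst.
exists k => //; exists t => x.
by rewrite /monomial big_cons mulrAC mulrC -/(monomial s x) (ft_partial chiP)// kt.
Qed.

(** Up to a constant, the derivative at 0 is the integral of a monomial times [ft th g]. This is the
    mass of a test function vanishing at 0, hence 0 by [ft_massE]. *)
Lemma ft_ft_flat s th th' g : btest g -> (\forall xi \near (0 : V), g xi = 0) ->
  pderiv s (ft th' (ft th g)) 0 = 0.
Proof.
move=> bg g0; rewrite pderiv_ft; last exact: (ft_rapid chiP).
have [k [bk k0] [t kt]] := monomial_ft s th bg g0.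
transitivity (\int[mu]_x (cos (th' + pi / 2 *+ size s) * ft t k x)).
  by apply: eq_Rintegral => x _; rewrite kt /cosdot dot0l add0r mulrC.
rewrite RintegralZl//; last by apply: rapid_integrable; exact: (ft_rapid chiP).
by rewrite -/(ft_mass t k) (ft_massE chiP)// k0 mul0r mulr0.
Qed.

(** A partial derivative of a transform is the transform of another test function; the induction
    therefore peels off the innermost derivative, the last entry of s. *)
Lemma pderiv_ft_bound (n N : nat) th g : btest g -> exists2 B : R, 0 <= B &
  forall s, (size s <= N)%N -> forall x, `|pderiv s (ft th g) x| <= B * wt n x.
Proof.
elim: N th g => [|N IH] th g bg; have [_ /(_ n)[B0 B00 HB0]] := ft_rapid chiP th bg.
  by exists B0 => // s; rewrite leqn0 => /nilP ->.
have /choice[B HB] : forall i, exists B : R, 0 <= B /\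
    forall s, (size s <= N)%N -> forall x, `|pderiv s (partial i (ft th g)) x| <= B * wt n x.
  move=> i; have [B B1 HB] := IH (th + pi / 2) _ (btest_coordM i bg).
  exists B; split => // s sN x.
  have -> : partial i (ft th g) = ft (th + pi / 2) (fun xi => xi ord0 i * g xi).
    by apply/funext => y; have [_] := is_derive_ft th y i (btest_rapid bg).
  exact: HB.
have sB0 : 0 <= \sum_i B i by apply: sumr_ge0 => i _; case: (HB i).
exists (B0 + \sum_i B i) => [|s]; first exact: addr_ge0.
case/lastP: s => [_ x|s i].
  by rewrite (le_trans (HB0 x))// ler_wpM2r ?wt_ge0// lerDl.
rewrite size_rcons ltnS -pderiv_partial => sN x.
rewrite (le_trans ((HB i).2 s sN x))// ler_wpM2r ?wt_ge0//.
rewrite (bigD1 i)//= addrCA lerDl addr_ge0// sumr_ge0// => j _; by case: (HB j).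
Qed.

Lemma pderiv_cst0 s : pderiv s (fun _ : V => 0 : R) = fun=> 0.
Proof. by elim: s => //= i s ->; apply/funext => x; rewrite derive_cst. Qed.

Lemma normc_real (a : R) : Normc.normc (a +i* 0) = `|a|.
Proof. by rewrite /Normc.normc expr0n addr0 sqrtr_sqr. Qed.

Lemma schwartz_infty_ft th g : btest g -> (\forall xi \near (0 : V), g xi = 0) ->
  schwartz_infty (fun x => (ft th g x)%:C).
Proof.
move=> bg g0; split; first split.
- by split; [apply: smooth_ft; exact: btest_rapid|exact: smooth_cst].
- move=> N; have [B B0 HB] := pderiv_ft_bound N N th bg.
  (* The factor 2 + d compares 1 + [enorm x] with 1 + |x|. *)
  apply: (@le_lt_trans _ _ ((1 + (1 + d%:R)) ^+ N * B)%:E); last exact: ltry.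
  apply: ge_ereal_sup => _ [s [x [sN ->]]]; rewrite lee_fin.
  have -> : cpderiv s (fun x0 => (ft th g x0)%:C) x = pderiv s (ft th g) x +i* 0.
    by rewrite /cpderiv /= pderiv_cst0.
  rewrite normc_real.
  rewrite (le_trans (ler_wpM2l _ (HB s sN x))) ?exprn_ge0 ?addr_ge0 ?enorm_ge0//.
  rewrite mulrCA [leRHS]mulrC ler_wpM2l// /wt ler_pdivrMr ?exprn_gt0 ?ltr_pwDl//.
  rewrite -exprMn lerXn2r ?nnegrE ?mulr_ge0 ?addr_ge0 ?enorm_ge0//.
  have := enorm_le_norm x; have := normr_ge0 x; have : 0 <= d%:R :> R by [].
  nra.
- move=> s; rewrite /cpderiv.
  have -> : (fun y => complex.Re (fourier (fun x => (ft th g x)%:C) y)) = ft 0 (ft th g).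
    apply/funext => xi; apply: eq_Rintegral => x _ /=.
    by rewrite mul0r subr0 /cosdot dotC addr0 cosN.
  have -> : (fun y => complex.Im (fourier (fun x => (ft th g x)%:C) y)) = ft (pi / 2) (ft th g).
    apply/funext => xi; apply: eq_Rintegral => x _ /=.
    by rewrite mul0r addr0 /cosdot dotC cosDpihalf sinN.
  by rewrite !ft_ft_flat.
Qed.

End fourier_schwartz.

(** * Functions integrable against a weight *)

Section weighted.
Context {R : realType} {d : nat}.
Local Notation V := 'rV[R]_d.
Local Notation mu := (lebesgue_rV d).
Implicit Types (h k u a : V -> R) (x y z : V).

(** The class to which f belongs: it contains the bounded measurable functions and those with a
    bound on translates, and its members can be paired with every rapidly decreasing function. *)
Definition wt_integrable h := measurable_fun setT h /\
  mu.-integrable setT (EFin \o (fun x => h x * wt d.*2.+1 x)).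

Lemma wt_integrable_rapid h k : wt_integrable h -> rapid k ->
  mu.-integrable setT (EFin \o (fun x => h x * k x)).
Proof.
move=> [mh hi] [mk /(_ d.*2.+1)[C C0 kC]].
apply: (integrable_le (g := fun x => C * `|h x * wt d.*2.+1 x|)).
- exact: measurable_funM.
- move=> x; rewrite !normrM (ger0_norm (wt_ge0 _ _)) mulrCA ler_wpM2l//.
- by apply: integrable_scaler; exact: integrable_normr.
Qed.

Lemma wt_integrable_loc h : wt_integrable h -> loc_integrable h.
Proof.
move=> hw; split; first by case: hw.
by move=> u bu; apply: wt_integrable_rapid => //; exact: btest_rapid.
Qed.

Lemma rapid_polyM n u : rapid u -> rapid (fun x => (1 + `|x|) ^+ n * u x).
Proof.
move=> [mu' ur]; split.
  apply: measurable_funM => //; apply: measurable_funX; apply: measurable_funD => //.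
  by apply: continuous_measurable_rV; exact: norm_continuous.
move=> m; have [C C0 uC] := ur (m + n)%N; exists C => // x.
have p0 : 0 < (1 + `|x|) ^+ n by rewrite exprn_gt0// ltr_pwDl.
rewrite normrM gtr0_norm// mulrC -ler_pdivlMr// (le_trans (uC x))//.
by rewrite /wt exprD invfM mulrA.
Qed.

Lemma rapid_affine (a : R) (b : V) u : a != 0 -> rapid u -> rapid (fun x => u (a *: x + b)).
Proof.
move=> a0 [mu' ur]; split; first by apply: (measurableT_comp mu'); exact: measurable_affine.
move=> n; have [C C0 uC] := ur n.
exists (C * ((1 + `|a|^-1) ^+ n * (1 + `|b|) ^+ n)).
  by rewrite mulr_ge0// mulr_ge0// exprn_ge0// addr_ge0// invr_ge0.
move=> x; rewrite (le_trans (uC _))// -mulrA ler_wpM2l//.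
rewrite /wt -exprMn ler_pdivlMr ?exprn_gt0 ?ltr_pwDl// mulrC ler_pdivrMr ?exprn_gt0 ?ltr_pwDl//.
rewrite -exprMn lerXn2r ?nnegrE ?mulr_ge0 ?addr_ge0 ?invr_ge0//.
have na : 0 < `|a| by rewrite normr_gt0.
have : `|x| <= `|a|^-1 * (`|a *: x + b| + `|b|).
  rewrite ler_pdivlMl// -normrZ -{1}(addrK b (a *: x)); exact: ler_normB.
set t := `|a|^-1; have t0 : 0 <= t by rewrite invr_ge0.
have := normr_ge0 (a *: x + b); have := normr_ge0 b.
set p := `|b|; set q := `|a *: x + b| => p0 q0 xt.
have pq : 0 <= p * q by rewrite mulr_ge0.
have tpq : 0 <= t * (p * q) by rewrite mulr_ge0.
have : (1 + t) * (1 + p) * (1 + q) = 1 + t * (q + p) + p + q + p * q + t + t * (p * q) by ring.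
lra.
Qed.

Lemma wt_integrable_decomposition h a (A M : R) (chi : V -> R) : cutoff chi -> measurable_fun setT h ->
  translation_bound a M -> {ae mu, forall x, `|h x - a x| <= A} -> wt_integrable h.
Proof.
move=> cc mh aM hA; split => //.
have ai := integrable_translation_bound cc aM.
have ma : measurable_fun setT a by case: aM => -[].
have mw : measurable_fun setT (@wt R d d.*2.+1) by exact: measurable_wt.
have bi : mu.-integrable setT (EFin \o (fun x => A * wt d.*2.+1 x)).
  by apply: integrable_scaler; apply: integrable_wt; rewrite leqW.
have mb : measurable_fun setT (fun x => (h x - a x) * wt d.*2.+1 x).
  by apply: measurable_funM => //; exact: measurable_funB.
have : mu.-integrable setT (EFin \o (fun x => (h x - a x) * wt d.*2.+1 x)).
  have [_ boo] := integrableP _ _ _ bi.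
  apply/integrableP; split; first exact/measurable_EFinP.
  apply: le_lt_trans boo; apply: ae_ge0_le_integral => //.
  - by apply: measurableT_comp => //; exact/measurable_EFinP.
  - apply: measurableT_comp => //; apply/measurable_EFinP.
    exact: measurable_funM.
  - apply: filterS hA => x hx _ /=.
    by rewrite lee_fin !normrM ler_wpM2r// (le_trans hx)// ler_norm.
move=> /(integrable_addr ai); apply: eq_integrable => // x _ /=.
by rewrite -mulrDl addrC subrK.
Qed.

Lemma ae_Rintegral_le (u v : V -> R) (A : R) : 0 <= A ->
  mu.-integrable setT (EFin \o (fun x => u x * v x)) ->
  mu.-integrable setT (EFin \o v) ->
  {ae mu, forall x, `|u x| <= A} ->
  `|\int[mu]_x (u x * v x)| <= A * \int[mu]_x `|v x|.
Proof.
move=> A0 uvi vi uA; rewrite (le_trans (le_normr_Rintegral _ _))//.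
have nvi := integrable_normr vi.
rewrite -RintegralZl// /Rintegral.
have nuvi := integrable_normr uvi.
have Avi := integrable_scaler A nvi.
apply: fine_le; [exact: integrable_fin_num|exact: integrable_fin_num|].
apply: ae_ge0_le_integral => //.
- by have [] := integrableP _ _ _ nuvi.
- by move=> x _; rewrite lee_fin mulr_ge0.
- by have [] := integrableP _ _ _ Avi.
- apply: filterS uA => x ux _ /=.
  by rewrite lee_fin normrM ler_wpM2r.
Qed.

Lemma rapid_sub u x : rapid u -> rapid (fun y => u (x - y)).
Proof.
move=> ru; rewrite (_ : (fun _ => _) = fun y => u ((- 1) *: y + x)).
  by apply: rapid_affine => //; rewrite oppr_eq0 oner_neq0.
by apply/funext => y; rewrite scaleN1r addrC.
Qed.

Lemma rapid_scale u (r : R) : r != 0 -> rapid u -> rapid (fun y => u (r *: y)).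
Proof.
move=> r0 ru; rewrite (_ : (fun _ => _) = fun y => u (r *: y + 0)).
  exact: rapid_affine.
by apply/funext => y; rewrite addr0.
Qed.

(** The subtraction formula for the cosine. As a function of y, the transform at x - y is a sum of
    transforms of modulations of g, so a convolution with it reduces to pairings with transforms of
    test functions. *)
Lemma ft_sub th (g : V -> R) x y : btest g -> ft th g (x - y) =
  ft 0 (fun xi => g xi * cosdot x th xi) y +
  ft (- (pi / 2)) (fun xi => g xi * cosdot x (th - pi / 2) xi) y.
Proof.
move=> bg; rewrite /ft.
have b1 t : btest (fun xi => g xi * cosdot x t xi).
  by apply: btestM => //; exact: smooth_cosdot.
rewrite -RintegralD//.
- apply: eq_Rintegral => xi _; rewrite -!mulrA -mulrDr; congr (_ * _).
  rewrite /cosdot dotDl (_ : dot (- y) xi = - dot y xi); last by rewrite dotC dotNr dotC.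
  rewrite !addrA !cosBpihalf addr0.
  by rewrite (_ : _ + th = (dot x xi + th) - dot y xi) ?cosB//; ring.
- by apply: integrable_cosdot; exact: btest_integrable.
- by apply: integrable_cosdot; exact: btest_integrable.
Qed.

End weighted.

Section measurable_parameter.
Context {R : realType} {d : nat}.
Local Notation V := 'rV[R]_d.
Local Notation mu := (lebesgue_rV d).

(** Tonelli yields measurability for nonnegative integrands, so F is written as (|F| + F) - |F|. *)
Lemma measurable_Rintegral_snd (F : V -> V -> R) :
  measurable_fun setT (fun z : V * V => F z.1 z.2) ->
  (forall x, mu.-integrable setT (EFin \o F x)) ->
  measurable_fun setT (fun x => \int[mu]_y F x y).
Proof.
move=> mF iF.
rewrite (_ : (fun _ => _) = fun x => fine (\int[mu]_y (`|F x y| + F x y)%:E)%E -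
  fine (\int[mu]_y (`|F x y|)%:E)%E); last first.
  apply/funext => x; have ni := integrable_normr (iF x).
  rewrite -/(Rintegral mu setT (fun y => `|F x y| + F x y)).
  rewrite -/(Rintegral mu setT (fun y => `|F x y|)).
  by rewrite RintegralD// addrAC subrr add0r.
have mN : measurable_fun setT (fun z : V * V => `|F z.1 z.2|) by exact: measurableT_comp.
apply: measurable_funB; apply: measurableT_comp => //.
  apply: (measurable_fun_integral_snd (F := fun x y => `|F x y| + F x y)).
    by apply/measurable_EFinP; exact: measurable_funD.
  by move=> x y; rewrite -lerBlDr sub0r -normrN ler_norm.
apply: (measurable_fun_integral_snd (F := fun x y => `|F x y|)) => //.
exact/measurable_EFinP.
Qed.

End measurable_parameter.

(** * Convolution with a rescaled kernel, for small and for large scales *)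

Section scaled_convolution.
Context {R : realType} {d : nat}.
Local Notation V := 'rV[R]_d.
Local Notation mu := (lebesgue_rV d).
Variables (Phi h : V -> R).
Hypotheses (rPhi : rapid Phi) (hw : wt_integrable h).

Definition scaled_conv (r : R) x : R := r ^+ d * \int[mu]_y (h y * Phi (r *: (x - y))).

Lemma rapid_Phi_scale (r : R) x : r != 0 -> rapid (fun y => Phi (r *: (x - y))).
Proof. by move=> r0; apply: (rapid_sub (u := fun z => Phi (r *: z))); exact: rapid_scale. Qed.

(** Split h into a and h - a. For a, a change of variables moves the difference from the kernel to
    a, where [translation_bound] applies, the kernel being at most r^d C. For h - a, the L1 distance
    between the two kernels is, after rescaling, the L1 modulus of continuity of Phi at r x. For d >
    0 both terms tend to 0 with r. *)
Lemma scaled_conv_diff (a : V -> R) (A M : R) : 0 <= A -> wt_integrable a ->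
  translation_bound a M ->
  {ae mu, forall x, `|h x - a x| <= A} ->
  exists2 C : R, 0 <= C & forall (r : R) x, 0 < r ->
  `|scaled_conv r x - scaled_conv r 0| <=
    r ^+ d * (C * (M * \sum_i `|x ord0 i|)) +
    A * \int[mu]_z `|Phi (r *: x + z) - Phi z|.
Proof.
move=> A0 aw aM hA.
have [C C0 PhiC] : exists2 C : R, 0 <= C & forall x, `|Phi x| <= C.
  have [_ /(_ 0)[C C0 H]] := rPhi; exists C => // x.
  by rewrite (le_trans (H x))// /wt expr0 invr1 mulr1.
exists C => // r x r0.
have r0' : r != 0 by rewrite gt_eqF.
have [ma ai] := aM.1.
pose D y := Phi (r *: (x - y)) - Phi (r *: (0 - y)).
have rD : rapid D.
  rewrite (_ : D = fun y => Phi (r *: (x - y)) + (- 1) * Phi (r *: (0 - y))).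
    by apply: rapidD; [|apply: rapidZ]; exact: rapid_Phi_scale.
  by apply/funext => y; rewrite mulN1r.
have hD := wt_integrable_rapid hw rD.
have aD := wt_integrable_rapid aw rD.
rewrite /scaled_conv -mulrBr -RintegralB//; last 2 first.
- by apply: wt_integrable_rapid => //; exact: rapid_Phi_scale.
- by apply: wt_integrable_rapid => //; exact: rapid_Phi_scale.
have -> : \int[mu]_y (h y * Phi (r *: (x - y)) - h y * Phi (r *: (0 - y))) =
    \int[mu]_y (a y * D y + (h y - a y) * D y).
  by apply: eq_Rintegral => y _; rewrite /D; ring.
have haD : mu.-integrable setT (EFin \o (fun y => (h y - a y) * D y)).
  have := integrable_subr hD aD; apply: eq_integrable => // y _ /=.
  by rewrite mulrBl.
rewrite RintegralD// mulrDr (le_trans (ler_normD _ _))//; apply: lerD.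
- rewrite normrM ger0_norm ?exprn_ge0 ?(ltW r0)//; apply: ler_wpM2l.
    by rewrite exprn_ge0// ltW.
  have a1 := wt_integrable_rapid aw (rapid_Phi_scale x r0').
  have a2 := wt_integrable_rapid aw (rapid_Phi_scale 0 r0').
  have a1' : mu.-integrable setT (EFin \o (fun y => a (y + x) * Phi (r *: (0 - y)))).
    have := integrable_translate x a1; apply: eq_integrable; [exact: measurableT|move=> y _ /=].
    by rewrite opprD addrCA subrr addr0 sub0r.
  have -> : \int[mu]_y (a y * D y) = \int[mu]_y ((a (y + x) - a y) * Phi (r *: (0 - y))).
    transitivity (\int[mu]_y (a y * Phi (r *: (x - y)) - a y * Phi (r *: (0 - y)))).
      by apply: eq_Rintegral => y _; rewrite mulrBr.
    rewrite (RintegralB _ a1 a2)//.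
    have -> : \int[mu]_y (a y * Phi (r *: (x - y))) =
        \int[mu]_y (a (y + x) * Phi (r *: (0 - y))).
      transitivity (\int[mu]_y (a (y + x) * Phi (r *: (x - (y + x))))).
        by symmetry; exact: (Rintegral_translate x a1).
      by apply: eq_Rintegral => y _; rewrite opprD addrCA subrr addr0 sub0r.
    rewrite -(RintegralB _ a1' a2)//.
    by apply: eq_Rintegral => y _; rewrite mulrBl.
  have a3 := integrable_subr a1' a2.
  have a3' : mu.-integrable setT (EFin \o (fun y => (a (y + x) - a y) * Phi (r *: (0 - y)))).
    by move: a3; apply: eq_integrable => // y _ /=; rewrite mulrBl.
  rewrite (le_trans (le_normr_Rintegral _ a3'))//.
  rewrite -lee_fin /Rintegral fineK; last first.
    by apply: integrable_fin_num => //; exact: integrable_normr a3'.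
  have max : measurable_fun setT (fun y : V => (`|a (y + x) - a y|)%:E).
    apply/measurable_EFinP; apply: measurableT_comp => //; apply: measurable_funB => //.
    by have [] := loc_integrable_shift x aM.1.
  rewrite EFinM; apply: (le_trans _ (lee_wpmul2l _ (aM.2 x))); last by rewrite lee_fin.
  rewrite -ge0_integralZl//; apply: ge0_le_integral => //.
  + have [/measurable_EFinP ? _] := integrableP _ _ _ a3'.
    by apply/measurable_EFinP; exact: measurableT_comp.
  + exact: emeasurable_funM.
  + by move=> y _; rewrite -EFinM lee_fin normrM mulrC ler_wpM2r.
- rewrite normrM ger0_norm ?exprn_ge0 ?(ltW r0)//.
  have Di := rapid_integrable rD.
  rewrite (le_trans (ler_wpM2l _ (ae_Rintegral_le A0 haD Di hA)))// ?exprn_ge0 ?(ltW r0)//.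
  rewrite mulrCA ler_wpM2l//.
  have Ni := integrable_normr Di.
  (* The substitution y = - z / r absorbs the factor r^d and leaves Phi (r x + z) - Phi z. *)
  have r1 : - r^-1 != 0 by rewrite oppr_eq0 invr_eq0.
  have := Rintegral_affine 0 r1 Ni.
  rewrite normrN normrV ?unitfE// invrK (gtr0_norm r0) => <-.
  rewrite le_eqVlt; apply/orP; left; apply/eqP; apply: eq_Rintegral => z _.
  rewrite /D !scalerBr addr0 scaler0 sub0r scalerA mulrN divff// scaleN1r opprK.
  by rewrite addrC.
Qed.

(** Fubini and the substitution x = y + z / r move the dependence on r from the kernel to the smooth
    function u. *)
Lemma scaled_conv_pairing (u : V -> R) (r : R) : btest u -> 0 < r ->
  \int[mu]_x (u x * scaled_conv r x) =
  \int[mu]_y (h y * \int[mu]_z (u (r^-1 *: z + y) * Phi z)).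
Proof.
move=> bu r0; have r0' : r != 0 by rewrite gt_eqF.
pose K z := r ^+ d * Phi (r *: z).
have rK : rapid K by apply: rapidZ; exact: rapid_scale.
have mK : measurable_fun setT K by case: rK.
have [_ /(_ d.*2.+1)[B B0 KB]] := rK.
have [mh hi] := hw; have mu' := smooth_measurable bu.1.
transitivity (\int[mu]_x \int[mu]_y (u x * (h y * K (x - y)))).
  apply: eq_Rintegral => x _; rewrite /scaled_conv.
  rewrite -RintegralZl//; last exact: wt_integrable_rapid hw (rapid_Phi_scale x r0').
  rewrite -RintegralZl//.
    by apply: eq_Rintegral => y _; rewrite /K [in RHS](mulrCA (h y)).
  have := wt_integrable_rapid hw (rapid_sub x rK); apply: eq_integrable => // y _ /=.
  by rewrite /K (mulrCA (h y)).
have mF : measurable_fun setT (fun z : V * V => u z.1 * (h z.2 * K (z.1 - z.2))).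
  apply: measurable_funM; first exact: measurableT_comp mu' measurable_fst.
  apply: measurable_funM; first exact: measurableT_comp mh measurable_snd.
  apply: (measurableT_comp mK); apply: measurable_fun_rV => i.
  rewrite (_ : _ \o _ = fun yz : V * V => (yz.1 ord0 i : measurableTypeR R) - yz.2 ord0 i).
    apply: measurable_funB.
      exact: measurableT_comp (measurable_coord i) measurable_fst.
    exact: measurableT_comp (measurable_coord i) measurable_snd.
  by apply/funext => yz /=; rewrite !mxE.
have bF x y : `|u x * (h y * K (x - y))| <=
    (B * `|(1 + `|x|) ^+ d.*2.+1 * u x|) * `|h y * wt d.*2.+1 y|.
  have p0 : 0 <= (1 + `|x|) ^+ d.*2.+1 by rewrite exprn_ge0// addr_ge0.
  rewrite normrM (normrM (h y)) [X in _ <= B * X * _]normrM [X in _ <= _ * X]normrM.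
  rewrite (ger0_norm (wt_ge0 _ _)) (ger0_norm p0).
  (* Peetre's inequality transfers the decay from x - y to y; the loss is a power of 1 + |x|,
     harmless because u has compact support. *)
  have {}KB : `|K (x - y)| <= B * ((1 + `|x|) ^+ d.*2.+1 * wt d.*2.+1 y).
    rewrite (le_trans (KB _))// ler_wpM2l//.
    by have := wt_shift d.*2.+1 (- y) x; rewrite wtN addrC.
  rewrite (_ : B * _ * _ = `|u x| * (`|h y| * (B * ((1 + `|x|) ^+ d.*2.+1 * wt d.*2.+1 y)))).
    by rewrite ler_wpM2l// ler_wpM2l.
  by ring.
have gi : mu.-integrable setT (EFin \o (fun x => B * `|(1 + `|x|) ^+ d.*2.+1 * u x|)).
  apply: integrable_scaler; apply: integrable_normr; apply: rapid_integrable.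
  by apply: rapid_polyM; exact: btest_rapid.
rewrite (Rintegral_Fubini mF bF gi (integrable_normr hi)).
apply: eq_Rintegral => y _.
pose f x := u x * Phi (r *: (x - y)).
have fi : mu.-integrable setT (EFin \o f).
  have [C C0 PhiC] : exists2 C : R, 0 <= C & forall x, `|Phi x| <= C.
    have [_ /(_ 0)[C C0 H]] := rPhi; exists C => // x.
    by rewrite (le_trans (H x))// /wt expr0 invr1 mulr1.
  apply: (integrable_le (g := fun x => C * `|u x|)).
  - apply: measurable_funM => //; apply: (measurableT_comp (proj1 rPhi)).
    rewrite (_ : (fun _ => _) = fun x : V => r *: x - r *: y); first exact: measurable_affine.
    by apply/funext => x; rewrite scalerBr.
  - by move=> x; rewrite normrM mulrC ler_wpM2r.
  - by apply: integrable_scaler; apply: integrable_normr; exact: btest_integrable.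
transitivity (\int[mu]_x ((h y * r ^+ d) * f x)).
  by apply: eq_Rintegral => x _; rewrite /K /f; ring.
rewrite RintegralZl// -mulrA; congr (_ * _).
have r1 : r^-1 != 0 by rewrite invr_eq0.
have := Rintegral_affine y r1 fi.
rewrite normrV ?unitfE// invrK (gtr0_norm r0) => <-.
by apply: eq_Rintegral => z _; rewrite /f addrK scalerA divff// scale1r.
Qed.

(** The inner integrals tend to u y times the integral of Phi. By Peetre's inequality they are
    bounded, uniformly in n, by a multiple of the weight against which h is integrable. *)
Lemma scaled_conv_pairing_cvg (u : V -> R) : btest u ->
  \int[mu]_y (h y * \int[mu]_z (u (n.+1%:R^-1 *: z + y) * Phi z)) @[n --> \oo] -->
  (\int[mu]_z Phi z) * \int[mu]_y (h y * u y).
Proof.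
move=> bu.
have mu' := smooth_measurable bu.1.
have cu : continuous u by exact: (smooth_continuous bu.1).
have mPhi : measurable_fun setT Phi by case: rPhi.
have [mh hi] := hw.
pose N := d.*2.+1.
have [_ /(_ N)[C C0 uC]] := btest_rapid bu.
pose G z := C * `|(1 + `|z|) ^+ N * Phi z|.
have rG := rapid_polyM N rPhi.
have Gi : mu.-integrable setT (EFin \o G).
  by apply: integrable_scaler; apply: integrable_normr; exact: rapid_integrable.
pose J (n : nat) y := \int[mu]_z (u (n.+1%:R^-1 *: z + y) * Phi z).
have uPhi n y z : `|u (n.+1%:R^-1 *: z + y) * Phi z| <= wt N y * G z.
  have p0 : 0 <= (1 + `|z|) ^+ N by rewrite exprn_ge0// addr_ge0.
  rewrite normrM /G normrM (ger0_norm p0) mulrCA !mulrA ler_wpM2r//.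
  rewrite addrC (le_trans (uC _))// -mulrA ler_wpM2l//.
  rewrite (le_trans (wt_shift _ _ _))// mulrC ler_wpM2l ?wt_ge0// lerXn2r ?nnegrE ?addr_ge0//.
  rewrite lerD2l normrZ; have i1 : n.+1%:R^-1 <= 1 :> R by rewrite invf_le1// ler1n.
  have i0 : 0 < n.+1%:R^-1 :> R by rewrite invr_gt0.
  by rewrite (ger0_norm (ltW i0)) ler_piMl.
have mJ2 n : measurable_fun setT (fun z : V * V => u (n.+1%:R^-1 *: z.2 + z.1) * Phi z.2).
  apply: measurable_funM; last exact: measurableT_comp mPhi measurable_snd.
  apply: (measurableT_comp mu'); apply: measurable_fun_rV => i.
  rewrite (_ : _ \o _ = fun yz : V * V => n.+1%:R^-1 * (yz.2 ord0 i : measurableTypeR R) + yz.1 ord0 i).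
    apply: measurable_funD.
      by apply: measurable_funM => //; exact: measurableT_comp (measurable_coord i) measurable_snd.
    exact: measurableT_comp (measurable_coord i) measurable_fst.
  by apply/funext => yz /=; rewrite !mxE.
have uPhi_int n y : mu.-integrable setT (EFin \o (fun z => u (n.+1%:R^-1 *: z + y) * Phi z)).
  apply: (integrable_le _ (uPhi n y)).
    exact: (measurableT_comp (mJ2 n) (measurable_pair1 y)).
  exact: integrable_scaler.
have mJ n : measurable_fun setT (J n).
  apply: (measurable_Rintegral_snd (F := fun y z => u (n.+1%:R^-1 *: z + y) * Phi z)) => //.
have JG n y : `|J n y| <= wt N y * \int[mu]_z G z.
  rewrite (le_trans (le_normr_Rintegral _ _))// -RintegralZl//.
  apply: le_Rintegral => //; first exact: integrable_normr.
  exact: integrable_scaler.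
rewrite -RintegralZl//; last exact: (wt_integrable_loc hw).2.
rewrite (_ : \int[mu]_x _ = \int[mu]_x (h x * (u x * (\int[mu]_z Phi z)))); last first.
  by apply: eq_Rintegral => x _; rewrite mulrC mulrA.
apply: (@dominated_Rintegral R d (fun n y => h y * J n y)
  (fun y => h y * (u y * (\int[mu]_z Phi z)))
  (fun y => (\int[mu]_z G z) * `|h y * wt N y|)).
- by move=> n; apply: measurable_funM.
- move=> y; apply: cvgM; first exact: cvg_cst.
  rewrite -RintegralZl//; last exact: rapid_integrable.
  apply: (@dominated_Rintegral R d (fun n z => u (n.+1%:R^-1 *: z + y) * Phi z)
    (fun z => u y * Phi z) (fun z => wt N y * G z)).
  + by move=> n; exact: (measurableT_comp (mJ2 n) (measurable_pair1 y)).
  + move=> z; apply: cvgM; last exact: cvg_cst.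
    have := @scale_cvg R d (fun w => u (w + y)) z.
    rewrite add0r; apply => w.
    apply: (@continuous_comp V V R (fun w => w + y) u); last exact: cu.
    rewrite (_ : (fun w => w + y) = fun w : V => 1 *: w + y); first exact: affine_continuous.
    by apply/funext => v; rewrite scale1r.
  + by move=> n z; exact: uPhi.
  + exact: integrable_scaler.
- move=> n y; rewrite !normrM (ger0_norm (wt_ge0 _ _)) mulrCA ler_wpM2l// mulrC.
  exact: JG.
- by apply: integrable_scaler; exact: integrable_normr.
Qed.

End scaled_convolution.

(** * Functions determined modulo constants by their pairings *)

Section annihilated.
Context {R : realType} {d : nat}.
Local Notation V := 'rV[R]_d.
Local Notation mu := (lebesgue_rV d).
Variables (chi h : V -> R).
Hypotheses (chiP : cutoff chi) (hw : wt_integrable h).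
Hypothesis annih : forall th (g : V -> R), btest g ->
  (\forall xi \near (0 : V), g xi = 0) -> \int[mu]_x (h x * ft th g x) = 0.

Let Phi := ft 0 chi.
Let bchi : btest chi. Proof. by case: chiP. Qed.
Let rPhi : rapid Phi. Proof. exact: (ft_rapid chiP). Qed.

Lemma integrable_h_sub u x : rapid u ->
  mu.-integrable setT (EFin \o (fun y => h y * u (x - y))).
Proof. by move=> ru; apply: wt_integrable_rapid => //; exact: rapid_sub. Qed.

(** A translation by x only multiplies g by cosines, which keeps it zero near the origin. *)
Lemma annih_conv th (g : V -> R) x : btest g -> (\forall xi \near (0 : V), g xi = 0) ->
  \int[mu]_y (h y * ft th g (x - y)) = 0.
Proof.
move=> bg g0.
have b1 t : btest (fun xi => g xi * cosdot x t xi).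
  by apply: btestM => //; exact: smooth_cosdot.
have n1 t : \forall xi \near (0 : V), g xi * cosdot x t xi = 0.
  by apply: filterS g0 => xi ->; rewrite mul0r.
transitivity (\int[mu]_y (h y * ft 0 (fun xi => g xi * cosdot x th xi) y +
  h y * ft (- (pi / 2)) (fun xi => g xi * cosdot x (th - pi / 2) xi) y)).
  by apply: eq_Rintegral => y _; rewrite ft_sub// mulrDr.
rewrite RintegralD//; last 2 first.
- by apply: wt_integrable_rapid => //; exact: (ft_rapid chiP).
- by apply: wt_integrable_rapid => //; exact: (ft_rapid chiP).
by rewrite !annih ?addr0.
Qed.

Lemma scaled_convE (r : R) x : 0 < r ->
  scaled_conv Phi h r x = \int[mu]_y (h y * ft 0 (fun xi => chi (r^-1 *: xi)) (x - y)).
Proof.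
move=> r0; rewrite /scaled_conv -RintegralZl//; last first.
  by apply: wt_integrable_rapid => //; exact: (rapid_Phi_scale rPhi x (lt0r_neq0 r0)).
apply: eq_Rintegral => y _; rewrite ftZ ?invr_eq0 ?gt_eqF//; last exact: btest_integrable.
by rewrite invrK normrV ?unitfE ?gt_eqF// invrK gtr0_norm// mulrCA.
Qed.

Lemma btest_scale (r : R) : r != 0 -> btest (fun xi => chi (r *: xi)).
Proof.
move=> r0; rewrite (_ : (fun _ => _) = fun xi => chi (r *: xi + 0)); first exact: btest_affine.
by apply/funext => y; rewrite addr0.
Qed.

Lemma cutoff_near_scale (r : R) : \forall xi \near (0 : V), chi (r *: xi) = 1.
Proof.
have [_ [s s0 chi1]] := chiP.
have e0 : 0 < s / (`|r| + 1) by rewrite divr_gt0// ltr_pwDr.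
apply: filterS (nbhsx_ballx (0 : V) _ e0) => y; rewrite -ball_normE /ball_/= sub0r normrN.
rewrite ltr_pdivlMr ?ltr_pwDr// => ys; apply: chi1; rewrite normrZ (le_trans _ (ltW ys))//.
by rewrite mulrC ler_wpM2l// lerDl.
Qed.

Lemma scaled_conv_indep (r s : R) x : 0 < r -> 0 < s -> scaled_conv Phi h r x = scaled_conv Phi h s x.
Proof.
move=> r0 s0; apply/eqP; rewrite -subr_eq0; apply/eqP.
have b1 (t : R) : 0 < t -> btest (fun xi => chi (t^-1 *: xi)).
  by move=> t0; apply: btest_scale; rewrite invr_eq0 gt_eqF.
rewrite !scaled_convE// -RintegralB//; last 2 first.
- by apply: integrable_h_sub; exact: (ft_rapid chiP 0 (b1 _ r0)).
- by apply: integrable_h_sub; exact: (ft_rapid chiP 0 (b1 _ s0)).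
transitivity (\int[mu]_y (h y * ft 0 (fun xi => chi (r^-1 *: xi) - chi (s^-1 *: xi)) (x - y))).
  apply: eq_Rintegral => y _; rewrite -mulrBr; congr (_ * _).
  rewrite /ft -RintegralB//; last 2 first.
  - by apply: integrable_cosdot; exact: btest_integrable (b1 _ r0).
  - by apply: integrable_cosdot; exact: btest_integrable (b1 _ s0).
  by apply: eq_Rintegral => xi _; rewrite mulrBl.
apply: annih_conv; first exact: btestB (b1 _ r0) (b1 _ s0).
apply: filterS2 (cutoff_near_scale r^-1) (cutoff_near_scale s^-1) => xi -> ->.
by rewrite subrr.
Qed.

Lemma scaled_conv_cst (a : V -> R) (A M : R) : (0 < d)%N -> 0 <= A ->
  translation_bound a M -> {ae mu, forall x, `|h x - a x| <= A} ->
  forall (r : R) x, 0 < r -> scaled_conv Phi h r x = scaled_conv Phi h 1 0.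
Proof.
move=> d0 A0 aM hA r x r0.
rewrite (scaled_conv_indep x r0 ltr01).
have aw : wt_integrable a.
  by split; [case: aM => -[]|exact: integrable_translation_bound chiP aM].
have [C C0 HC] := scaled_conv_diff rPhi hw A0 aw aM hA.
apply/eqP; rewrite -subr_eq0 -normr_le0.
pose s (n : nat) : R := n.+1%:R^-1.
have s0 n : 0 < s n by rewrite invr_gt0.
pose S : R := \sum_i `|x ord0 i|.
pose I n := \int[mu]_z `|Phi (s n *: x + z) - Phi z|.
have [_ /(_ d.*2)[B B0 PB]] := rPhi.
have mPhi : measurable_fun setT Phi by case: rPhi.
have cPhi : continuous Phi by apply: ft_continuous; exact: btest_rapid.
have I0 : I n @[n --> \oo] --> (0 : R).
  have -> : (0 : R) = \int[mu]_z (cst (0 : R) z).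
    by rewrite /Rintegral integral0.
  apply: (@dominated_Rintegral R d (fun n z => `|Phi (s n *: x + z) - Phi z|) (cst 0)
    (fun z => (B * (1 + `|x|) ^+ d.*2 + B) * wt d.*2 z)).
  - move=> n; apply: measurableT_comp => //; apply: measurable_funB => //.
    rewrite (_ : (fun _ => _) = fun z => Phi (1 *: z + s n *: x)).
      by apply: (measurableT_comp mPhi); exact: measurable_affine.
    by apply/funext => z; rewrite scale1r addrC.
  - move=> z; rewrite /cst -[X in _ --> X](@normr0 R R) -(subrr (Phi z)).
    apply: cvg_norm; apply: cvgB; last exact: cvg_cst.
    have := @scale_cvg R d (fun y => Phi (y + z)) x.
    rewrite add0r; apply.
    move=> y; apply: (@continuous_comp V V R (fun y => y + z) Phi); last exact: cPhi.
    rewrite (_ : +%R^~ z = fun w : V => 1 *: w + z); first exact: affine_continuous.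
    by apply/funext => w; rewrite scale1r.
  - move=> n z; rewrite normr_id (le_trans (ler_normB _ _))// mulrDl; apply: lerD => //.
    rewrite addrC (le_trans (PB _))// -mulrA ler_wpM2l//.
    rewrite (le_trans (wt_shift _ _ _))// ler_wpM2r ?wt_ge0// lerXn2r ?nnegrE ?addr_ge0//.
    rewrite lerD2l normrZ ger0_norm ?(ltW (s0 n))// ler_piMl//.
    by rewrite invf_le1// ler1n.
  - by apply: integrable_scaler; exact: integrable_wt.
(* The positive dimension enters here: the power r^d has to tend to 0 with r. *)
have sd0 : s n ^+ d @[n --> \oo] --> (0 : R).
  case: d d0 => // k _.
  have -> : (0 : R) = 0 * 0 ^+ k by rewrite mul0r.
  rewrite (_ : (fun _ => _) = fun n => s n * s n ^+ k); last by apply/funext => n; rewrite exprS.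
  apply: cvgM; first exact: inv_nat_cvg0.
  elim: k => [|k IH]; first by rewrite expr0; under eq_fun do rewrite expr0; exact: cvg_cst.
  rewrite exprS; under eq_fun do rewrite exprS.
  by apply: cvgM => //; exact: inv_nat_cvg0.
have lim0 : s n ^+ d * (C * (M * S)) + A * I n @[n --> \oo] --> (0 : R).
  rewrite (_ : 0 = 0 * (C * (M * S)) + A * 0); last by rewrite mul0r mulr0 addr0.
  apply: cvgD; first by apply: cvgM => //; exact: cvg_cst.
  by apply: cvgM => //; exact: cvg_cst.
rewrite -(cvg_lim _ lim0)//; apply: limr_ge; first by apply/cvg_ex; exists 0.
apply: nearW => n.
by rewrite -(scaled_conv_indep x (s0 n) ltr01) -(scaled_conv_indep 0 (s0 n) ltr01); exact: HC.
Qed.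

Lemma annihilated_cst (a : V -> R) (A M : R) : (0 < d)%N -> 0 <= A ->
  translation_bound a M -> {ae mu, forall x, `|h x - a x| <= A} ->
  exists c, {ae mu, forall x, h x = c}.
Proof.
move=> d0 A0 aM hA.
have hcst := scaled_conv_cst d0 A0 aM hA.
set H0 := scaled_conv Phi h 1 0 in hcst.
pose m := ft_mass 0 chi.
have m0 : m != 0 := ft_mass_neq0 chiP.
(* The convolution equals H0 at every scale. Paired with u it gives H0 times the integral of u, and
   as the scale parameter tends to infinity the same pairing tends to m times the pairing of h with
   u. *)
pose c := H0 / m; exists c.
have huE u : btest u -> \int[mu]_y (h y * u y) = c * \int[mu]_y u y.
  move=> bu; apply: (mulfI m0).
  have := scaled_conv_pairing_cvg rPhi hw bu.
  have E n : \int[mu]_y (h y * \int[mu]_z (u (n.+1%:R^-1 *: z + y) * Phi z)) =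
      H0 * \int[mu]_y u y.
    transitivity (\int[mu]_x (u x * scaled_conv Phi h n.+1%:R x)).
      by rewrite scaled_conv_pairing.
    transitivity (\int[mu]_x (H0 * u x)).
      by apply: eq_Rintegral => x _; rewrite hcst// mulrC.
    by rewrite RintegralZl//; exact: btest_integrable.
  under eq_fun do rewrite E.
  move=> /cvg_lim <-//; rewrite lim_cst// /c mulrA [m * _]mulrC divfK//.
(* h - c pairs to 0 with every test function, so [L1_duality] with M = 0 makes it vanish almost
   everywhere. *)
pose k y := h y - c.
have lk : loc_integrable k.
  by apply: loc_integrableB; [exact: wt_integrable_loc|exact: loc_integrable_cst].
have [B B0 dual] := L1_duality chiP.
have k0 : (\int[mu]_x `|k x|%:E <= (B * 0)%:E)%E.
  apply: dual => // u bu _.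
  have ci : mu.-integrable setT (EFin \o (fun y => c * u y)).
    by apply: integrable_scaler; exact: btest_integrable.
  rewrite (_ : \int[mu]_x _ = \int[mu]_x (h x * u x - c * u x)); last first.
    by apply: eq_Rintegral => x _; rewrite mulrBl.
  rewrite RintegralB//; last exact: (wt_integrable_loc hw).2.
  by rewrite huE// RintegralZl ?subrr ?normr0//; exact: btest_integrable.
have mk : measurable_fun setT (EFin \o k) by apply/measurable_EFinP; case: lk.
have : (\int[mu]_x `|(EFin \o k) x| = 0)%E.
  apply/eqP; rewrite eq_le; apply/andP; split; first by move: k0; rewrite mulr0.
  by apply: integral_ge0.
move=> /(ae_eq_integral_abs _ measurableT mk).
apply: filterS => x /= /(_ I) [kx]; apply/eqP; rewrite -subr_eq0; exact/eqP.
Qed.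

End annihilated.

(** * Convolution with dilates of a kernel of integral 0 *)

Section kernel_convolution.
Context {R : realType} {d : nat}.
Local Notation V := 'rV[R]_d.
Local Notation mu := (lebesgue_rV d).

Lemma translation_boundD_cst (a : V -> R) (M c : R) : translation_bound a M ->
  translation_bound (fun x => a x + c) M.
Proof.
move=> [la aM]; split.
  rewrite (_ : (fun _ => _) = fun x => a x - cst (- c) x).
    by apply: loc_integrableB => //; exact: loc_integrable_cst.
  by apply/funext => x; rewrite /cst opprK.
move=> h; apply: le_trans (aM h); rewrite le_eqVlt; apply/orP; left; apply/eqP.
by apply: eq_integral => x _; rewrite opprD addrACA subrr addr0.
Qed.

Definition dilate (K : V -> R) (r : R) z : R := r ^+ d * K (r *: z).

Lemma rapid_dilate K r : r != 0 -> rapid K -> rapid (dilate K r).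
Proof. by move=> r0 rK; apply: rapidZ; exact: rapid_scale. Qed.

Lemma Rintegral_dilate_sub (K : V -> R) (r : R) x : 0 < r ->
  mu.-integrable setT (EFin \o K) -> \int[mu]_y dilate K r (x - y) = \int[mu]_y K y.
Proof.
move=> r0 Ki; have r1 : - r != 0 by rewrite oppr_eq0 gt_eqF.
have E : (fun y => K (r *: (x - y))) = (fun y => K (- r *: y + r *: x)).
  by apply/funext => y; rewrite scalerBr scaleNr addrC.
have := Rintegral_affine (r *: x) r1 Ki; rewrite normrN (gtr0_norm r0) => KE.
rewrite /dilate RintegralZl//; last first.
  by rewrite [X in EFin \o X]E; exact: integrable_affine.
by rewrite E KE mulrA -exprMn divff ?expr1n ?mul1r// gt_eqF.
Qed.

(** The part h - a contributes at most A times the L1 norm of K, whatever r is. For a, the zero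
    integral of K allows a x to be subtracted, and g is the integral of |a (x + z) - a x| against
    the absolute value of the dilated kernel. Integrating in x first gives M times the length of z,
    whose integral against that kernel is proportional to 1 / r. The values of g are extended reals
    since it may be infinite at some points. *)
Lemma dilate_conv_bound (K : V -> R) : rapid K -> \int[mu]_x K x = 0 ->
  exists2 C : R, 0 <= C & forall (r A M : R) (h a : V -> R), 0 < r -> 0 <= A -> 0 <= M ->
  wt_integrable h -> wt_integrable a -> translation_bound a M ->
  {ae mu, forall x, `|h x - a x| <= A} ->
  exists g : V -> \bar R, [/\ measurable_fun setT g, forall x, (0 <= g x)%E,
    (\int[mu]_x g x <= (C * M / r)%:E)%E &
    forall x, (`|\int[mu]_y (h y * dilate K r (x - y))|%:E <= (C * A)%:E + g x)%E].
Proof.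
move=> rK K0.
have Ki := rapid_integrable rK.
pose S (z : V) := \sum_i `|z ord0 i|.
have S0 z : 0 <= S z by apply: sumr_ge0.
have mS : measurable_fun setT S.
  by apply: measurable_sum => i; apply: measurableT_comp => //; exact: measurable_coord.
pose KS z := `|K z| * S z.
have KSi : mu.-integrable setT (EFin \o KS).
  apply: (integrable_le (g := fun z => d%:R * (`|K z| * `|z|))).
  - by apply: measurable_funM => //; apply: measurableT_comp => //; case: rK.
  - move=> z; rewrite normrM normr_id (ger0_norm (S0 z)) mulrCA ler_wpM2l//.
    rewrite mulr_natl -[X in _ *+ X]card_ord -sumr_const.
    by apply: ler_sum => i _; exact: coord_le_norm.
  - apply: integrable_scaler; apply: rapid_integrable; exact: rapid_normM.
(* The first summand serves the pointwise bound, the second the integral of g. *)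
pose C := \int[mu]_z `|K z| + \int[mu]_z KS z.
have C1 : 0 <= \int[mu]_z `|K z| by apply: Rintegral_ge0.
have C2 : 0 <= \int[mu]_z KS z by apply: Rintegral_ge0 => z _; rewrite mulr_ge0.
exists C; first exact: addr_ge0.
move=> r A M h a r0 A0 M0 hw aw [la aM] hA.
have r0' : r != 0 by rewrite gt_eqF.
have rD := rapid_dilate r0' rK.
have [mD _] := rD; have [mh _] := hw; have [ma _] := aw.
pose F x z := `|a (x + z) - a x| * `|dilate K r (- z)|.
have F0 x z : 0 <= F x z by rewrite mulr_ge0.
have madd : measurable_fun setT (fun yz : V * V => yz.1 + yz.2).
  apply: measurable_fun_rV => i.
  rewrite (_ : _ \o _ = fun yz : V * V => (yz.1 ord0 i : measurableTypeR R) + yz.2 ord0 i).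
    apply: measurable_funD.
      exact: measurableT_comp (measurable_coord i) measurable_fst.
    exact: measurableT_comp (measurable_coord i) measurable_snd.
  by apply/funext => yz /=; rewrite mxE.
have mDN : measurable_fun setT (fun z : V => dilate K r (- z)).
  rewrite (_ : (fun _ => _) = fun z : V => dilate K r (0 - z)); last by apply/funext => z; rewrite sub0r.
  by have [] := rapid_sub 0 rD.
have mF : measurable_fun setT (fun xz : V * V => (F xz.1 xz.2)%:E).
  apply/measurable_EFinP; apply: measurable_funM.
    apply: measurableT_comp => //; apply: measurable_funB.
      exact: measurableT_comp ma madd.
    exact: measurableT_comp ma measurable_fst.
  apply: measurableT_comp => //; exact: (measurableT_comp mDN measurable_snd).
pose g x := (\int[mu]_z (F x z)%:E)%E.
exists g; split.
- exact: measurable_fun_integral_snd.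
- by move=> x; apply: integral_ge0 => z _; rewrite lee_fin.
- rewrite /g (fubini_tonelli (fun xz : V * V => (F xz.1 xz.2)%:E))//; last first.
    by move=> z; rewrite lee_fin.
  rewrite /=.
  have r1 : - r != 0 by rewrite oppr_eq0.
  have fi : mu.-integrable setT (EFin \o (fun z => r ^+ d * KS (- r *: z))).
    apply: integrable_scaler; have := integrable_affine 0 r1 KSi.
    by apply: eq_integrable => // z _ /=; rewrite addr0.
  have fi' := integrable_scaler (M / r) fi.
  apply: (@le_trans _ _ (\int[mu]_z ((M / r) * (r ^+ d * KS (- r *: z)))%:E)%E).
    apply: ge0_le_integral => //.
    + by move=> z _; apply: integral_ge0 => x _; rewrite lee_fin.
    + exact: measurable_fun_integral_fst.
    + exact: measurable_int fi'.
    move=> z _; rewrite /F.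
    under eq_integral do rewrite mulrC EFinM.
    rewrite ge0_integralZl//; last first.
      apply/measurable_EFinP; apply: measurableT_comp => //; apply: measurable_funB => //.
      by have [] := loc_integrable_shift z la.
    apply: (le_trans (lee_wpmul2l _ (aM z))); first by rewrite lee_fin.
    rewrite -EFinM lee_fin le_eqVlt; apply/orP; left; apply/eqP.
    rewrite /KS (_ : S (- r *: z) = r * S z); last first.
      rewrite /S mulr_sumr; apply: eq_bigr => i _.
      by rewrite mxE normrM normrN (gtr0_norm r0).
    rewrite /dilate normrM ger0_norm ?exprn_ge0 ?(ltW r0)// scalerN scaleNr.
    by rewrite -/(S z); field.
  have -> : (\int[mu]_z ((M / r) * (r ^+ d * KS (- r *: z)))%:E)%E =
      (M / r * \int[mu]_z KS z)%:E.
    rewrite -[LHS]fineK; last exact: integrable_fin_num.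
    congr EFin; rewrite -/(Rintegral mu setT (fun z => (M / r) * (r ^+ d * KS (- r *: z)))).
    rewrite RintegralZl//; congr (_ * _).
    rewrite RintegralZl//; last first.
      by have := integrable_affine 0 r1 KSi; apply: eq_integrable => // z _ /=; rewrite addr0.
    have := Rintegral_affine 0 r1 KSi.
    under eq_Rintegral do rewrite addr0.
    by move=> ->; rewrite normrN (gtr0_norm r0) mulrA -exprMn divff// expr1n mul1r.
  rewrite lee_fin mulrC mulrA ler_wpM2r ?invr_ge0 ?(ltW r0)// ler_wpM2r//.
  by rewrite lerDr.
- move=> x.
  have rDx := rapid_sub x rD.
  have hD := wt_integrable_rapid hw rDx.
  have aD := wt_integrable_rapid aw rDx.
  have Di := rapid_integrable rDx.
  have D0 : \int[mu]_y dilate K r (x - y) = 0 by rewrite Rintegral_dilate_sub.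
  have haD : mu.-integrable setT (EFin \o (fun y => (h y - a y) * dilate K r (x - y))).
    by have := integrable_subr hD aD; apply: eq_integrable => // y _ /=; rewrite mulrBl.
  have axD := integrable_scaler (a x) Di.
  have aaD : mu.-integrable setT (EFin \o (fun y => (a y - a x) * dilate K r (x - y))).
    by have := integrable_subr aD axD; apply: eq_integrable => // y _ /=; rewrite mulrBl.
  have -> : \int[mu]_y (h y * dilate K r (x - y)) =
      \int[mu]_y ((h y - a y) * dilate K r (x - y)) + \int[mu]_y ((a y - a x) * dilate K r (x - y)).
    rewrite -[LHS]subr0 -[X in _ - X](mulr0 (a x)) -D0 -RintegralZl// -RintegralB// -RintegralD//.
    by apply: eq_Rintegral => y _; ring.
  apply: (@le_trans _ _ (`|\int[mu]_y ((h y - a y) * dilate K r (x - y))|%:E +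
    `|\int[mu]_y ((a y - a x) * dilate K r (x - y))|%:E)%E).
    by rewrite -EFinD lee_fin ler_normD.
  apply: leeD.
    rewrite lee_fin (le_trans (ae_Rintegral_le A0 haD Di hA))// mulrC ler_wpM2r//.
    rewrite (_ : \int[mu]_y _ = \int[mu]_y (dilate (fun z => `|K z|) r (x - y))); last first.
      by apply: eq_Rintegral => y _; rewrite /dilate normrM ger0_norm// exprn_ge0// ltW.
    by rewrite Rintegral_dilate_sub ?lerDl//; exact: integrable_normr.
  have ni := integrable_normr aaD.
  apply: (@le_trans _ _ (\int[mu]_y `|(a y - a x) * dilate K r (x - y)|%:E)%E).
    rewrite -[leRHS]fineK; last exact: integrable_fin_num.
    by rewrite lee_fin; exact: le_normr_Rintegral.
  rewrite -(ge0_integral_translate x (f := fun y => `|(a y - a x) * dilate K r (x - y)|%:E)).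
  + rewrite le_eqVlt; apply/orP; left; apply/eqP; apply: eq_integral => z _.
    by rewrite /F normrM (addrC x z) opprD addrCA subrr addr0.
  + exact: measurable_int ni.
  + by move=> y; rewrite lee_fin.
Qed.

End kernel_convolution.

(** * The kernels of the dyadic pieces *)

Section lp_kernel.
Context {R : realType} {d : nat}.
Local Notation C := R[i].
Local Notation V := 'rV[R]_d.
Local Notation mu := (lebesgue_rV d).
Variables (phi : V -> C).
Hypothesis phiP : dyadic_cutoff phi.

Let pr x := complex.Re (phi x).
Let pi' x := complex.Im (phi x).

Lemma cutoff_eq0 xi : ~ (3 / 4 < enorm xi < 7 / 4) -> phi xi = 0.
Proof.
move=> H; apply/eqP; apply/negPn/negP => nz; apply: H.
by apply: (cutoff_support phiP); exact: subset_closure.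
Qed.

Lemma btest_Re_cutoff : btest pr.
Proof.
split; first by case: (cutoff_smooth phiP).
exists (7 / 4) => x xr; rewrite /pr cutoff_eq0// => /andP[_].
by rewrite ltNge (le_trans xr)// norm_le_enorm.
Qed.

Lemma btest_Im_cutoff : btest pi'.
Proof.
split; first by case: (cutoff_smooth phiP).
exists (7 / 4) => x xr; rewrite /pi' cutoff_eq0// => /andP[_].
by rewrite ltNge (le_trans xr)// norm_le_enorm.
Qed.

Lemma enorm_small (s : R) : 0 < s -> exists2 r : R, 0 < r & forall x : V, `|x| <= r -> enorm x < s.
Proof.
move=> s0; have D0 : 0 < 1 + d%:R :> R by rewrite ltr_pwDl.
exists (s / 2 / (1 + d%:R)); first by rewrite !divr_gt0.
move=> x; rewrite ler_pdivlMr// mulrC => xs.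
by rewrite (le_lt_trans (enorm_le_norm x))// (le_lt_trans xs)// ltr_pdivrMr// ltr_pMr// ltr1n.
Qed.

Lemma enorm_continuous : continuous (@enorm R d).
Proof.
have cd : continuous (fun y : V => dot y y).
  rewrite /dot; elim: (index_enum _) => [|i l IH] x.
    rewrite (_ : (fun _ => _) = cst 0); first exact: cst_continuous.
    by apply/funext => y; rewrite big_nil.
  rewrite (_ : (fun _ => _) = (fun y : V => y ord0 i * y ord0 i) \+
    (fun y => \sum_(i <- l) y ord0 i * y ord0 i)); last by apply/funext => y; rewrite big_cons.
  apply: continuousD; last exact: IH.
  by apply: (@continuousM _ V (fun y : V => y ord0 i) (fun y : V => y ord0 i));
    exact: coord_continuous.
move=> x; apply: (@continuous_comp V R R (fun y => dot y y) Num.sqrt); first exact: cd.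
exact: sqrt_continuous.
Qed.

(** The earlier sections ask for a test function equal to 1 near 0. The real part of phi is 1 on the
    annulus between 7/8 and 9/8, so replacing it by 1 inside the unit ball leaves it smooth. *)
Definition low_cutoff x : R := if enorm x < 1 then 1 else pr x.

Lemma low_cutoff_cutoff : cutoff low_cutoff.
Proof.
split; last first.
  by have [r r0 xr] := enorm_small ltr01; exists r => // x /xr; rewrite /low_cutoff => ->.
split; last first.
  have [_ [r rE]] := btest_Re_cutoff.
  exists (Num.max 1 r) => x; rewrite ge_max => /andP[x1 xr].
  by rewrite /low_cutoff ltNge (le_trans x1 (norm_le_enorm x))/= rE.
apply: smooth_near => x.
have [x1|x1] := ltP (enorm x) 1.
  exists (cst 1); first exact: smooth_cst.
  have : \forall y \near x, enorm y < 1.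
    exact: (cvgr_lt (enorm x) (@enorm_continuous x) 1 x1).
  by apply: filterS => y y1; rewrite /low_cutoff y1.
exists pr; first by case: btest_Re_cutoff.
have : \forall y \near x, 7 / 8 < enorm y.
  apply: (cvgr_gt (enorm x) (@enorm_continuous x)).
  by rewrite (lt_le_trans _ x1)//; lra.
apply: filterS => y y1; rewrite /low_cutoff; case: ltP => // y2.
rewrite /pr (cutoff_eq1 phiP)//; apply/andP; split; first exact: ltW.
by rewrite (le_trans (ltW y2))//; lra.
Qed.

Let mass0 th (g : V -> R) : btest g -> g 0 = 0 -> ft_mass th g = 0.
Proof. by move=> bg g0; rewrite (ft_massE low_cutoff_cutoff)// g0 mul0r. Qed.

Let phi0 : phi 0 = 0.
Proof.
apply: cutoff_eq0 => /andP[+ _].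
rewrite /enorm (_ : dot _ _ = 0) ?sqrtr0; last exact: dot0l.
by rewrite ltNge divr_ge0.
Qed.

(** With [ker_Im], the real and imaginary parts of the inverse Fourier transform of phi; sines are
    cosines of phase pi / 2 or - pi / 2. Both parts of phi occur in each because phi is complex
    valued. *)
Definition ker_Re z : R := (2 * pi) ^- d * (ft 0 pr z + ft (pi / 2) pi' z).
Definition ker_Im z : R := (2 * pi) ^- d * (ft (- (pi / 2)) pr z + ft 0 pi' z).

Lemma rapid_ker : rapid ker_Re /\ rapid ker_Im.
Proof.
have r1 th := ft_rapid low_cutoff_cutoff th btest_Re_cutoff.
have r2 th := ft_rapid low_cutoff_cutoff th btest_Im_cutoff.
by split; apply: rapidZ; apply: rapidD.
Qed.

(** The integral of a transform is a multiple of the value at 0 of the function transformed, and phi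
    vanishes there. *)
Lemma Rintegral_ker : \int[mu]_z ker_Re z = 0 /\ \int[mu]_z ker_Im z = 0.
Proof.
have r1 th := rapid_integrable (ft_rapid low_cutoff_cutoff th btest_Re_cutoff).
have r2 th := rapid_integrable (ft_rapid low_cutoff_cutoff th btest_Im_cutoff).
have m1 th : \int[mu]_z ft th pr z = 0.
  by rewrite -/(ft_mass th pr) mass0 ?/pr ?phi0//; exact: btest_Re_cutoff.
have m2 th : \int[mu]_z ft th pi' z = 0.
  by rewrite -/(ft_mass th pi') mass0 ?/pi' ?phi0//; exact: btest_Im_cutoff.
by split; rewrite RintegralZl ?RintegralD ?m1 ?m2 ?addr0 ?mulr0//; exact: integrable_addr.
Qed.

Lemma lp_kernelE (k : int) x y : lp_kernel phi k x y =
  dilate ker_Re (2 ^ k) (x - y) +i* dilate ker_Im (2 ^ k) (x - y).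
Proof.
rewrite /lp_kernel /cintegral.
have i1 := btest_integrable btest_Re_cutoff.
have i2 := btest_integrable btest_Im_cutoff.
set z := x - y; set r : R := 2 ^ k.
have r0 : 0 < r by rewrite exprz_gt0.
have r0' : r^-1 != 0 by rewrite invr_eq0 gt_eqF.
rewrite -invr_expz -/r.
have sc (g : V -> R) th : mu.-integrable setT (EFin \o g) ->
    mu.-integrable setT (EFin \o (fun xi => g (r^-1 *: xi) * cosdot z th xi)).
  move=> gi; apply: (integrable_cosdot (g := fun xi => g (r^-1 *: xi))).
  by have := integrable_affine 0 r0' gi; apply: eq_integrable => // xi _ /=; rewrite addr0.
have ftE (g : V -> R) th : mu.-integrable setT (EFin \o g) ->
    \int[mu]_xi (g (r^-1 *: xi) * cosdot z th xi) = r ^+ d * ft th g (r *: z).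
  move=> gi; rewrite -/(ft th (fun xi => g (r^-1 *: xi)) z) ftZ//.
  by rewrite normrV ?unitfE ?gt_eqF// invrK (gtr0_norm r0) invrK.
have -> : \int[mu]_xi complex.Re (phi (r^-1 *: xi) * cexpi (dot z xi)) =
    r ^+ d * (ft 0 pr (r *: z) + ft (pi / 2) pi' (r *: z)).
  rewrite mulrDr -!ftE// -RintegralD//; [|exact: sc..].
  apply: eq_Rintegral => xi _; rewrite /pr /pi' /cexpi /cosdot addr0 cosDpihalf.
  by case: (phi _) => u v /=; rewrite mulrN.
have -> : \int[mu]_xi complex.Im (phi (r^-1 *: xi) * cexpi (dot z xi)) =
    r ^+ d * (ft (- (pi / 2)) pr (r *: z) + ft 0 pi' (r *: z)).
  rewrite mulrDr -!ftE// -RintegralD//; [|exact: sc..].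
  apply: eq_Rintegral => xi _; rewrite /pr /pi' /cexpi /cosdot addr0 cosBpihalf.
  by case: (phi _) => u v /=; rewrite addrC.
rewrite /dilate /ker_Re /ker_Im /=.
by apply/eqP; rewrite eq_complex /=; apply/andP; split; apply/eqP; ring.
Qed.

End lp_kernel.

(** * Level sets of the dyadic pieces *)

Section level_sets.
Context {R : realType} {d : nat}.
Local Notation C := R[i].
Local Notation V := 'rV[R]_d.
Local Notation mu := (lebesgue_rV d).

Lemma measurable_ereal_ge (G : V -> \bar R) (e : \bar R) : measurable_fun setT G ->
  measurable [set x | (e <= G x)%E].
Proof.
move=> mG; rewrite -[X in measurable X]setTI.
rewrite (_ : [set x | _] = G @^-1` `[e, +oo[%classic).
  by apply: mG => //; exact: emeasurable_itv.
by apply/seteqP; split => x /=; rewrite in_itv/= andbT.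
Qed.

Lemma ge0_markov (G : V -> \bar R) (e : R) : measurable_fun setT G ->
  (forall x, 0 <= G x)%E -> 0 <= e ->
  (e%:E * mu [set x | e%:E <= G x] <= \int[mu]_x G x)%E.
Proof.
move=> mG G0 e0; set D := [set x | _]%E.
have mD : measurable D by exact: measurable_ereal_ge.
rewrite -(integral_cst mu mD) (@le_trans _ _ (\int[mu]_(x in D) G x)%E)//.
  by apply: ge0_le_integral => //; exact: measurable_funTS.
exact: ge0_subset_integral.
Qed.

Lemma measurable_conv (h K : V -> R) : wt_integrable h -> rapid K ->
  measurable_fun setT (fun x : V => \int[mu]_y (h y * K (x - y))).
Proof.
move=> hw rK; apply: (measurable_Rintegral_snd (F := fun x y => h y * K (x - y))).
  apply: measurable_funM; first exact: measurableT_comp hw.1 measurable_snd.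
  apply: (measurableT_comp rK.1); apply: measurable_fun_rV => i.
  rewrite (_ : _ \o _ = fun yz : V * V => (yz.1 ord0 i : measurableTypeR R) - yz.2 ord0 i).
    apply: measurable_funB.
      exact: measurableT_comp (measurable_coord i) measurable_fst.
    exact: measurableT_comp (measurable_coord i) measurable_snd.
  by apply/funext => yz /=; rewrite !mxE.
by move=> x; apply: wt_integrable_rapid => //; exact: rapid_sub.
Qed.

(** What a decomposition f = f0 + f1 provides: ar and ai stand for the real and imaginary parts of
    f1 up to constants, A bounds the rest and M controls the translates. *)
Definition split_bound (f : V -> C) (A M : R) := exists ar ai : V -> R,
  [/\ translation_bound ar M, translation_bound ai M,
      {ae mu, forall x, `|complex.Re (f x) - ar x| <= A} &
      {ae mu, forall x, `|complex.Im (f x) - ai x| <= A}].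

Lemma normc_le (a b : R) : Normc.normc (a +i* b) <= `|a| + `|b|.
Proof.
rewrite /Normc.normc -[leRHS]ger0_norm ?addr_ge0// -sqrtr_sqr ler_wsqrtr//.
by rewrite sqrrD !real_normK ?num_real// lerD2r lerDl mulrn_wge0// mulr_ge0.
Qed.

Lemma pairing_normc (f psi : V -> C) (a b u v : V -> R) :
  (forall x, f x = a x +i* b x) -> (forall x, psi x = u x +i* v x) ->
  mu.-integrable setT (EFin \o (fun x => a x * u x)) ->
  mu.-integrable setT (EFin \o (fun x => a x * v x)) ->
  mu.-integrable setT (EFin \o (fun x => b x * u x)) ->
  mu.-integrable setT (EFin \o (fun x => b x * v x)) ->
  pairing f psi = (\int[mu]_x (a x * u x) - \int[mu]_x (b x * v x)) +i*
    (\int[mu]_x (a x * v x) + \int[mu]_x (b x * u x)).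
Proof.
move=> fE pE au av bu bv; rewrite /pairing /cintegral.
congr (_ +i* _).
  by rewrite -RintegralB//; apply: eq_Rintegral => x _; rewrite fE pE.
by rewrite -RintegralD//; apply: eq_Rintegral => x _; rewrite fE pE.
Qed.

Variables (phi : V -> C).
Hypothesis phiP : dyadic_cutoff phi.

Lemma split_bound_wt_integrable f A M : cmeasurable f -> split_bound f A M ->
  wt_integrable (fun x => complex.Re (f x)) /\ wt_integrable (fun x => complex.Im (f x)).
Proof.
move=> [mr mi] [ar [ai [Tr Ti Er Ei]]].
by split; [exact: wt_integrable_decomposition (low_cutoff_cutoff phiP) mr Tr Er|
  exact: wt_integrable_decomposition (low_cutoff_cutoff phiP) mi Ti Ei].
Qed.

Lemma lp_level : exists kappa B : R, [/\ 0 < kappa, 0 <= B &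
  forall f (k : int) (A M tau : R), cmeasurable f -> split_bound f A M ->
    0 <= A -> 0 <= M -> 0 < tau -> A <= kappa * tau ->
    (mu [set x | (tau < Normc.normc (lp_piece phi k (pairing f) x))%R] <=
      (B * (M / (2 ^ k * tau)))%:E)%E].
Proof.
have [rR rI] := rapid_ker phiP.
have [zR zI] := Rintegral_ker phiP.
have [C1 C10 H1] := dilate_conv_bound rR zR.
have [C2 C20 H2] := dilate_conv_bound rI zI.
pose Q := C1 + C2.
have Q0 : 0 <= Q by rewrite addr_ge0.
have D0 : 0 < 4 * Q + 1 by rewrite ltr_pwDr// mulr_ge0.
(* Real and imaginary parts of f against those of the kernel give four bounded terms of total 2 Q A,
   which A <= kappa tau makes at most tau / 2; the summand 1 keeps kappa positive even if Q = 0. The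
   second constant is 2 / tau from Chebyshev times 2 Q M / r. *)
exists (4 * Q + 1)^-1, (4 * Q); split; [by rewrite invr_gt0|by rewrite mulr_ge0|].
move=> f k A M tau mf sf A0 M0 tau0 Atau.
have [wr wi] := split_bound_wt_integrable mf sf.
have [ar [ai [Tr Ti Er Ei]]] := sf.
have cc := low_cutoff_cutoff phiP.
have war : wt_integrable ar by split; [case: Tr => -[]|exact: integrable_translation_bound cc Tr].
have wai : wt_integrable ai by split; [case: Ti => -[]|exact: integrable_translation_bound cc Ti].
set r : R := 2 ^ k.
have r0 : 0 < r by rewrite exprz_gt0.
have r0' : r != 0 by rewrite gt_eqF.
have [g1 [m1 p1 i1 b1]] := H1 r A M _ _ r0 A0 M0 wr war Tr Er.
have [g2 [m2 p2 i2 b2]] := H2 r A M _ _ r0 A0 M0 wr war Tr Er.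
have [g3 [m3 p3 i3 b3]] := H1 r A M _ _ r0 A0 M0 wi wai Ti Ei.
have [g4 [m4 p4 i4 b4]] := H2 r A M _ _ r0 A0 M0 wi wai Ti Ei.
pose G x := ((g1 x + g2 x) + (g3 x + g4 x))%E.
have mG : measurable_fun setT G by do !apply: emeasurable_funD.
have G0 x : (0 <= G x)%E by rewrite !adde_ge0.
have iG : (\int[mu]_x G x <= (2 * Q * M / r)%:E)%E.
  rewrite /G ge0_integralD//; last 4 first.
  - by move=> x _; rewrite adde_ge0.
  - exact: emeasurable_funD.
  - by move=> x _; rewrite adde_ge0.
  - exact: emeasurable_funD.
  rewrite !ge0_integralD//.
  apply: (le_trans (leeD (leeD i1 i2) (leeD i3 i4))).
  by rewrite -!EFinD lee_fin le_eqVlt; apply/orP; left; apply/eqP; rewrite /Q; field.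
have rdR := rapid_dilate r0' rR.
have rdI := rapid_dilate r0' rI.
pose cv (h K : V -> R) (x : V) := \int[mu]_y (h y * dilate K r (x - y)).
pose fr x := complex.Re (f x). pose fi x := complex.Im (f x).
have ii (h K : V -> R) (x : V) : wt_integrable h -> rapid (dilate K r) ->
    mu.-integrable setT (EFin \o (fun y => h y * dilate K r (x - y))).
  by move=> hw rK; apply: wt_integrable_rapid => //; exact: rapid_sub.
have pE x : lp_piece phi k (pairing f) x =
  (cv fr (ker_Re phi) x - cv fi (ker_Im phi) x) +i*
  (cv fr (ker_Im phi) x + cv fi (ker_Re phi) x).
  rewrite /lp_piece; apply: pairing_normc; try exact: ii.
  - by move=> y; rewrite /fr /fi; case: (f y).
  - by move=> y; rewrite (lp_kernelE phiP).
set E := [set x | _].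
have mE : measurable E.
  have mc (h K : V -> R) : wt_integrable h -> rapid (dilate K r) -> measurable_fun setT (cv h K).
    by move=> hw rK; exact: measurable_conv.
  have mn : measurable_fun setT (fun x => Normc.normc (lp_piece phi k (pairing f) x)).
    rewrite (_ : (fun _ => _) = fun x : V => Num.sqrt
      ((cv fr (ker_Re phi) x - cv fi (ker_Im phi) x) ^+ 2 +
       (cv fr (ker_Im phi) x + cv fi (ker_Re phi) x) ^+ 2)); last first.
      by apply/funext => x; rewrite pE.
    apply: (measurableT_comp (continuous_measurable_fun (@sqrt_continuous R))).
    by apply: measurable_funD; apply: measurable_funX;
      [apply: measurable_funB|apply: measurable_funD]; exact: mc.
  rewrite -[E]setTI (_ : E = (fun x => Normc.normc (lp_piece phi k (pairing f) x)) @^-1` `]tau, +oo[%classic).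
    exact: mn.
  by apply/seteqP; split => x /=; rewrite in_itv/= andbT.
have t20 : 0 < tau / 2 by rewrite divr_gt0.
pose D := [set x | (tau / 2)%:E <= G x]%E.
have mD : measurable D by exact: measurable_ereal_ge.
have norm4 (u1 u2 u3 u4 : R) :
    `|u1 - u4| + `|u2 + u3| <= `|u1| + `|u2| + (`|u3| + `|u4|).
  have := ler_normB u1 u4; have := ler_normD u2 u3; lra.
(* Where the piece exceeds tau, the bounded terms account for at most tau / 2, so G accounts for the
   rest. *)
have ED : E `<=` D.
  move=> x; rewrite /E /mkset pE => xt; rewrite /D/=.
  have le4 : (tau%:E <= (2 * Q * A)%:E + G x)%E.
    apply: (@le_trans _ _ (`|cv fr (ker_Re phi) x|%:E + `|cv fr (ker_Im phi) x|%:E +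
      (`|cv fi (ker_Re phi) x|%:E + `|cv fi (ker_Im phi) x|%:E))%E).
      by rewrite -!EFinD lee_fin (le_trans (ltW xt))// (le_trans (normc_le _ _)).
    apply: (le_trans (leeD (leeD (b1 x) (b2 x)) (leeD (b3 x) (b4 x)))).
    rewrite /G [X in (X + _ <= _)%E]addeACA [X in (_ + X <= _)%E]addeACA addeACA -!EFinD.
    by apply: leeD => //; rewrite lee_fin /Q; lra.
  rewrite -(@leeD2lE _ (2 * Q * A)%:E)//; apply: le_trans le4.
  rewrite -EFinD lee_fin.
  have : 2 * Q * A <= tau / 2; last by lra.
  have := Atau; rewrite ler_pdivlMl// => At.
  by nra.
have := ge0_markov mG G0 (ltW t20); rewrite -/D => mk.
have muD : (mu D <= (2 / tau)%:E * (2 * Q * M / r)%:E)%E.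
  rewrite -[X in (X <= _)%E]mul1e (_ : 1%E = ((2 / tau) * (tau / 2))%:E); last first.
    by congr EFin; field; rewrite gt_eqF.
  rewrite EFinM -muleA; apply: lee_wpmul2l; first by rewrite lee_fin divr_ge0// ltW.
  exact: le_trans mk iG.
apply: (le_trans (le_measure _ _ _ ED)); rewrite ?inE//.
apply: (le_trans muD); rewrite -EFinM lee_fin le_eqVlt; apply/orP; left; apply/eqP.
by field; rewrite r0' gt_eqF.
Qed.

End level_sets.

(** * From the norms of the two spaces to bounds on the parts of f *)

Section function_spaces.
Context {R : realType} {d : nat}.
Local Notation C := R[i].
Local Notation V := 'rV[R]_d.
Local Notation mu := (lebesgue_rV d).

Lemma Re_le_normc (z : C) : `|complex.Re z| <= Normc.normc z.
Proof.
by case: z => a b /=; rewrite -sqrtr_sqr ler_wsqrtr// lerDl sqr_ge0.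
Qed.

Lemma Im_le_normc (z : C) : `|complex.Im z| <= Normc.normc z.
Proof.
by case: z => a b /=; rewrite -sqrtr_sqr ler_wsqrtr// lerDr sqr_ge0.
Qed.

(** The norm of exponent +oo unfolds to the essential supremum when the whole space has positive
    measure. *)
Lemma lebesgue_setT_gt0 : (0 < mu [set: V])%E.
Proof.
apply: (lt_le_trans (lebesgue_ball_gt0 ltr01)).
by apply: le_measure; rewrite ?inE//; exact: measurable_norm_le.
Qed.

Lemma Vinfty_norm_ge0 (f : V -> C) : (0 <= Vinfty_norm f)%E.
Proof. by apply: le_ereal_inf_tmp => _ [c _ <-]; exact: Lnorm_ge0. Qed.

Lemma Vinfty_norm_lt (f : V -> C) (A : R) : (Vinfty_norm f < A%:E)%E ->
  exists c, {ae mu, forall x, Normc.normc (f x - c) <= A}.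
Proof.
move=> /ereal_inf_lt[_ [c _ <-] cA]; exists c.
move: cA; rewrite unlock lebesgue_setT_gt0 => /ltW /ess_supP.
by apply: filterS => x /=; rewrite lee_fin; apply: le_trans; exact: ler_norm.
Qed.

Lemma vmeasure_variation_ge0 (nu : @vmeasure R d) : (0 <= vmeasure_variation nu)%E.
Proof.
pose F (k : nat) : set V := if k is 0%N then setT else set0.
apply: (@le_trans _ _ (\sum_(0 <= k <oo) (vmeasure_norm nu (F k))%:E)%E).
  by apply: nneseries_ge0 => k _ _; rewrite lee_fin sqrtr_ge0.
apply: ereal_sup_ubound => /=; exists F; split => //.
- by case=> [|k]; [exact: measurableT|exact: measurable0].
- by apply/trivIsetP => -[|i] [|j] _ _ //=; rewrite ?setI0 ?set0I.
- by apply/seteqP; split => // x _; exists 0%N.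
Qed.

Lemma BVdot_norm_ge0 (f : V -> C) : (0 <= BVdot_norm f)%E.
Proof. by apply: le_ereal_inf_tmp => _ [nu _ <-]; exact: vmeasure_variation_ge0. Qed.

(** Meant for a Hahn decomposition of one component of nu, where |nu P| + |nu N| is the total
    variation of that component. *)
Lemma variation_ge_pair (nu : @vmeasure R d) (P N : set V) :
  measurable P -> measurable N -> P `|` N = setT -> P `&` N = set0 ->
  ((vmeasure_norm nu P + vmeasure_norm nu N)%:E <= vmeasure_variation nu)%E.
Proof.
move=> mP mN PN PIN.
pose F (k : nat) : set V := if k is 0%N then P else if k is 1%N then N else set0.
apply: (@le_trans _ _ (\sum_(0 <= k <oo) (vmeasure_norm nu (F k))%:E)%E).
  have -> : (vmeasure_norm nu P + vmeasure_norm nu N)%:E =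
      (\sum_(0 <= k < 2) (vmeasure_norm nu (F k))%:E)%E.
    by rewrite big_nat_recr//= big_nat1.
  by apply: nneseries_lim_ge => k _ _; rewrite lee_fin sqrtr_ge0.
apply: ereal_sup_ubound => /=; exists F; split => //.
- by case=> [|[|k]] //; exact: measurable0.
- apply/trivIsetP => -[|[|j]] [|[|k]] _ _ //=; rewrite ?setI0 ?set0I//.
  by rewrite setIC.
- apply/seteqP; split => // x _; have : (P `|` N) x by rewrite PN.
  by case=> Hx; [exists 0%N|exists 1%N].
Qed.

Lemma vmeasure_norm_ge (nu : @vmeasure R d) i A :
  `|fine ((nu i).1 A)| <= vmeasure_norm nu A /\ `|fine ((nu i).2 A)| <= vmeasure_norm nu A.
Proof.
split; rewrite -sqrtr_sqr ler_wsqrtr// (bigD1 i)//=.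
  rewrite -addrA lerDl addr_ge0 ?sqr_ge0// sumr_ge0// => j _.
  by rewrite addr_ge0 ?sqr_ge0.
rewrite addrAC lerDr addr_ge0 ?sqr_ge0// sumr_ge0// => j _.
by rewrite addr_ge0 ?sqr_ge0.
Qed.

Lemma finite_measure_Rintegral_le (m : {finite_measure set V -> \bar R}) (u : V -> R) (C0 : R) :
  measurable_fun setT u -> (forall x, `|u x| <= C0) ->
  `|\int[m]_x u x| <= C0 * fine (m setT).
Proof.
move=> mu' uC.
have C00 : 0 <= C0 by rewrite (le_trans _ (uC 0)).
have mf : (m setT \is a fin_num)%E by exact: fin_num_measure.
have ci : m.-integrable setT (cst C0%:E).
  by apply/integrableP; split => //; rewrite integral_cst// lte_mul_pinfty// ltey_eq mf.
have ui : m.-integrable setT (EFin \o u).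
  apply: le_integrable ci => //; first exact/measurable_EFinP.
  by move=> x _ /=; rewrite lee_fin (ger0_norm C00).
rewrite (le_trans (le_normr_Rintegral _ ui))//.
rewrite (_ : C0 * _ = \int[m]_x C0); last first.
  by rewrite /Rintegral integral_cst// fineM.
by apply: le_Rintegral => //; exact: (integrable_abse ui).
Qed.

(** P and N are the Hahn sets chosen in [charge_integral]; the Jordan parts have masses nu P and -
    nu N. *)
Lemma charge_integral_le (nu : {charge set V -> \bar R}) (u : V -> R) (C0 : R) :
  measurable_fun setT u -> (forall x, `|u x| <= C0) ->
  exists P N, [/\ measurable P, measurable N, P `|` N = setT, P `&` N = set0 &
  `|charge_integral nu u| <= C0 * (`|fine (nu P)| + `|fine (nu N)|)].
Proof.
move=> mu' uC; rewrite /charge_integral.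
set HP := cid _; set HN := cid _; set H := projT2 HN.
have [[mP posP] [mN negN] PN PIN] := H.
exists (projT1 HP), (projT1 HN); split => //.
have EP : jordan_pos H setT = nu (projT1 HP).
  by rewrite jordan_posE cjordan_posE /crestr0 mem_set// /crestr setTI.
have EN : jordan_neg H setT = (- nu (projT1 HN))%E.
  by rewrite jordan_negE cjordan_negE /crestr0 mem_set// /crestr setTI.
have C00 : 0 <= C0 by rewrite (le_trans _ (uC 0)).
rewrite (le_trans (ler_normB _ _))// mulrDr; apply: lerD.
  rewrite (le_trans (finite_measure_Rintegral_le _ mu' uC))// ler_wpM2l// -EP.
  exact: ler_norm.
rewrite (le_trans (finite_measure_Rintegral_le _ mu' uC))// ler_wpM2l//.
by rewrite -normrN -fineN -EN; exact: ler_norm.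
Qed.

Lemma charge_integral0 (nu : {charge set V -> \bar R}) : charge_integral nu (fun=> 0) = 0.
Proof.
apply/eqP; rewrite -normr_le0.
have [|P [N [_ _ _ _]]] := @charge_integral_le nu (fun=> 0) 0 (measurable_cst _).
  by move=> x; rewrite normr0.
by rewrite mul0r.
Qed.

Lemma charge_integral_variation (nu : @vmeasure R d) i (u : V -> R) (C0 Y : R) :
  measurable_fun setT u -> (forall x, `|u x| <= C0) -> (vmeasure_variation nu < Y%:E)%E ->
  `|charge_integral (nu i).1 u| <= Y * C0 /\ `|charge_integral (nu i).2 u| <= Y * C0.
Proof.
move=> mu' uC nuY; have C00 : 0 <= C0 by rewrite (le_trans _ (uC 0)).
split.
  have [P [N [mP mN PN PIN H]]] := charge_integral_le (nu i).1 mu' uC.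
  rewrite (le_trans H)// mulrC ler_wpM2r//.
  rewrite (le_trans (lerD (vmeasure_norm_ge nu i P).1 (vmeasure_norm_ge nu i N).1))//.
  by rewrite -lee_fin (le_trans (variation_ge_pair nu mP mN PN PIN))// ltW.
have [P [N [mP mN PN PIN H]]] := charge_integral_le (nu i).2 mu' uC.
rewrite (le_trans H)// mulrC ler_wpM2r//.
rewrite (le_trans (lerD (vmeasure_norm_ge nu i P).2 (vmeasure_norm_ge nu i N).2))//.
by rewrite -lee_fin (le_trans (variation_ge_pair nu mP mN PN PIN))// ltW.
Qed.

Lemma loc_integrable_compact (a : V -> R) : measurable_fun setT a ->
  (forall K : set V, compact K -> mu.-integrable K (EFin \o a)) -> loc_integrable a.
Proof.
move=> ma aK; split => // u bu; have [su [r ur]] := bu.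
have [C0 C00 uC] := btest_bounded bu.
pose K := [set x : V | `|x| <= r].
have mK : measurable K by exact: measurable_norm_le.
have ai := aK K (@closed_ball0_compact R d r).
have : mu.-integrable setT (EFin \o (fun x => C0 * (a \_ K) x)).
  apply: integrable_scaler; move/(integrable_mkcond _ mK): ai.
  by apply: eq_integrable => // x _; rewrite /= restrict_EFin.
move=> Ki; apply: (integrable_le (g := fun x => `|C0 * (a \_ K) x|)).
- by apply: measurable_funM => //; exact: smooth_measurable.
- move=> x; rewrite !normrM (ger0_norm C00) patchE.
  case: ifPn => [_|]; first by rewrite mulrC ler_wpM2r.
  rewrite notin_setE /K /= => /negP; rewrite -ltNge => /ltW /ur ->.
  by rewrite normr0 !mulr0.
- exact: integrable_normr.
Qed.

(** Testing with a real u separates the two components of each complex measure: one governs the real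
    part of f, the other the imaginary part. *)
Lemma BVdot_bound (f : V -> C) (Y : R) : BVdot f -> (BVdot_norm f < Y%:E)%E ->
  BV_bound (fun x => complex.Re (f x)) Y /\ BV_bound (fun x => complex.Im (f x)) Y.
Proof.
move=> [[[mr mi] floc] _] /ereal_inf_lt[_ [nu fnu <-] nuY].
have lr : loc_integrable (fun x => complex.Re (f x)).
  by apply: loc_integrable_compact => // K cK; case: (floc K cK).
have li : loc_integrable (fun x => complex.Im (f x)).
  by apply: loc_integrable_compact => // K cK; case: (floc K cK).
have key i u : btest u ->
    cintegral (fun x => f x * cpderiv [:: i] (fun y => (u y)%:C) x) =
    (\int[mu]_x (complex.Re (f x) * partial i u x)) +i*
    (\int[mu]_x (complex.Im (f x) * partial i u x)).
  move=> bu; rewrite /cintegral; congr (_ +i* _); apply: eq_Rintegral => x _.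
    rewrite /cpderiv /= (_ : 'D_(delta_mx ord0 i) (fun=> 0) x = 0); last by rewrite derive_cst.
    by case: (f x) => a b /=; rewrite mulr0 subr0.
  rewrite /cpderiv /= (_ : 'D_(delta_mx ord0 i) (fun=> 0) x = 0); last by rewrite derive_cst.
  by case: (f x) => a b /=; rewrite mulr0 add0r.
have key2 i u : btest u -> cmeasure_integral (nu i) (fun y => (u y)%:C) =
    charge_integral (nu i).1 u +i* charge_integral (nu i).2 u.
  move=> bu; rewrite /cmeasure_integral /=.
  by rewrite !charge_integral0 subr0 add0r.
split; split => // i u C0 bu uC; have := fnu i _ (btest_test bu); rewrite key// key2//.
  move=> [-> _]; rewrite normrN.
  by have [] := charge_integral_variation i (smooth_measurable bu.1) uC nuY.
move=> [_ ->]; rewrite normrN.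
by have [] := charge_integral_variation i (smooth_measurable bu.1) uC nuY.
Qed.

Definition K_VBV (t : R) (f : V -> C) : \bar R :=
  K_functional eq_mod_const Vinfty BVdot Vinfty_norm BVdot_norm t f.

(** A competitor in the infimum that defines K has both its terms below X, so f0 has norm below X
    and f1 has norm below X / t. *)
Lemma K_split_bound (chi : V -> R) : cutoff chi -> exists2 B : R, 0 < B &
  forall (f : V -> C) (t X : R), 0 < t -> (K_VBV t f < X%:E)%E ->
    split_bound f X (B * (X / t)).
Proof.
move=> /BV_translation_bound[B B0 HB]; exists B => // f t X t0.
move=> /ereal_inf_lt[_ [f0 [f1 [Vf0 Bf1 [c fE] ->]]] KX].
have N0 := Vinfty_norm_ge0 f0; have N1 := BVdot_norm_ge0 f1.
have f0X : (Vinfty_norm f0 < X%:E)%E.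
  by apply: le_lt_trans KX; rewrite leeDl// mule_ge0// lee_fin ltW.
have f1X : (BVdot_norm f1 < (X / t)%:E)%E.
  rewrite mulrC EFinM lte_pdivlMl//.
  by apply: le_lt_trans KX; rewrite leeDr.
have Xt0 : 0 <= X / t by rewrite -lee_fin (le_trans N1)// ltW.
have [c' f0c] := Vinfty_norm_lt f0X.
have [Br Bi] := BVdot_bound Bf1 f1X.
(* The constant c comes from equality modulo constants, and c' is a constant that f0 stays within X
   of. Both are added to f1, whose bound on translates is unaffected. *)
exists (fun x => complex.Re (f1 x) + complex.Re (c + c')).
exists (fun x => complex.Im (f1 x) + complex.Im (c + c')).
have dE x : f x = (f0 + f1) x + c -> f x - f1 x - (c + c') = f0 x - c'.
  by move=> ->; rewrite -[(f0 + f1) x]/(f0 x + f1 x); ring.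
split.
- by apply: translation_boundD_cst; exact: HB.
- by apply: translation_boundD_cst; exact: HB.
- apply: filterS2 fE f0c => x /dE <- H; rewrite (le_trans _ H)//.
  rewrite (le_trans _ (Re_le_normc _))//.
  by case: (f x) (f1 x) (c + c') => a b [a' b'] [a'' b''] /=; rewrite opprD addrA.
- apply: filterS2 fE f0c => x /dE <- H; rewrite (le_trans _ H)//.
  rewrite (le_trans _ (Im_le_normc _))//.
  by case: (f x) (f1 x) (c + c') => a b [a' b'] [a'' b''] /=; rewrite opprD addrA.
Qed.

End function_spaces.

(** * Sums over dyadic scales *)

Section dyadic_sums.
Context {R : realType}.
Implicit Types (s : seq int) (k j : int).

Let two_gt0 (x : R) : 0 < 2 `^ x. Proof. by rewrite powR_gt0. Qed.
Let two_D (x y : R) : 2 `^ (x + y) = 2 `^ x * 2 `^ y :> R.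
Proof. by rewrite powRD// pnatr_eq0 implybT. Qed.

(* A separated family decays geometrically once it is sorted. *)
Lemma separated_sum_le (a : int -> R) (q X : R) s : 0 <= q < 1 -> 0 <= X ->
  (forall k, 0 <= a k) ->
  (forall k j, k != j -> a j <= a k -> a j <= q * a k) ->
  uniq s -> all (fun k => a k <= X) s ->
  \sum_(k <- s) a k <= X / (1 - q).
Proof.
move=> /andP[q0 q1] X0 a0 aq us sX.
have q1' : 0 < 1 - q by rewrite subr_gt0.
pose e := [rel k j | a j <= a k].
have etot : total e by move=> k j; exact: le_total.
have st := sort_sorted etot s.
have ps : perm_eq (sort e s) s by rewrite perm_sort.
rewrite -(perm_big _ ps) /=; move: st; rewrite -(perm_uniq ps) in us.
rewrite -(perm_all _ ps) in sX; move: us sX; case: (sort e s) => [|k t].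
  by rewrite big_nil => _ _ _; rewrite divr_ge0// ltW.
move=> ukt /= /andP[kX _] pkt.
have : \sum_(i <- k :: t) a i <= a k / (1 - q).
  elim: t k {kX} ukt pkt => [|j t IH] k.
    by rewrite big_seq1 => _ _; rewrite ler_pdivlMr// ler_piMr// gerBl.
  move=> /= /andP[]; rewrite inE negb_or => /andP[kj kt] ujt /andP[akj pjt].
  rewrite big_cons.
  have := IH j ujt pjt; have := aq _ _ kj akj.
  move=> ajk S; rewrite (le_trans (lerD (lexx _) S))//.
  rewrite ler_pdivlMr// mulrDl divfK ?gt_eqF//.
  by lra.
move=> /le_trans; apply.
by rewrite ler_wpM2r// invr_ge0 ltW.
Qed.

(** Distinct integers differ by at least 1, so the exponents differ by at least |g|. *)
Lemma geometric_separated (g : R) k j : k != j ->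
  2 `^ (- (j%:~R * g)) <= 2 `^ (- (k%:~R * g)) :> R ->
  2 `^ (- (j%:~R * g)) <= 2 `^ (- `|g|) * 2 `^ (- (k%:~R * g)) :> R.
Proof.
move=> kj le1; rewrite -two_D ler_powR ?ler1n//.
have {le1} H : k%:~R * g <= j%:~R * g.
  rewrite leNgt; apply/negP => lt1; move: le1; rewrite leNgt => /negP; apply.
  by rewrite /powR pnatr_eq0/= ltr_expR ltr_pM2r ?ln_gt0 ?ltr1n// ltrN2.
have : `|j%:~R * g - k%:~R * g| >= `|g|.
  rewrite -mulrBl normrM ler_peMl// -intrB -intr_norm ler1z.
  by rewrite -gtz0_ge1 normr_gt0 subr_eq0 eq_sym.
rewrite (ger0_norm (_ : 0 <= j%:~R * g - _)) ?subr_ge0//.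
by lra.
Qed.

(** The inclusion of l^1 in l^p: every b j is at most S, hence its p-th power is at most S^(p-1) b
    j. *)
Lemma sum_powR_le (b : int -> R) (p S : R) s : 1 < p -> (forall j, 0 <= b j) ->
  \sum_(j <- s) b j <= S -> \sum_(j <- s) b j `^ p <= S `^ p.
Proof.
move=> p1 b0 bS; have p0 : 0 < p by rewrite (lt_trans _ p1).
have S0 : 0 <= S by rewrite (le_trans _ bS)// sumr_ge0.
have bjS j : j \in s -> b j <= S.
  move=> js; rewrite (le_trans _ bS)// (big_rem j)//= lerDl.
  by rewrite sumr_ge0.
rewrite -(mulr_powRB1 S0 p0) (le_trans _ (ler_wpM2r (powR_ge0 _ _) bS))//.
rewrite mulr_suml big_seq [leRHS]big_seq; apply: ler_sum => j js.
rewrite -(mulr_powRB1 (b0 j) p0) ler_wpM2l// ge0_ler_powR ?nnegrE ?bjS//.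
by rewrite subr_ge0 ltW.
Qed.

Lemma nat_powR_large (y : R) : exists n : nat, y < 2 `^ n%:R.
Proof.
exists (Num.truncn `|y|).+1; rewrite powR_mulrn// (le_lt_trans (ler_norm _))//.
rewrite (lt_le_trans (truncnS_gt _))// -natrX ler_nat ltnW// ltn_expl//.
Qed.

(** Kf j is at most S 2^(j/p), which tends to 0 as j tends to minus infinity. *)
Lemma dyadic_small (Kf : int -> R) (X : R) (p S : R) : 1 < p ->
  (forall j, 2 `^ (- (j%:~R / p)) * Kf j <= S) -> 0 < X -> exists j, Kf j < X.
Proof.
move=> p1 KS X0; have p0 : 0 < p by rewrite (lt_trans _ p1).
have [n nS] := nat_powR_large (S / X).
exists (- (Num.truncn (n%:R * p)).+1%:Z); set N := (Num.truncn _).+1.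
have := KS (- N%:Z); rewrite mulrNz mulNr opprK => KN.
have nN : 2 `^ n%:R <= 2 `^ (N%:~R / p) :> R.
  rewrite ler_powR ?ler1n// ler_pdivlMr// ltW// /N -[X in _ < X]/(_.+1%:R).
  exact: truncnS_gt.
rewrite ltNge; apply/negP => XK.
have : S < X * 2 `^ (N%:~R / p).
  rewrite -ltr_pdivrMl// mulrC (lt_le_trans nS)//.
rewrite ltNge => /negP; apply; apply: le_trans KN.
by rewrite mulrC ler_wpM2l// ltW.
Qed.

(** Start at an index where Kf j < X and take the first later one where this fails; the bound on m
    still holds one step before, whence the factor 2. If it never failed, m would be at most beta
    2^-j for arbitrarily large j and could not be positive. *)
Lemma dyadic_threshold (Kf : int -> R) (X m beta : R) (p S : R) : 1 < p ->
  (forall j, 2 `^ (- (j%:~R / p)) * Kf j <= S) ->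
  0 < X -> 0 < m -> 0 <= beta ->
  (forall j, Kf j < X -> m <= beta * 2 `^ (- j%:~R)) ->
  exists2 j, X <= Kf j & m <= 2 * beta * 2 `^ (- j%:~R).
Proof.
move=> p1 KS X0 m0 beta0 H.
have [j0 j0X] := dyadic_small p1 KS X0.
have [n nX] : exists n : nat, ~~ (Kf (j0 + n%:Z) < X).
  apply: contrapT => /forallNP nX.
  have {}nX n : Kf (j0 + n%:Z) < X by apply/negPn/negP; exact: nX.
  have [n nm] := nat_powR_large (beta * 2 `^ (- j0%:~R) / m).
  have := H _ (nX n); rewrite intrD opprD two_D mulrA [2 `^ (- (n%:Z)%:~R)]powRN.
  rewrite ler_pdivlMr// leNgt => /negP; apply.
  by rewrite -ltr_pdivrMl// mulrC.
have exn : exists n : nat, ~~ (Kf (j0 + n%:Z) < X) by exists n.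
case: (ex_minnP exn) => -[|i]; first by rewrite addr0 j0X.
move=> iX imin; exists (j0 + i.+1%:Z); first by rewrite leNgt.
have : Kf (j0 + i%:Z) < X by apply/negPn/negP => /imin; rewrite ltnn.
move=> /H /le_trans; apply.
rewrite (_ : j0 + i.+1%:Z = (j0 + i%:Z) + 1); last by rewrite -addrA -PoszD addn1.
set w := j0 + _; rewrite intrD opprD two_D powR_inv1//.
by set t := 2 `^ _; rewrite (_ : 2 * beta * _ = beta * t)//; field.
Qed.

(** To be applied with g = gamma + 1 and m k the measure of the level set at frequency k. The index
    [J k] obtained from [dyadic_threshold] plays the role of t_k. *)
Lemma dyadic_sum_bound (g p : R) : g != 0 -> 1 < p ->
  exists2 C : R, 0 <= C & forall (Kf m : int -> R) (lam kappa beta S : R) s,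
  (forall j, 0 <= Kf j) -> (forall k, 0 <= m k) ->
  (forall s', uniq s' -> \sum_(j <- s') 2 `^ (- (j%:~R / p)) * Kf j <= S) ->
  0 < lam -> 0 < kappa -> 0 <= beta ->
  (forall k j, Kf j < kappa * (lam * 2 `^ (- (k%:~R * g / p))) ->
    m k <= beta * 2 `^ (- k%:~R) * 2 `^ (- j%:~R)) ->
  uniq s ->
  \sum_(k <- s) 2 `^ (- (k%:~R * (g - 1))) * m k <= C * beta * (S / (kappa * lam)) `^ p.
Proof.
move=> g0 p1; have p0 : 0 < p by rewrite (lt_trans _ p1).
pose q : R := 2 `^ (- `|g|).
have q01 : 0 <= q < 1.
  rewrite powR_ge0/= /q /powR pnatr_eq0/= expR_lt1 nmulr_rlt0 ?ln_gt0 ?ltr1n//.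
  by rewrite oppr_lt0 normr_gt0.
have q1' : 0 < 1 - q by rewrite subr_gt0; case/andP: q01.
exists (2 / (1 - q)); first by rewrite divr_ge0// ltW.
move=> Kf m lam kappa beta S s K0 m0 KS lam0 kappa0 beta0 Hm us.
have kl0 : 0 < kappa * lam by rewrite mulr_gt0.
pose a k : R := 2 `^ (- (k%:~R * g)).
pose tau k : R := kappa * (lam * 2 `^ (- (k%:~R * g / p))).
have tau0 k : 0 < tau k by rewrite !mulr_gt0.
have KS1 j : 2 `^ (- (j%:~R / p)) * Kf j <= S.
  by have := KS [:: j] isT; rewrite big_seq1.
(* Indices with m k = 0 contribute nothing: they get the dummy value 0 and are filtered out in
   s1. *)
have /choice[J HJ] : forall k, exists j, 0 < m k ->
    tau k <= Kf j /\ m k <= 2 * (beta * 2 `^ (- k%:~R)) * 2 `^ (- j%:~R).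
  move=> k; have [mk|mk] := ltP 0 (m k); last by exists 0.
  have [||j jX jm] := @dyadic_threshold Kf (tau k) (m k) (beta * 2 `^ (- k%:~R)) p S p1 KS1 (tau0 k) mk.
  - by rewrite mulr_ge0// ltW.
  - by move=> j; exact: Hm.
  by exists j.
pose s1 := [seq k <- s | 0 < m k].
have us1 : uniq s1 by rewrite filter_uniq.
have m1 k : k \in s1 -> 0 < m k by rewrite mem_filter => /andP[].
pose G := undup (map J s1).
have uG : uniq G := undup_uniq _.
(* The factor 2^-k in the bound on m k turns the weight 2^(-k (g - 1)) into a k = 2^(-k g). *)
have step1 : \sum_(k <- s) 2 `^ (- (k%:~R * (g - 1))) * m k <=
    \sum_(k <- s1) 2 * beta * (a k * 2 `^ (- (J k)%:~R)).
  rewrite (bigID (fun k => 0 < m k)) /= [X in _ + X]big1 ?addr0; last first.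
    by move=> k; rewrite -leNgt => mk; rewrite (_ : m k = 0) ?mulr0//; apply/le_anti; rewrite mk m0.
  rewrite -big_filter big_seq [leRHS]big_seq; apply: ler_sum => k ks.
  have [_ mk] := HJ k (m1 _ ks).
  rewrite (le_trans (ler_wpM2l (powR_ge0 _ _) mk))// mulrBr mulr1 opprB two_D /a [2 `^ (- k%:~R)]powRN.
  set t := 2 `^ k%:~R; have t0 : t != 0 by rewrite gt_eqF ?two_gt0.
  by rewrite le_eqVlt; apply/orP; left; apply/eqP; field.
have step2 : \sum_(k <- s1) a k * 2 `^ (- (J k)%:~R) =
    \sum_(j <- G) (2 `^ (- j%:~R) * \sum_(k <- s1 | J k == j) a k).
  under [RHS]eq_bigr do rewrite mulr_sumr big_mkcond.
  rewrite exchange_big/= big_seq [RHS]big_seq; apply: eq_bigr => k ks.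
  have kG : J k \in G by rewrite mem_undup map_f.
  rewrite (bigD1_seq (J k))//= eqxx big1 ?addr0; first by rewrite mulrC.
  by move=> j jk; rewrite eq_sym (negPf jk).
(* For J k = j, the inequality tau k <= Kf j says that a k is at most (Kf j / (kappa lam))^p. The a
   k are a separated family, so their sum is governed by this bound on the largest. *)
have inner j : \sum_(k <- s1 | J k == j) a k <= (Kf j / (kappa * lam)) `^ p / (1 - q).
  rewrite -big_filter; apply: (separated_sum_le q01).
  - exact: powR_ge0.
  - by move=> k; exact: powR_ge0.
  - by move=> k i; exact: geometric_separated.
  - by rewrite filter_uniq.
  - apply/allP => k; rewrite mem_filter => /andP[/eqP <- /m1 mk].
    have [tK _] := HJ k mk.
    rewrite (_ : a k = (2 `^ (- (k%:~R * g / p))) `^ p).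
      apply: ge0_ler_powR; rewrite ?nnegrE ?powR_ge0 ?divr_ge0 ?(ltW kl0) ?(ltW p0)//.
      by rewrite ler_pdivlMr// mulrC; move: tK; rewrite /tau mulrA.
    by rewrite -powRrM mulNr divfK// gt_eqF.
have KS2 : \sum_(j <- G) (2 `^ (- (j%:~R / p)) * (Kf j)) `^ p <= S `^ p.
  apply: sum_powR_le => //; last exact: KS.
  by move=> j; rewrite mulr_ge0// ltW.
have S0 : 0 <= S by rewrite (le_trans _ (KS1 0))// mulr_ge0// ltW.
rewrite (le_trans step1)// -mulr_sumr step2.
rewrite [leRHS](_ : _ = 2 * beta * ((S / (kappa * lam)) `^ p / (1 - q))); last by field; rewrite gt_eqF.
rewrite ler_wpM2l ?mulr_ge0//.
rewrite (le_trans (ler_sum _ (fun j _ => ler_wpM2l (ltW (two_gt0 _)) (inner j))))//.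
under eq_bigr do rewrite mulrA.
rewrite -mulr_suml ler_wpM2r ?invr_ge0 ?(ltW q1')//.
have Kl0 : 0 <= (kappa * lam)^-1 by rewrite invr_ge0 ltW.
rewrite powRM// (le_trans _ (ler_wpM2r (powR_ge0 _ _) KS2))// mulr_suml.
apply: ler_sum => j _; rewrite powRM// mulrA ler_wpM2r ?powR_ge0//.
rewrite powRM ?(ltW (two_gt0 _))// -powRrM mulNr divfK ?gt_eqF//.
Qed.

End dyadic_sums.

(** * The interpolation norm bounds a dyadic sum *)

Section interpolation_sum.
Context {R : realType}.
Local Open Scope ereal_scope.
Local Notation leb := (@lebesgue_measure R).

(* The integral of a nonnegative function is a supremum over simple functions,
   so f, for us the integrand of the K-method, need not be measurable. *)
Lemma ge0_le_integral_minorant (D : set R) (g f : R -> \bar R) :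
  (forall t, D t -> 0 <= g t) -> (forall t, D t -> g t <= f t) ->
  \int[leb]_(t in D) g t <= \int[leb]_(t in D) f t.
Proof.
move=> g0 gf.
have f0 t : D t -> 0 <= f t by move=> Dt; exact: le_trans (g0 _ Dt) (gf _ Dt).
rewrite (ge0_integralE leb g0) (ge0_integralE leb f0).
apply: le_ereal_sup => _ [h hg <-]; exists h => // t.
apply: (le_trans (hg t)); rewrite !patchE; case: ifPn => // tD.
by apply: gf; move: tD; rewrite inE.
Qed.

Let two_gt0 (x : R) : (0 < 2 `^ x)%R. Proof. by rewrite powR_gt0. Qed.
Let two_D (x y : R) : (2 `^ (x + y) = 2 `^ x * 2 `^ y :> R)%R.
Proof. by rewrite powRD// pnatr_eq0 implybT. Qed.

(** On [2^j, 2^(j+1)[ the integrand is at least c j, since K increases and the powers of t decrease.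
    The interval has length 2^j, and the loss against the term of the sum is 2^(1 + theta) <= 4. *)
Lemma dyadic_sum_le_integral (K : R -> \bar R) (theta : R) (s : seq int) :
  (0 <= theta <= 1)%R -> (forall t, 0 <= K t) ->
  (forall u t : R, (0 < u)%R -> (u <= t)%R -> K u <= K t) -> uniq s ->
  \sum_(j <- s) (2 `^ (- (j%:~R * theta)))%:E * K (2 `^ j%:~R)%R <=
  4%:E * \int[leb]_(t in `]0%R, +oo[) (((t `^ (- theta))%:E * K t) `^ 1 * (t^-1)%:E).
Proof.
move=> /andP[th0 th1] K0 Kmono us.
pose I (j : int) : set R := `[(2 `^ j%:~R)%R, (2 `^ (j%:~R + 1))%R[%classic.
pose c (j : int) : \bar R := (2 `^ (- ((j%:~R + 1) * theta)) * 2 `^ (- (j%:~R + 1)))%:E * K (2 `^ j%:~R)%R.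
have c0 j : 0 <= c j by rewrite mule_ge0// lee_fin mulr_ge0// ltW.
(* A step function below the integrand, measurable even if the integrand is not. *)
pose g t := \sum_(j <- s) c j * (\1_(I j) t)%:E.
have mI j : measurable (I j) by exact: measurable_itv.
have I0 j : I j `<=` `]0%R, +oo[%classic.
  move=> t; rewrite /I /= !in_itv/= andbT => /andP[jt _].
  by rewrite (lt_le_trans _ jt).
have muI j : leb (I j) = (2 `^ j%:~R)%:E.
  rewrite lebesgue_measure_itv/= lte_fin two_D powRr1//.
  by rewrite ltr_pMr// ltr1n -EFinB; congr EFin; ring.
have gint : \int[leb]_(t in `]0%R, +oo[) g t = \sum_(j <- s) c j * (2 `^ j%:~R)%:E.
  rewrite ge0_integral_sum//.
  - apply: eq_bigr => j _; rewrite ge0_integralZl//.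
    + congr (_ * _); rewrite -muI -[in RHS](setIidl (@I0 j)).
      by rewrite integral_indic //; exact: measurable_itv.
    + by apply/measurable_EFinP; apply: measurable_indic; exact: measurable_itv.
  - move=> j; apply: emeasurable_funM => //.
    by apply/measurable_EFinP; apply: measurable_indic; exact: measurable_itv.
  - by move=> j t _; rewrite mule_ge0.
have Kt (j : int) t : I j t -> c j <= ((t `^ (- theta))%:E * K t) `^ 1 * (t^-1)%:E.
  rewrite /I /= in_itv/= => /andP[jt tj].
  have t0 : (0 < t)%R by rewrite (lt_le_trans _ jt).
  have p0 : (0 <= t `^ (- theta))%R by exact: powR_ge0.
  rewrite poweRe1; last by rewrite mule_ge0.
  rewrite muleAC -EFinM; apply: lee_pmul => //.
  - rewrite lee_fin ler_pM// ?(ltW (two_gt0 _))//.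
    + rewrite -mulrN powRrM !powRN lef_pV2 ?posrE ?powR_gt0//.
      by rewrite ge0_ler_powR ?nnegrE ?(ltW t0) ?(ltW tj)// ltW.
    + by rewrite powRN lef_pV2 ?posrE// ltW.
  - exact: Kmono.
have gf t : `]0%R, +oo[%classic t -> g t <= ((t `^ (- theta))%:E * K t) `^ 1 * (t^-1)%:E.
  move=> /=; rewrite in_itv/= andbT => t0; rewrite /g.
  have [[j js jt]|nj] := pselect (exists2 j, j \in s & I j t).
    rewrite (bigD1_seq j)//= [X in _ + X]big1 ?adde0.
      by rewrite indicE mem_set// mule1; exact: Kt.
    move=> i ij; rewrite indicE memNset ?mule0// => it.
    have lt1 (k l : int) : (k < l)%R -> ~ (I k t /\ I l t).
      move=> kl [] ; rewrite /I /= !in_itv/= => /andP[_ tk] /andP[lt _].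
      have := lt_le_trans tk (le_trans _ lt); rewrite ltxx => H.
      suff /H : (2 `^ (k%:~R + 1) <= 2 `^ l%:~R :> R)%R by [].
      by rewrite ler_powR ?ler1n// -(intrD _ k 1) ler_int lezD1.
    by case: (ltgtP i j) ij => // [/lt1|/lt1] H _; apply: H.
  rewrite big_seq big1 ?mule_ge0 ?poweR_ge0 ?lee_fin ?invr_ge0 ?(ltW t0)// => j js.
  by rewrite indicE memNset ?mule0// => jt; apply: nj; exists j.
have g0 t : `]0%R, +oo[%classic t -> 0 <= g t.
  by move=> _; apply: sume_ge0 => j _; rewrite mule_ge0.
apply: le_trans (lee_wpmul2l _ (ge0_le_integral_minorant g0 gf)); last by rewrite lee_fin.
rewrite gint ge0_sume_distrr//; last by move=> j _; rewrite mule_ge0// lee_fin ltW.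
apply: lee_sum => j _; rewrite /c muleAC muleA -!EFinM.
apply: lee_wpmul2r => //; rewrite lee_fin.
have -> : (4 * (2 `^ (- ((j%:~R + 1) * theta)) * 2 `^ (- (j%:~R + 1)) * 2 `^ j%:~R) =
    2 * 2 `^ (- theta) * 2 `^ (- (j%:~R * theta)) :> R)%R.
  have [eq1 eq2] : (- ((j%:~R + 1) * theta) = - (j%:~R * theta) + - theta)%R /\ (- (j%:~R + 1) = - j%:~R + - (1 : R))%R.
    by split; ring.
  rewrite eq1 eq2 !two_D powR_inv1// [(2 `^ (- j%:~R))%R]powRN.
  by field; rewrite gt_eqF ?two_gt0.
rewrite ler_peMl ?(ltW (two_gt0 _))// -[X in (X <= _)%R](mulfV (_ : 2 != 0 :> R)%R) ?pnatr_eq0//.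
rewrite ler_wpM2l// -[leLHS]powR_inv1// ler_powR ?ler1n// lerN2//.
Qed.

Lemma K_functional_mono (E : zmodType) (eqv : E -> E -> Prop) (X0 X1 : set E)
    (N0 N1 : E -> \bar R) (f : E) (u t : R) : (forall e, 0 <= N1 e) -> (u <= t)%R ->
  K_functional eqv X0 X1 N0 N1 u f <= K_functional eqv X0 X1 N0 N1 t f.
Proof.
move=> N10 ut; apply: le_ereal_inf_tmp => _ [f0 [f1 [Xf0 Xf1 ff ->]]].
apply: ereal_inf_le => /=; exists (N0 f0 + u%:E * N1 f1); first by exists f0, f1.
by apply: leeD2l; apply: lee_wpmul2r.
Qed.

End interpolation_sum.

(** * Pairings with Schwartz functions *)

Section schwartz_pairing.
Context {R : realType} {d : nat}.
Local Notation C := R[i].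
Local Notation V := 'rV[R]_d.
Local Notation mu := (lebesgue_rV d).

Lemma schwartz_norm_ge N (psi : V -> C) (S : R) x : (schwartz_norm N psi <= S%:E)%E ->
  Normc.normc (psi x) <= S * wt N x.
Proof.
move=> HS; rewrite /wt -ler_pdivrMr ?invr_gt0 ?exprn_gt0 ?ltr_pwDl// invrK.
rewrite -lee_fin; apply: le_trans HS.
apply: (@le_trans _ _ ((1 + enorm x) ^+ N * Normc.normc (psi x))%:E).
  rewrite lee_fin mulrC ler_wpM2r ?sqrtr_ge0//; last first.
    rewrite lerXn2r ?nnegrE ?addr_ge0 ?enorm_ge0// lerD2l; exact: norm_le_enorm.
  by case: (psi x) => a b; exact: sqrtr_ge0.
apply: ereal_sup_ubound; exists [::], x; split => //.
by rewrite /cpderiv /=; case: (psi x).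
Qed.

Lemma schwartz_norm_fin N (psi : V -> C) : schwartz psi ->
  schwartz_norm N psi = (fine (schwartz_norm N psi))%:E /\ 0 <= fine (schwartz_norm N psi).
Proof.
move=> [_ /(_ N) Hoo].
have H0 : (0 <= schwartz_norm N psi)%E.
  apply: (@le_trans _ _ ((1 + enorm (0 : V)) ^+ N * Normc.normc (cpderiv [::] psi 0))%:E).
    rewrite lee_fin mulr_ge0 ?exprn_ge0 ?addr_ge0 ?enorm_ge0//.
    by case: (cpderiv _ _ _) => a b; exact: sqrtr_ge0.
  by apply: ereal_sup_ubound; exists [::], 0.
by split; [rewrite fineK// ge0_fin_numE|exact: fine_ge0].
Qed.

Lemma schwartz_rapid (psi : V -> C) : schwartz psi ->
  rapid (fun x => complex.Re (psi x)) /\ rapid (fun x => complex.Im (psi x)).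
Proof.
move=> sp; have [[sr si] _] := sp.
have key n x : Normc.normc (psi x) <= fine (schwartz_norm n psi) * wt n x.
  have [E _] := schwartz_norm_fin n sp.
  by apply: schwartz_norm_ge; rewrite -E.
split; split; [exact: smooth_measurable| |exact: smooth_measurable|] => n;
  have [_ S0] := schwartz_norm_fin n sp; exists (fine (schwartz_norm n psi)) => // x;
  apply: le_trans (key n x).
- exact: Re_le_normc.
- exact: Im_le_normc.
Qed.

Definition cwt_integrable (f : V -> C) := wt_integrable (fun x => complex.Re (f x)) /\
  wt_integrable (fun x => complex.Im (f x)).

Lemma pairingE (f psi : V -> C) : cwt_integrable f -> schwartz psi ->
  pairing f psi =
  (\int[mu]_x (complex.Re (f x) * complex.Re (psi x)) -
   \int[mu]_x (complex.Im (f x) * complex.Im (psi x))) +i*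
  (\int[mu]_x (complex.Re (f x) * complex.Im (psi x)) +
   \int[mu]_x (complex.Im (f x) * complex.Re (psi x))).
Proof.
move=> [fr fi] /schwartz_rapid[pr pi'].
apply: pairing_normc; try exact: wt_integrable_rapid.
- by move=> x; case: (f x).
- by move=> x; case: (psi x).
Qed.

Lemma pairing_integrable (f psi : V -> C) : cwt_integrable f -> schwartz psi ->
  cintegrable_on setT (fun x => f x * psi x).
Proof.
move=> [fr fi] /schwartz_rapid[pr pi'].
have i1 := wt_integrable_rapid fr pr. have i2 := wt_integrable_rapid fi pi'.
have i3 := wt_integrable_rapid fr pi'. have i4 := wt_integrable_rapid fi pr.
split.
  have := integrable_subr i1 i2; apply: eq_integrable => // x _ /=.
  by case: (f x) (psi x) => a b [a' b'].
have := integrable_addr i3 i4; apply: eq_integrable => // x _ /=.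
by case: (f x) (psi x) => a b [a' b'].
Qed.

Lemma wt_pairing_le (h u : V -> R) (S : R) : wt_integrable h -> measurable_fun setT u ->
  (forall x, `|u x| <= S * wt d.*2.+1 x) ->
  `|\int[mu]_x (h x * u x)| <= S * \int[mu]_x `|h x * wt d.*2.+1 x|.
Proof.
move=> [mh hi] mu' uS.
have hu x : `|h x * u x| <= S * `|h x * wt d.*2.+1 x|.
  by rewrite !normrM (ger0_norm (wt_ge0 _ _)) mulrCA ler_wpM2l.
have hn := integrable_normr hi.
have hui : mu.-integrable setT (EFin \o (fun x => h x * u x)).
  by apply: (integrable_le _ hu); [exact: measurable_funM|exact: integrable_scaler].
rewrite (le_trans (le_normr_Rintegral _ hui))// -RintegralZl//.
by apply: le_Rintegral => //; [exact: integrable_normr hui|exact: integrable_scaler].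
Qed.

(** The Schwartz norm of order 2 d + 1 gives psi the decay of the weight against which f is
    integrable. *)
Lemma pairing_dual (f : V -> C) : cwt_integrable f -> schwartz_infty_dual (pairing f).
Proof.
move=> wf; have [wr wi] := wf; split.
  move=> [a b] u v [su _] [sv _].
  have [ur ui] := schwartz_rapid su; have [vr vi] := schwartz_rapid sv.
  have rL (k1 k2 k3 : V -> R) (c1 c2 : R) : rapid k1 -> rapid k2 -> rapid k3 ->
      rapid (fun x => c1 * k1 x + c2 * k2 x + k3 x).
    by move=> r1 r2 r3; apply: rapidD => //; apply: rapidD; exact: rapidZ.
  have L (h k1 k2 k3 : V -> R) (c1 c2 : R) : wt_integrable h ->
      rapid k1 -> rapid k2 -> rapid k3 ->
      \int[mu]_x (h x * (c1 * k1 x + c2 * k2 x + k3 x)) =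
      c1 * \int[mu]_x (h x * k1 x) + c2 * \int[mu]_x (h x * k2 x) + \int[mu]_x (h x * k3 x).
    move=> hw r1 r2 r3.
    have i1 := wt_integrable_rapid hw r1. have i2 := wt_integrable_rapid hw r2.
    have i3 := wt_integrable_rapid hw r3.
    have i12 := integrable_addr (integrable_scaler c1 i1) (integrable_scaler c2 i2).
    rewrite -RintegralZl// -RintegralZl// -RintegralD//; [|exact: integrable_scaler..].
    rewrite -RintegralD//.
    by apply: eq_Rintegral => x _; ring.
  pose p1 x := a * complex.Re (u x) + (- b) * complex.Im (u x) + complex.Re (v x).
  pose p2 x := a * complex.Im (u x) + b * complex.Re (u x) + complex.Im (v x).
  rewrite (@pairing_normc _ _ f (fun x => (a +i* b) * u x + v x)
    (fun x => complex.Re (f x)) (fun x => complex.Im (f x)) p1 p2); last 6 first.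
  - by move=> x; case: (f x).
  - move=> x; rewrite /p1 /p2; case: (u x) (v x) => u1 u2 [v1 v2] /=.
    by apply/eqP; rewrite eq_complex /=; apply/andP; split; apply/eqP; ring.
  - by apply: wt_integrable_rapid => //; exact: rL.
  - by apply: wt_integrable_rapid => //; exact: rL.
  - by apply: wt_integrable_rapid => //; exact: rL.
  - by apply: wt_integrable_rapid => //; exact: rL.
  rewrite /p1 /p2 !L// !pairingE//.
  by apply/eqP; rewrite eq_complex /=; apply/andP; split; apply/eqP; ring.
pose I (h : V -> R) := \int[mu]_x `|h x * wt d.*2.+1 x|.
have I0 h : 0 <= I h by apply: Rintegral_ge0.
(* Each part of f meets both parts of psi, whence the factor 2. *)
pose c := 2 * (I (fun x => complex.Re (f x)) + I (fun x => complex.Im (f x))).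
exists d.*2.+1, c => psi [sp _].
have [E S0] := schwartz_norm_fin d.*2.+1 sp.
rewrite E -EFinM lee_fin pairingE//.
set S := fine _ in E S0 *.
have [pr pi'] := schwartz_rapid sp.
have br x : `|complex.Re (psi x)| <= S * wt d.*2.+1 x.
  by rewrite (le_trans (Re_le_normc _))// schwartz_norm_ge// E.
have bi x : `|complex.Im (psi x)| <= S * wt d.*2.+1 x.
  by rewrite (le_trans (Im_le_normc _))// schwartz_norm_ge// E.
rewrite (le_trans (normc_le _ _))//.
rewrite (le_trans (lerD (ler_normB _ _) (ler_normD _ _)))//.
have H1 := wt_pairing_le wr pr.1 br. have H2 := wt_pairing_le wi pi'.1 bi.
have H3 := wt_pairing_le wr pi'.1 bi. have H4 := wt_pairing_le wi pr.1 br.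
rewrite (le_trans (lerD (lerD H1 H2) (lerD H3 H4)))// /c /I.
by rewrite le_eqVlt; apply/orP; left; apply/eqP; ring.
Qed.

End schwartz_pairing.

(** * The embedding and its injectivity *)

Section embedding.
Context {R : realType} {d : nat}.
Local Notation C := R[i].
Local Notation V := 'rV[R]_d.
Local Notation mu := (lebesgue_rV d).
Variables (phi : V -> C) (p : R).
Hypotheses (phiP : dyadic_cutoff phi) (p_gt1 : 1 < p).

Let p_gt0 : 0 < p. Proof. by rewrite (lt_trans _ p_gt1). Qed.

Lemma K_VBV_ge0 (t : R) (f : V -> C) : 0 <= t -> (0 <= K_VBV t f)%E.
Proof.
move=> t0; apply: le_ereal_inf_tmp => _ [f0 [f1 [_ _ _ ->]]].
by rewrite adde_ge0 ?Vinfty_norm_ge0// mule_ge0 ?BVdot_norm_ge0.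
Qed.

Lemma VBV_normE (f : V -> C) : VBV_norm p^-1 1 f =
  (\int[lebesgue_measure]_(t in `]0%R, +oo[)
    (((t `^ (- p^-1))%:E * K_VBV t f) `^ 1 * (t^-1)%:E))%E.
Proof.
rewrite /VBV_norm /interp_norm invr1 poweRe1//.
apply: integral_ge0 => t /=; rewrite in_itv/= andbT => t0.
by rewrite mule_ge0 ?poweR_ge0// lee_fin invr_ge0 ltW.
Qed.

Lemma VBV_norm_ge0 (f : V -> C) : (0 <= VBV_norm p^-1 1 f)%E.
Proof.
rewrite VBV_normE; apply: integral_ge0 => t /=; rewrite in_itv/= andbT => t0.
by rewrite mule_ge0 ?poweR_ge0// lee_fin invr_ge0 ltW.
Qed.

Lemma VBV_dyadic_sum (f : V -> C) (s : seq int) : uniq s ->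
  (\sum_(j <- s) (2 `^ (- (j%:~R / p)))%:E * K_VBV (2 `^ j%:~R) f <=
   4%:E * VBV_norm p^-1 1 f)%E.
Proof.
move=> us; rewrite VBV_normE.
have th : 0 <= p^-1 <= 1 by rewrite invr_ge0 (ltW p_gt0)/= invf_le1// ltW.
(* [dyadic_sum_le_integral] wants a function nonnegative on the whole line, so the K-functional is
   replaced by 0 for t <= 0. *)
pose K (t : R) : \bar R := if 0 < t then K_VBV t f else 0%E.
have two_gt0 (j : int) : 0 < 2 `^ j%:~R :> R by rewrite powR_gt0.
rewrite (eq_bigr (fun j => (2 `^ (- (j%:~R * p^-1)))%:E * K (2 `^ j%:~R)%R)%E); last first.
  by move=> j _; rewrite /K two_gt0.
apply: (@le_trans _ _ (4%:E * \int[lebesgue_measure]_(t in `]0%R, +oo[)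
    (((t `^ (- p^-1))%:E * K t) `^ 1 * (t^-1)%:E))%E).
  apply: dyadic_sum_le_integral => //.
  - by move=> t; rewrite /K; case: ltP => // t0; apply: K_VBV_ge0; exact: ltW.
  - move=> u t u0 ut; rewrite /K u0 (lt_le_trans u0 ut).
    by apply: K_functional_mono => // e; exact: BVdot_norm_ge0.
rewrite le_eqVlt; apply/orP; left; apply/eqP; congr (_ * _)%E.
by apply: eq_integral => t; rewrite inE /= in_itv/= andbT /K => ->.
Qed.

Section fixed_function.
Variable f : V -> C.
Hypothesis fVBV : VBV_space p^-1 1 f.

Let N : R := fine (VBV_norm p^-1 1 f).
Let NE : VBV_norm p^-1 1 f = N%:E.
Proof. by rewrite fineK// ge0_fin_numE ?VBV_norm_ge0//; case: fVBV => _ []. Qed.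

Definition dyadic_K (j : int) : R := fine (K_VBV (2 `^ j%:~R) f).

(** A single term of the dyadic sum is finite and its weight is positive, so the K-functional is
    finite at 2^j. *)
Lemma dyadic_KE j : K_VBV (2 `^ j%:~R) f = (dyadic_K j)%:E.
Proof.
have K0 : (0 <= K_VBV (2 `^ j%:~R) f)%E by apply: K_VBV_ge0; exact: powR_ge0.
rewrite fineK// ge0_fin_numE//.
have := @VBV_dyadic_sum f [:: j] isT; rewrite big_seq1 NE -EFinM.
have t0 : (0 < 2 `^ (- (j%:~R / p)) :> R) by rewrite powR_gt0.
move: K0; case: (K_VBV _ f) => // [r|_]; first by rewrite ltry.
by rewrite gt0_muley// leye_eq.
Qed.

Lemma dyadic_K_ge0 j : 0 <= dyadic_K j.
Proof. by rewrite fine_ge0// K_VBV_ge0// powR_ge0. Qed.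

Lemma dyadic_K_sum (s : seq int) : uniq s ->
  \sum_(j <- s) 2 `^ (- (j%:~R / p)) * dyadic_K j <= 4 * N.
Proof.
move=> us; have := VBV_dyadic_sum f us; rewrite NE -EFinM -lee_fin.
congr (is_true (_ <= _)%E); rewrite -sumEFin.
by apply: eq_bigr => j _; rewrite dyadic_KE -EFinM.
Qed.

Lemma VBV_split : exists A M : R, [/\ 0 <= A, 0 <= M & split_bound f A M].
Proof.
have [B B0 HB] := K_split_bound (low_cutoff_cutoff phiP).
have A0 : 0 <= dyadic_K 0 + 1 by rewrite addr_ge0 ?dyadic_K_ge0.
(* One decomposition, at t = 1, is enough for qualitative integrability; adding 1 makes the
   inequality on K strict. *)
exists (dyadic_K 0 + 1), (B * ((dyadic_K 0 + 1) / 2 `^ 0%:~R)); split => //.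
  by rewrite mulr_ge0 ?(ltW B0)// divr_ge0 ?powR_ge0.
apply: HB; first exact: powR_gt0.
by rewrite dyadic_KE lte_fin ltrDl.
Qed.

Lemma VBV_wt_integrable : cwt_integrable f.
Proof.
have [A [M [_ _ fAM]]] := VBV_split; have [mf _] := fVBV.
exact: split_bound_wt_integrable phiP _ _ _ mf fAM.
Qed.

End fixed_function.

Lemma besov_norm_le (gamma : R) : gamma + 1 != 0 -> exists2 c : R, 0 <= c &
  forall f, VBV_space p^-1 1 f ->
    (besov_norm phi p^-1 p gamma (pairing f) <= c%:E * VBV_norm p^-1 1 f)%E.
Proof.
move=> g0.
have [B1 B10 HB] := K_split_bound (low_cutoff_cutoff phiP).
have [kappa [B2 [kappa0 B20 HL]]] := lp_level phiP.
have [C0 C00 HC] := dyadic_sum_bound g0 p_gt1.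
(* In [lp_level] with M = B1 kappa tau / 2^j the level tau cancels, leaving B2 B1 kappa 2^-k
   2^-j. *)
pose beta := B2 * B1 * kappa.
have beta0 : 0 <= beta by rewrite !mulr_ge0 ?(ltW B10) ?(ltW kappa0).
(* This is lam times the p-th root of C0 beta (4 N / (kappa lam))^p, divided by N; the 4 is the
   constant of the dyadic sum. *)
pose c := 4 * (C0 * beta) `^ p^-1 / kappa.
exists c; first by rewrite divr_ge0 ?(ltW kappa0)// mulr_ge0 ?powR_ge0.
move=> f fV; set N := fine (VBV_norm p^-1 1 f).
have NE : VBV_norm p^-1 1 f = N%:E.
  by rewrite fineK// ge0_fin_numE ?VBV_norm_ge0//; case: fV => _ [].
have N0 : 0 <= N by rewrite fine_ge0 ?VBV_norm_ge0.
have mf : cmeasurable f by case: fV.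
apply: ge_ereal_sup => _ [lam /= lam0 <-].
have {}lam0 : 0 < lam by move: lam0; rewrite in_itv/= andbT.
pose tau (k : int) : R := lam * 2 `^ (- (k%:~R * (gamma + 1) / p)).
have tau0 k : 0 < tau k by rewrite mulr_gt0 ?powR_gt0.
pose E (k : int) := [set x | tau k < Normc.normc (lp_piece phi k (pairing f) x)].
have two_gt0 (j : int) : 0 < 2 `^ j%:~R :> R by rewrite powR_gt0.
have level k j : dyadic_K f j < kappa * tau k ->
    (mu (E k) <= (beta * 2 `^ (- k%:~R) * 2 `^ (- j%:~R))%:E)%E.
  move=> jk.
  have KX : (K_VBV (2 `^ j%:~R) f < (kappa * tau k)%:E)%E by rewrite dyadic_KE.
  have kt0 : 0 <= kappa * tau k by rewrite mulr_ge0 ?(ltW kappa0) ?(ltW (tau0 k)).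
  have sb := HB _ _ _ (two_gt0 j) KX.
  have := HL f k _ _ (tau k) mf sb kt0 _ (tau0 k) (lexx _).
  rewrite mulr_ge0 ?(ltW B10) ?divr_ge0 ?(ltW (two_gt0 j))// => /(_ isT) /le_trans; apply.
  rewrite lee_fin -powR_intmul// !powRN /beta le_eqVlt; apply/orP; left; apply/eqP.
  by field; rewrite !gt_eqF ?powR_gt0.
pose m k := fine (mu (E k)).
have S1 j : 2 `^ (- (j%:~R / p)) * dyadic_K f j <= 4 * N.
  by have := dyadic_K_sum fV (s := [:: j]) isT; rewrite big_seq1.
(* The level sets have finite measure: [dyadic_small] provides a j for which [level] applies. *)
have mE k : mu (E k) = (m k)%:E.
  have [j jk] : exists j, dyadic_K f j < kappa * tau k.
    by apply: (dyadic_small p_gt1 S1); rewrite mulr_gt0.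
  by rewrite fineK// ge0_fin_numE// (le_lt_trans (level k j jk))// ltry.
have main (s : seq int) : uniq s ->
    \sum_(k <- s) 2 `^ (- (k%:~R * gamma)) * m k <= C0 * beta * (4 * N / (kappa * lam)) `^ p.
  move=> us; have -> : gamma = gamma + 1 - 1 by rewrite addrK.
  apply: (HC (dyadic_K f)) => //.
  - exact: dyadic_K_ge0.
  - by move=> k; exact: fine_ge0.
  - by move=> s' us'; exact: (dyadic_K_sum fV us').
  - by move=> k j /level; rewrite mE lee_fin.
set X := C0 * beta * (4 * N / (kappa * lam)) `^ p in main.
have X0 : 0 <= X by rewrite mulr_ge0 ?powR_ge0// mulr_ge0.
have sumX : (\esum_(k in [set: int]) ((2 `^ (- (k%:~R * gamma)))%:E *
       mu [set x | (lam * 2 `^ (- (k%:~R * (p^-1 + gamma / p))) <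
                    Normc.normc (lp_piece phi k (pairing f) x))%R]) <= X%:E)%E.
  apply: ge_ereal_sup => _ [A [finA _] <-].
  rewrite fsbig_finite//=.
  rewrite (eq_bigr (fun k => (2 `^ (- (k%:~R * gamma)) * m k)%:E)).
    by rewrite sumEFin lee_fin; apply: main; exact: finmap.fset_uniq.
  move=> k _; rewrite EFinM -mE /E /tau.
  by rewrite (_ : k%:~R * (gamma + 1) / p = k%:~R * (p^-1 + gamma / p))//; ring.
rewrite NE -EFinM.
apply: (@le_trans _ _ (lam%:E * (X%:E `^ p^-1))%E).
  apply: lee_wpmul2l; first by rewrite lee_fin ltW.
  apply: gt0_ler_poweR => //; first by rewrite invr_ge0 ltW.
    by rewrite in_itv/= leey andbT esum_ge0// => k _; rewrite mule_ge0// lee_fin powR_ge0.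
  by rewrite in_itv/= leey andbT lee_fin.
rewrite poweR_EFin -EFinM lee_fin /X powRM ?powR_ge0 ?(mulr_ge0 C00 beta0)//.
have q0 : 0 <= 4 * N / (kappa * lam) by rewrite divr_ge0 ?mulr_ge0 ?(ltW kappa0) ?(ltW lam0).
rewrite -powRrM mulfV ?gt_eqF// powRr1// /c le_eqVlt; apply/orP; left; apply/eqP.
by field; rewrite !gt_eqF.
Qed.

Lemma translation_boundB (a b : V -> R) (M1 M2 : R) : translation_bound a M1 ->
  translation_bound b M2 -> translation_bound (fun x => a x - b x) (M1 + M2).
Proof.
move=> [la aM] [lb bM]; split; first exact: loc_integrableB.
move=> h; have ms (e : V -> R) : loc_integrable e ->
    measurable_fun setT (fun x : V => `|e (x + h) - e x|%:E).
  move=> le; apply/measurable_EFinP; apply: measurableT_comp => //.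
  by apply: measurable_funB; [case: (loc_integrable_shift h le)|case: le].
apply: (@le_trans _ _ (\int[mu]_x (`|a (x + h) - a x|%:E + `|b (x + h) - b x|%:E))%E).
  apply: ge0_le_integral => //.
  - by apply: ms; exact: loc_integrableB.
  - by apply: emeasurable_funD; exact: ms.
  move=> x _; rewrite -EFinD lee_fin.
  rewrite (_ : a (x + h) - b (x + h) - (a x - b x) =
    (a (x + h) - a x) - (b (x + h) - b x)); last by ring.
  exact: ler_normB.
rewrite ge0_integralD//; [|exact: ms..].
by rewrite mulrDl EFinD; apply: leeD.
Qed.

(** The difference f - g has a decomposition of the same kind, so [annihilated_cst] applies to its
    real and imaginary parts, tested with the real functions [ft th u]. *)
Lemma VBV_pairing_inj (f g : V -> C) : (0 < d)%N ->
  VBV_space p^-1 1 f -> VBV_space p^-1 1 g ->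
  (forall psi, schwartz_infty psi -> pairing f psi = pairing g psi) -> eq_mod_const f g.
Proof.
move=> d0 fV gV fg.
have cc := low_cutoff_cutoff phiP.
have [A1 [M1 [A10 M10 [ar [ai [Tr Ti Er Ei]]]]]] := VBV_split fV.
have [A2 [M2 [A20 M20 [br [bi [Sr Si Fr Fi]]]]]] := VBV_split gV.
have wf := VBV_wt_integrable fV; have wg := VBV_wt_integrable gV.
have wB (h k : V -> R) : wt_integrable h -> wt_integrable k -> wt_integrable (fun x => h x - k x).
  move=> [mh hi] [mk ki]; split; first exact: measurable_funB.
  have := integrable_subr hi ki; apply: eq_integrable => // x _ /=.
  by rewrite mulrBl.
have aeB (h k a b : V -> R) : {ae mu, forall x, `|h x - a x| <= A1} ->
    {ae mu, forall x, `|k x - b x| <= A2} ->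
    {ae mu, forall x, `|(h x - k x) - (a x - b x)| <= A1 + A2}.
  apply: filterS2 => x hx kx.
  rewrite (_ : h x - k x - (a x - b x) = (h x - a x) - (k x - b x)); last by ring.
  by rewrite (le_trans (ler_normB _ _))// lerD.
have A0 : 0 <= A1 + A2 by rewrite addr_ge0.
have pE (f' : V -> C) th u : cwt_integrable f' -> btest u -> (\forall xi \near (0 : V), u xi = 0) ->
    pairing f' (fun x => (ft th u x)%:C) =
    (\int[mu]_x (complex.Re (f' x) * ft th u x)) +i* (\int[mu]_x (complex.Im (f' x) * ft th u x)).
  move=> wf' bu u0; rewrite pairingE//; last by case: (schwartz_infty_ft cc th bu u0).
  rewrite /=; congr (_ +i* _).
    rewrite [X in _ - X](_ : _ = 0) ?subr0//.
    by rewrite /Rintegral integral0_eq// => x _; rewrite mulr0.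
  rewrite [X in X + _](_ : _ = 0) ?add0r//.
  by rewrite /Rintegral integral0_eq// => x _; rewrite mulr0.
have an th u : btest u -> (\forall xi \near (0 : V), u xi = 0) ->
    \int[mu]_x ((complex.Re (f x) - complex.Re (g x)) * ft th u x) = 0 /\
    \int[mu]_x ((complex.Im (f x) - complex.Im (g x)) * ft th u x) = 0.
  move=> bu u0; have := fg _ (schwartz_infty_ft cc th bu u0).
  rewrite !pE// => -[e1 e2].
  have ru := ft_rapid cc th bu.
  have i1 := wt_integrable_rapid wf.1 ru. have i2 := wt_integrable_rapid wf.2 ru.
  have i3 := wt_integrable_rapid wg.1 ru. have i4 := wt_integrable_rapid wg.2 ru.
  split.
    transitivity (\int[mu]_x (complex.Re (f x) * ft th u x - complex.Re (g x) * ft th u x)).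
      by apply: eq_Rintegral => x _; rewrite mulrBl.
    by rewrite RintegralB// e1 subrr.
  transitivity (\int[mu]_x (complex.Im (f x) * ft th u x - complex.Im (g x) * ft th u x)).
    by apply: eq_Rintegral => x _; rewrite mulrBl.
  by rewrite RintegralB// e2 subrr.
have [cr Hr] := annihilated_cst cc (wB _ _ wf.1 wg.1) (fun th u bu u0 => (an th u bu u0).1)
  d0 A0 (translation_boundB Tr Sr) (aeB _ _ _ _ Er Fr).
have [ci Hi] := annihilated_cst cc (wB _ _ wf.2 wg.2) (fun th u bu u0 => (an th u bu u0).2)
  d0 A0 (translation_boundB Ti Si) (aeB _ _ _ _ Ei Fi).
exists (cr +i* ci); apply: filterS2 Hr Hi => x.
case: (f x) (g x) => a1 a2 [b1 b2] /= <- <-.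
by apply/eqP; rewrite eq_complex /=; apply/andP; split; apply/eqP; ring.
Qed.
End embedding.

Theorem theorem1p8 (R : realType) (d : nat) (d_gt0 : (0 < d)%N)
    (phi : 'rV[R]_d -> R[i]) (phi_cutoff : dyadic_cutoff phi)
    (gamma p : R) (gammaN : gamma \notin `[-1, 0]) (p_gt1 : 1 < p) :
  [/\ forall f : 'rV[R]_d -> R[i], VBV_space p^-1 1 f ->
        (forall psi, schwartz_infty psi ->
          cintegrable_on setT (fun x => f x * psi x)) /\
        besov phi p^-1 p gamma (pairing f),
      forall f g : 'rV[R]_d -> R[i], VBV_space p^-1 1 f -> VBV_space p^-1 1 g ->
        (forall psi, schwartz_infty psi -> pairing f psi = pairing g psi) ->
        eq_mod_const f g
    & exists c : R, forall f : 'rV[R]_d -> R[i], VBV_space p^-1 1 f ->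
        (besov_norm phi p^-1 p gamma (pairing f) <=
          c%:E * VBV_norm p^-1 1 f)%E].

Proof.
(* The ratio of the geometric series is not 1: gamma = -1 is an endpoint of the excluded
   interval. *)
have g0 : gamma + 1 != 0.
  apply: contraNneq gammaN => g1; have -> : gamma = -1 by lra.
  by rewrite in_itv/= lexx oppr_le0 ler01.
have [c c0 Hc] := besov_norm_le phi_cutoff p_gt1 g0.
split.
- move=> f fV; have wf := VBV_wt_integrable phi_cutoff p_gt1 fV; split.
    by move=> psi [sp _]; exact: pairing_integrable.
  split; first exact: pairing_dual.
  apply: (le_lt_trans (Hc f fV)); case: fV => _ [_ Noo].
  by rewrite lte_mul_pinfty// VBV_norm_ge0.
- by move=> f g fV gV; exact: (VBV_pairing_inj phi_cutoff p_gt1 d_gt0 fV gV).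
- by exists c.
Qed.
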